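(* Let $X(\mathbb{R}^n)$ be a Banach function space and let $\Omega\subseteq\mathbb{R}^n$ be a measurable set of infinite measure such that $X(\Omega)$ has the weak doubling property. If $a\in\mathcal{M}^0_{X(\mathbb{R}^n)}$, then \[ \|a\|_{L^\infty(\mathbb{R}^n)}\le \|W_\Omega(a)\|_{\mathcal{B}(X_2(\Omega),X(\Omega))}. \]
   Context: Banach function spaces. Let $\mathfrak{M}(\mathbb{R}^n)$ be the set of Lebesgue measurable complex-valued functions on $\mathbb{R}^n$ and $\mathfrak{M}^+(\mathbb{R}^n)$ the set of measurable functions on $\mathbb{R}^n$ with values in $[0,\infty]$. A mapping $\rho:\mathfrak{M}^+(\mathbb{R}^n)\to[0,\infty]$ is a Banach function norm if for all $f,g,f_k\in\mathfrak{M}^+(\mathbb{R}^n)$ ($k\in\mathbb{N}$), all constants $c\ge 0$ and all measurable $E\subseteq\mathbb{R}^n$: (A1) $\rho(f)=0\Leftrightarrow f=0$ a.e., $\rho(cf)=c\rho(f)$, $\rho(f+g)\le\rho(f)+\rho(g)$; (A2) $0\le g\le f$ a.e. implies $\rho(g)\le\rho(f)$; (A3) $0\le f_k\uparrow f$ a.e. implies $\rho(f_k)\uparrow\rho(f)$; (A4) if $E$ is bounded, then $\rho(\chi_E)<\infty$; (A5) if $E$ is bounded, then $\int_E f(x)\,dx\le C_E\,\rho(f)$ with a constant $C_E\in(0,\infty)$ that may depend on $E$ and $\rho$ but not on $f$. The Banach function space $X(\mathbb{R}^n)$ generated by $\rho$ is the set of $f\in\mathfrak{M}(\mathbb{R}^n)$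 (functions equal a.e. being identified) with $\|f\|_{X(\mathbb{R}^n)}:=\rho(|f|)<\infty$. Spaces on $\Omega$. For a measurable set $\Omega\subseteq\mathbb{R}^n$ of positive measure, $r_\Omega$ is the operator of restriction from $\mathbb{R}^n$ to $\Omega$, $e_\Omega$ is the operator of extension by $0$ from $\Omega$ to $\mathbb{R}^n$, and $X(\Omega)$ is the space of measurable $f:\Omega\to\mathbb{C}$ with $\|f\|_{X(\Omega)}:=\|e_\Omega f\|_{X(\mathbb{R}^n)}<\infty$. $X_2(\Omega)$ is the closure of $L^2(\Omega)\cap X(\Omega)$ in $X(\Omega)$. Multipliers and Wiener-Hopf type operators. $F$ is the Fourier transform, $(Fu)(\xi)=\int_{\mathbb{R}^n}u(x)e^{-ix\xi}\,dx$ for Schwartz functions $u$, and $F^{-1}$ is its inverse; both are extended by continuity to $L^2(\mathbb{R}^n)$. $\mathcal{M}^0_{X(\mathbb{R}^n)}$ is the set of $a\in L^\infty(\mathbb{R}^n)$ such that \[ \sup\left\{\frac{\|F^{-1}aFu\|_{X(\mathbb{R}^n)}}{\|u\|_{X(\mathbb{R}^n)}}: u\in (L^2(\mathbb{R}^n)\cap X(\mathbb{R}^n))\setminus\{0\}\right\}<\infty . \] For $a\in\mathcal{M}^0_{X(\mathbb{R}^n)}$, $W_\Omega(a)u:=r_\Omega F^{-1}aFe_\Omega u$ for $u\in L^2(\Omega)\cap X(\Omega)$; this operator is bounded in the norm of $X(\Omega)$, and $W_\Omega(a)$ also denotes its extension by continuity to a bounded linear operator from $X_2(\Omega)$ to $X(\Omega)$.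 $\mathcal{B}(\mathcal{X},\mathcal{Y})$ is the Banach space of bounded linear operators from $\mathcal{X}$ to $\mathcal{Y}$ with the operator norm. Weak doubling property. $B(y,R)=\{x\in\mathbb{R}^n:|x-y|<R\}$. The space $X(\Omega)$ has the weak doubling property if there exists $\tau>1$ such that \[ D_{X(\Omega),\tau}:=\liminf_{R\to\infty}\left(\inf_{B(y,\tau R)\subseteq\Omega}\frac{\|\chi_{B(y,\tau R)}\|_{X(\Omega)}}{\|\chi_{B(y,R)}\|_{X(\Omega)}}\right)<\infty, \] where the infimum is over all $y$ with $B(y,\tau R)\subseteq\Omega$ (an infimum over the empty set being $+\infty$). *)

(* Defs.v *)
From HB Require Import structures.
From mathcomp Require Import all_boot all_order all_algebra.
From mathcomp Require Import complex.
From mathcomp Require Import all_classical all_reals all_analysis.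
From mathcomp Require Import measurable_realfun ess_sup_inf.

Set Implicit Arguments.
Unset Strict Implicit.
Unset Printing Implicit Defensive.

Import Order.TTheory GRing.Theory Num.Theory.
Import numFieldNormedType.Exports.

Local Open Scope classical_set_scope.
Local Open Scope complex_scope.
Local Open Scope ring_scope.

(* Lebesgue measure on R^n: the n-fold product of the one-dimensional Lebesgue
   measure, first on the sigma-algebra generated by the coordinates (that is,
   the Borel sets, [borel_lebesgue]), and then completed by the Caratheodory
   extension ([leb]), so that measurability on [Rn R n] is Lebesgue
   measurability. *)
Section borel.
Variables (R : realType) (n : nat).

Definition borelRn : Type := 'rV[R]_n.
HB.instance Definition _ := Pointed.copy borelRn 'rV[R]_n.

Definition borel_coord (i : 'I_n) (x : borelRn) : measurableTypeR R := x ord0 i.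

Let set0P : g_sigma_preimage borel_coord set0.
Proof. exact: sigma_algebra0. Qed.

Let setCP A : g_sigma_preimage borel_coord A -> g_sigma_preimage borel_coord (~` A).
Proof. exact: sigma_algebraC. Qed.

Let bigcupP (F : (set borelRn)^nat) : (forall i, g_sigma_preimage borel_coord (F i)) ->
  g_sigma_preimage borel_coord (\bigcup_i F i).
Proof. exact: sigma_algebra_bigcup. Qed.

Definition borelRn_display : measure_display.
Proof. by constructor. Qed.

HB.instance Definition _ := @isMeasurable.Build borelRn_display
  borelRn (g_sigma_preimage borel_coord) set0P setCP bigcupP.

Lemma measurable_coord i : measurable_fun [set: borelRn] (borel_coord i).
Proof.
move=> _ Y mY; rewrite setTI; apply: sub_sigma_algebra => /=.
rewrite -bigcup_seq/=; exists i => /=; first by rewrite mem_index_enum.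
by exists Y => //; rewrite setTI.
Qed.

Lemma measurable_to_borelRn d (T : measurableType d) (f : T -> borelRn) :
  (forall i, measurable_fun [set: T] (borel_coord i \o f)) ->
  measurable_fun [set: T] f.
Proof.
move=> mf _ A; move: A; apply: smallest_sub.
  split=> /=.
  - by rewrite preimage_set0 setI0.
  - by move=> A mA; rewrite setTI setTD -preimage_setC; apply: measurableC;
      rewrite setTI in mA.
  - move=> F mF; rewrite setTI preimage_bigcup; apply: bigcup_measurable => k _.
    by have := mF k; rewrite setTI.
move=> A; rewrite -bigcup_seq/= => -[i _] [B mB <-].
by rewrite setTI; have := mf i measurableT _ mB; rewrite !setTI.
Qed.
End borel.

Section product.
Variables (R : realType) (n : nat).

Definition consRn (p : measurableTypeR R * borelRn R n) : borelRn R n.+1 :=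
  row_mx (const_mx (p.1 : R)) p.2 : 'rV_(1 + n).

Definition unconsRn (x : borelRn R n.+1) : measurableTypeR R * borelRn R n :=
  ((x : 'rV_(1 + n)) ord0 (lshift n ord0), rsubmx (x : 'rV_(1 + n))).

Lemma unconsRnK : cancel unconsRn consRn.
Proof.
move=> x; rewrite /consRn /unconsRn/= -[RHS](@hsubmxK R 1 1 n x).
rewrite (_ : const_mx _ = @lsubmx R 1 1 n x)//.
by apply/rowP => i; rewrite !ord1 !mxE.
Qed.

Lemma consRnK : cancel consRn unconsRn.
Proof.
move=> [x y]; rewrite /consRn /unconsRn/= row_mxKr.
by rewrite row_mxEl !mxE.
Qed.

Lemma measurable_consRn : measurable_fun setT consRn.
Proof.
apply: measurable_to_borelRn => i; case: (@split_ordP 1 n i) => j ->.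
- rewrite (_ : _ \o _ = fst); first exact: measurable_fst.
  apply/funext => -[x y]; rewrite /borel_coord /consRn/=.
  by rewrite (@row_mxEl R 1 1 n) mxE.
- rewrite (_ : _ \o _ = @borel_coord R n j \o snd).
    by apply: measurableT_comp; [exact: measurable_coord|exact: measurable_snd].
  apply/funext => -[x y]; rewrite /borel_coord /consRn/=.
  by rewrite (@row_mxEr R 1 1 n).
Qed.

Lemma measurable_unconsRn : measurable_fun setT unconsRn.
Proof.
apply/measurable_fun_pairP; split.
  rewrite (_ : _ \o _ = @borel_coord R n.+1 (@lshift 1 n ord0)).
    exact: measurable_coord.
  by apply/funext => x.
apply: measurable_to_borelRn => i.
rewrite (_ : _ \o _ = @borel_coord R n.+1 (rshift 1 i)); first exact: measurable_coord.
by apply/funext => x; rewrite /borel_coord/= mxE.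
Qed.
End product.

Section borel_lebesgue.
Variable R : realType.

Section step.
Variables (n : nat) (mu : {sigma_finite_measure set (borelRn R n) -> \bar R}).

Definition prod_borel : set (borelRn R n.+1) -> \bar R :=
  pushforward (lebesgue_measure \x mu)%E (@consRn R n).

Let prod_borel0 : prod_borel set0 = 0%E.
Proof. by rewrite /prod_borel /pushforward preimage_set0 measure0. Qed.

Let prod_borel_ge0 A : (0 <= prod_borel A)%E.
Proof. by rewrite /prod_borel /pushforward; apply: integral_ge0. Qed.

Let prod_borel_sigma_additive : semi_sigma_additive prod_borel.
Proof.
move=> F mF tF mUF; rewrite /prod_borel /pushforward preimage_bigcup.
have mpre A : measurable A -> measurable (@consRn R n @^-1` A).
  by move=> mA; rewrite -[X in measurable X]setTI; exact: measurable_consRn.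
apply: measure_semi_sigma_additive.
- by move=> k; exact: mpre (mF k).
- by apply/trivIsetP => /= i j _ _ ij; rewrite -preimage_setI;
    move/trivIsetP : tF => /(_ _ _ I I ij) ->; rewrite preimage_set0.
- by rewrite -preimage_bigcup; exact: mpre mUF.
Qed.

HB.instance Definition _ := isMeasure.Build _ _ _ prod_borel
  prod_borel0 prod_borel_ge0 prod_borel_sigma_additive.

Let prod_borel_sigma_finite : sigma_finite setT prod_borel.
Proof.
have /sigma_finiteP[F [TF ndF Foo]] := sigma_finiteT (@lebesgue_measure R).
have /sigma_finiteP[G [TG ndG Goo]] := sigma_finiteT mu.
exists (fun k => @unconsRn R n @^-1` (F k `*` G k)).
  rewrite -preimage_bigcup -[LHS](@preimage_setT _ _ (@unconsRn R n)).
  congr (_ @^-1` _); rewrite -setXTT TF TG predeqE => -[x y]; split.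
    move=> [/= [i _ Fix] [j _ Gjy]]; exists (maxn i j) => //; split.
    - by move: x Fix; exact/subsetPset/ndF/leq_maxl.
    - by move: y Gjy; exact/subsetPset/ndG/leq_maxr.
  by move=> [i _ []/= ? ?]; split; exists i.
move=> k; have [mF Fk] := Foo k; have [mG Gk] := Goo k; split.
  by rewrite -[X in measurable X]setTI; apply: measurable_unconsRn => //;
    exact: measurableX.
rewrite /prod_borel /pushforward -comp_preimage.
rewrite (_ : _ \o _ = id); last by apply/funext => x /=; rewrite consRnK.
rewrite preimage_id product_measure1E// lte_mul_pinfty// ge0_fin_numE//.
Qed.

HB.instance Definition _ := Measure_isSigmaFinite.Build _ _ _ prod_borel
  prod_borel_sigma_finite.
End step.

Fixpoint borel_lebesgue (n : nat) :
    {sigma_finite_measure set (borelRn R n) -> \bar R} :=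
  match n with
  | 0 => dirac ((0 : 'rV[R]_0) : borelRn R 0)
  | m.+1 => prod_borel (borel_lebesgue m)
  end.
End borel_lebesgue.

Definition Rn (R : realType) (n : nat) : Type := 'rV[R]_n.

HB.instance Definition _ (R : realType) n := NormedModule.copy (Rn R n) 'rV[R]_n.
HB.instance Definition _ (R : realType) n := Measurable.copy (Rn R n)
  (caratheodory_type (mu_ext (borel_lebesgue R n))).

Definition leb {R : realType} {n : nat} : set (Rn R n) -> \bar R :=
  @completed_measure_extension _ _ _ (borel_lebesgue R n).
HB.instance Definition _ (R : realType) n := Measure.on (@leb R n).

Section analysis.
Variables (R : realType) (n : nat).
Implicit Types (x y xi : Rn R n) (u v f : Rn R n -> R[i]).

(* The norm inherited by [Rn R n] from ['rV[R]_n] is the sup norm; it has the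
   same topology and bounded sets as the Euclidean norm [enorm]. *)
Definition dotp x y : R := \sum_(i < n) x ord0 i * y ord0 i.
Definition enorm x : R := Num.sqrt (dotp x x).
Definition eball y (r : R) : set (Rn R n) := [set x | enorm (x - y) < r].

Definition absC f : Rn R n -> \bar R :=
  fun x => (ComplexField.Normc.normc (f x))%:E.

Definition measurable_cplx f : Prop :=
  measurable_fun setT (fun x => complex.Re (f x)) /\
  measurable_fun setT (fun x => complex.Im (f x)).

Definition integralC f : R[i] :=
  (\int[leb]_x complex.Re (f x)) +i* (\int[leb]_x complex.Im (f x)).

Definition L2norm f : \bar R := 'N[leb]_(2%:E)[absC f].
Definition L2 : set (Rn R n -> R[i]) :=
  [set f | measurable_cplx f /\ (L2norm f < +oo)%E].

Definition Linf_norm f : \bar R := 'N[leb]_(+oo%E)[absC f].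
Definition Linf : set (Rn R n -> R[i]) :=
  [set f | measurable_cplx f /\ (Linf_norm f < +oo)%E].

Definition partials (s : seq 'I_n) (g : Rn R n -> R) : Rn R n -> R :=
  foldr (fun i h x => 'D_(delta_mx ord0 i : Rn R n) h x) g s.

(* Differentiability of all the iterated partial derivatives amounts to being
   infinitely differentiable. *)
Definition schwartz_real (g : Rn R n -> R) : Prop :=
  (forall s x, differentiable (partials s g) x) /\
  (forall s (k : nat), exists C : R, forall x,
     (1 + enorm x) ^+ k * `|partials s g x| <= C).

Definition schwartz : set (Rn R n -> R[i]) :=
  [set f | schwartz_real (fun x => complex.Re (f x)) /\
           schwartz_real (fun x => complex.Im (f x))].

Definition expi (t : R) : R[i] := cos t +i* sin t.

Definition fourier_schwartz u : Rn R n -> R[i] :=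
  fun xi => integralC (fun x => u x * expi (- dotp x xi)).

(* [t] is the limit, for the seminorm [NT], of the images by [A] of a sequence
   of elements of [D] that converges to [s] for the seminorm [NS]. *)
Definition ext_graph (S T : zmodType) (NS : S -> \bar R) (NT : T -> \bar R)
    (D : set S) (A : S -> T) (s : S) (t : T) : Prop :=
  exists w : nat -> S, [/\ forall k, D (w k),
    NS (w k - s) @[k --> \oo] --> 0%E & NT (A (w k) - t) @[k --> \oo] --> 0%E].

Definition fourier_graph u v : Prop :=
  [/\ L2 u, L2 v & ext_graph L2norm L2norm schwartz fourier_schwartz u v].

(* By Plancherel's theorem, [fourier_graph] is, up to equality a.e., the graph
   of a bijection of L^2; [fourier] and [inv_fourier] select representatives of
   the two extensions by continuity. *)
Definition fourier u : Rn R n -> R[i] := xget 0 [set v | fourier_graph u v].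
Definition inv_fourier v : Rn R n -> R[i] := xget 0 [set u | fourier_graph u v].

Definition fourier_multiplier (a u : Rn R n -> R[i]) : Rn R n -> R[i] :=
  inv_fourier (fun xi => a xi * fourier u xi).

End analysis.

Section banach_function_space.
Variables (R : realType) (n : nat).

Definition Mplus : set (Rn R n -> \bar R) :=
  [set f : Rn R n -> \bar R | measurable_fun setT f /\ forall x, (0 <= f x)%E].

Local Open Scope ereal_scope.

Record banach_function_norm (rho : (Rn R n -> \bar R) -> \bar R) : Prop := {
  bfn_ge0 : forall f : Rn R n -> \bar R, Mplus f -> 0 <= rho f ;
  bfn_eq0 : forall f : Rn R n -> \bar R, Mplus f ->
    rho f = 0 <-> \forall x \ae leb, f x = 0 ;
  bfn_scale : forall (c : R) (f : Rn R n -> \bar R), (0 <= c)%R -> Mplus f ->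
    rho (fun x => c%:E * f x) = c%:E * rho f ;
  bfn_triangle : forall f g : Rn R n -> \bar R, Mplus f -> Mplus g ->
    rho (fun x => f x + g x) <= rho f + rho g ;
  bfn_le : forall f g : Rn R n -> \bar R, Mplus f -> Mplus g ->
    (\forall x \ae leb, g x <= f x) -> rho g <= rho f ;
  bfn_fatou : forall (f_ : nat -> Rn R n -> \bar R) (f : Rn R n -> \bar R),
    (forall k, Mplus (f_ k)) -> Mplus f ->
    (\forall x \ae leb, {homo (fun k => f_ k x) : i j / (i <= j)%N >-> i <= j} /\
                        f_ k x @[k --> \oo] --> f x) ->
    {homo (fun k => rho (f_ k)) : i j / (i <= j)%N >-> i <= j} /\
    rho (f_ k) @[k --> \oo] --> rho f ;
  bfn_indic : forall E : set (Rn R n), measurable E -> bounded_set E ->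
    rho (fun x => (\1_E x)%:E) < +oo ;
  bfn_integral : forall E : set (Rn R n), measurable E -> bounded_set E ->
    exists2 C : R, (0 < C)%R &
      forall f : Rn R n -> \bar R, Mplus f ->
        \int[leb]_(x in E) f x <= C%:E * rho f }.

Variable rho : (Rn R n -> \bar R) -> \bar R.

Definition normX (f : Rn R n -> R[i]) : \bar R := rho (absC f).
Definition Xspace : set (Rn R n -> R[i]) :=
  [set f | measurable_cplx f /\ normX f < +oo].

Definition ae_zero (f : Rn R n -> R[i]) : Prop := \forall x \ae leb, f x = 0%R.

Definition multiplier : set (Rn R n -> R[i]) :=
  [set a | Linf a /\
    ereal_sup [set normX (fourier_multiplier a u) / normX u |
               u in [set u | [/\ L2 u, Xspace u & ~ ae_zero u]]] < +oo].

Variable Omega : set (Rn R n).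

Definition r_Omega (f : Rn R n -> R[i]) : Omega -> R[i] := sigL Omega f.
Definition e_Omega (f : Omega -> R[i]) : Rn R n -> R[i] := 'valL_0%R f.

Definition normXO (f : Omega -> R[i]) : \bar R := normX (e_Omega f).

(* [Omega] is assumed measurable whenever these are used, so that a function on
   [Omega] is measurable if and only if its extension by 0 is. *)
Definition XO : set (Omega -> R[i]) := [set f | Xspace (e_Omega f)].
Definition L2XO : set (Omega -> R[i]) := [set f | L2 (e_Omega f) /\ XO f].

Definition X2O : set (Omega -> R[i]) :=
  [set f | XO f /\ exists w : nat -> Omega -> R[i],
     (forall k, L2XO (w k)) /\ normXO (w k - f)%R @[k --> \oo] --> 0].

Definition wiener_hopf0 (a : Rn R n -> R[i]) (f : Omega -> R[i]) :
    Omega -> R[i] :=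
  r_Omega (fourier_multiplier a (e_Omega f)).

Definition wiener_hopf (a : Rn R n -> R[i]) (f : Omega -> R[i]) : Omega -> R[i] :=
  xget 0%R [set g | XO g /\ ext_graph normXO normXO L2XO (wiener_hopf0 a) f g].

Definition opnorm (A : (Omega -> R[i]) -> (Omega -> R[i])) : \bar R :=
  ereal_sup [set normXO (A f) / normXO f |
             f in [set f | X2O f /\ ~ ae_zero (e_Omega f)]].

Definition chi (E : set (Rn R n)) : Omega -> R[i] :=
  r_Omega (fun x => (\1_E x)%:C).

Definition doubling_const (tau : R) : \bar R :=
  limf_einf (fun r : R =>
    ereal_inf [set normXO (chi (eball y (tau * r))) / normXO (chi (eball y r)) |
               y in [set y | eball y (tau * r) `<=` Omega]])
  (pinfty_nbhs R).

Definition weak_doubling : Prop := exists2 tau : R, (1 < tau)%R &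
  doubling_const tau < +oo.

End banach_function_space.

(* Main.v *)
(* Let [phi] be 1 on the unit ball, between 0 and 1, and 0 outside of the ball of
   radius [sig > 1], with an integrable Fourier transform, and consider the wave
   packets [u x = exp (i xi0 x) phi ((x - y) / r)].  Their Fourier transforms
   concentrate at [xi0] when [r] grows, so that for [c] in the essential range of
   [a], [F^-1 a F u - c u], which is bounded by the integral of [|a - c| |F u|],
   is uniformly small for a suitable [xi0]: such a [xi0] is found by averaging
   over a set [K] of positive finite measure on which [|a - c|] is small, since
   translations are continuous in L^2.  If [B(y, sig r)] is contained in [Omega],
   then [|u|] is at most the indicator of [B(y, sig r)] and [|W_Omega(a) u|] is
   about [|c|] or more on [B(y, r)], whence [|c|] is at most about the norm of
   [W_Omega(a)] times the ratio of the norms of the indicators of the two balls.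
   Splitting the passage from radius [r] to radius [tau r] into many steps, the
   weak doubling property yields balls for which, for some [sig > 1], this ratio
   is as close to 1 as desired. *)
Require Import Defs.
From HB Require Import structures.
From mathcomp Require Import all_boot all_order all_algebra.
From mathcomp Require Import complex.
From mathcomp Require Import all_classical all_reals all_analysis.
From mathcomp Require Import measurable_realfun ess_sup_inf.
From mathcomp Require Import ring lra.

Set Implicit Arguments.
Unset Strict Implicit.
Unset Printing Implicit Defensive.

Import Order.TTheory GRing.Theory Num.Theory.
Import numFieldNormedType.Exports.

Local Open Scope classical_set_scope.
Local Open Scope complex_scope.
Local Open Scope ring_scope.

(** * Lebesgue measure on R^n *)

(** The Fourier transform on L^2 is only given as a graph of limits of Schwartz functions, with
    representatives selected by choice: Plancherel's theorem has to be proved for this graph,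
    identities hold almost everywhere, and every function of L^2 must be shown to occur on both
    sides. Fourier inversion is computed for Gaussians alone; the rest comes from the multiplication
    formula [FT_swap] and from density ([L12_ind]). The bump has to be exactly 0 outside its larger
    ball, since a tail leaving [Omega] would be cut off by the restriction; hence the correlation of
    two indicators in [bump_function]. The order of the choices matters: the gap between the two
    norms fixes the admissible ratio for the balls, this fixes [sig] and the bump, and these fix the
    tolerance and the level set. The radius comes last, and the weak doubling property offers only
    some large radii, with centres that depend on the radius. So the spectral estimate is made
    uniform in the centre, which is possible because a translation changes [F u] only by a phase. *)

HB.instance Definition _ (R : realType) n := Measure_isSigmaFinite.Build _ _ _
  (@leb R n) (completed_measure_extension_sigma_finite (sigma_finiteT (borel_lebesgue R n))).

Lemma ge0_integrableP d (T : measurableType d) (R : realType)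
    (mu : {measure set T -> \bar R}) (f : T -> R) :
  measurable_fun setT f -> (forall x, 0 <= f x) ->
  mu.-integrable setT (EFin \o f) <-> (\int[mu]_x (f x)%:E < +oo)%E.
Proof.
move=> mf f0.
have E : (\int[mu]_x `|(EFin \o f) x| = \int[mu]_x (f x)%:E)%E.
  by apply: eq_integral => x _ /=; rewrite ger0_norm.
split; first by move=> /integrableP[_]; rewrite E.
by move=> H; apply/integrableP; split; [exact/measurable_EFinP|rewrite E].
Qed.

Section ge0_integralT.
Context d (T : measurableType d) (R : realType) (mu : {measure set T -> \bar R}).
Implicit Types f g : T -> \bar R.

Lemma ge0_integralZlT (c : \bar R) f : measurable_fun setT f -> (forall x, 0 <= f x)%E -> (0 <= c)%E ->
  (\int[mu]_x (c * f x) = c * \int[mu]_x f x)%E.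
Proof. by move=> mf f0 c0; rewrite ge0_integralZl. Qed.

Lemma ge0_integralDT f g : measurable_fun setT f -> (forall x, 0 <= f x)%E ->
  measurable_fun setT g -> (forall x, 0 <= g x)%E ->
  (\int[mu]_x (f x + g x) = \int[mu]_x f x + \int[mu]_x g x)%E.
Proof. by move=> mf f0 mg g0; rewrite ge0_integralD. Qed.

Lemma ge0_le_integralT f g : measurable_fun setT f -> (forall x, 0 <= f x)%E -> measurable_fun setT g ->
  (forall x, f x <= g x)%E -> (\int[mu]_x f x <= \int[mu]_x g x)%E.
Proof. by move=> mf f0 mg fg; apply: ge0_le_integral. Qed.

End ge0_integralT.

(** * Borel sets against Lebesgue sets of R^n *)

Section borel.
Variables (R : realType) (n : nat).
Local Notation mu := (borel_lebesgue R n).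
Implicit Types (A : set (borelRn R n)).

(** One space with two sigma-algebras. Affine maps and scalar products are handled as Borel maps,
    and composition with [toB] returns to Lebesgue measurability. *)
Definition toB : Rn R n -> borelRn R n := id.

Lemma borel_measurable A : measurable A -> measurable (A : set (Rn R n)).
Proof. by move=> mA; exact: caratheodory_measurable_mu_ext. Qed.

Lemma measurable_toB : measurable_fun setT toB.
Proof. by move=> _ A mA; rewrite setTI; exact: borel_measurable. Qed.

Lemma leb_borel A : measurable A -> leb (A : set (Rn R n)) = mu A.
Proof. by move=> mA; rewrite /leb/= /completed_measure_extension measurable_mu_extE. Qed.

Lemma borel_measurable_fun d (T : measurableType d) (f : borelRn R n -> T) :
  measurable_fun setT f -> measurable_fun setT (f : Rn R n -> T).
Proof. by move=> mf; exact: (measurableT_comp mf measurable_toB). Qed.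

(** The image of [leb] under [toB] is the product measure, for which changes of variables and
    integration by coordinates are proved. *)
Lemma ge0_integral_leb (f : borelRn R n -> \bar R) : measurable_fun setT f ->
  (forall x, 0 <= f x)%E -> (\int[leb]_x f x = \int[mu]_x f x)%E.
Proof.
move=> mf f0.
have := @ge0_integral_pushforward _ _ _ _ R _ measurable_toB (@leb R n) setT f measurableT mf (fun x _ => f0 x).
rewrite preimage_setT => /esym H.
rewrite [LHS]H; apply: eq_measure_integral => [|mt A mA _]; first exact: measurable_toB.
exact: leb_borel.
Qed.

(** [leb A] is an infimum over countable Borel covers; the unions of covers that come within
    [k.+1%:R^-1] of it are intersected. *)
Lemma leb_borel_hull (A : set (Rn R n)) : measurable A -> (leb A < +oo)%E ->
  exists B : set (borelRn R n), [/\ measurable B, A `<=` B & leb (B `\` A : set (Rn R n)) = 0%E].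
Proof.
move=> mA Aoo.
have Afin : leb A \is a fin_num by rewrite ge0_fin_numE.
have H k : exists B : set (borelRn R n), [/\ measurable B, A `<=` B &
    (leb (B : set (Rn R n)) <= leb A + (k.+1%:R^-1)%:E)%E].
  have k0 : (0 < k.+1%:R^-1 :> R)%R by rewrite invr_gt0.
  have [_ [F [mF AF] <-] lt] := lb_ereal_inf_adherent k0 Afin.
  exists (\bigcup_i F i); split => //; first exact: bigcupT_measurable.
  rewrite (le_trans _ (ltW lt))// leb_borel; last exact: bigcupT_measurable.
  by apply: measure_sigma_subadditive => //; exact: bigcupT_measurable.
have [B HB] := choice H.
have mB : measurable (\bigcap_k B k) by apply: bigcapT_measurable => k; have [] := HB k.
exists (\bigcap_k B k); split => //; first by move=> x Ax k _; have [_ + _] := HB k; apply.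
have mB' := borel_measurable mB.
rewrite measureD//; last first.
- apply: (@le_lt_trans _ _ (leb (B 0%N : set (Rn R n)))).
    apply: le_measure; rewrite ?inE//; first by apply: borel_measurable; have [] := HB 0%N.
    by move=> x /(_ 0%N I).
  by have [_ _ /le_lt_trans] := HB 0%N; apply; rewrite lte_add_pinfty ?ltry.
rewrite (_ : _ `&` A = A); last first.
  by apply/setIidPr => x Ax k _; have [_ + _] := HB k; apply.
apply/eqP; rewrite eq_le sube_ge0 ?Afin//; apply/andP; split; last first.
  by apply: le_measure; rewrite ?inE// => x Ax k _; have [_ + _] := HB k; apply.
rewrite sube_le0; apply/lee_addgt0Pr => e e0.
have [k ke] := ltr_add_invr e0.
apply: (@le_trans _ _ (leb A + (k.+1%:R^-1)%:E)); last by rewrite leeD2l// lee_fin; rewrite add0r in ke; exact: ltW.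
have [mBk _ le] := HB k; apply: le_trans le.
by apply: le_measure; rewrite ?inE//; [exact: borel_measurable|move=> x /(_ k I)].
Qed.

End borel.

Section measurability.
Variables (R : realType) (n : nat).

Lemma measurable_coordRn d (T : measurableType d) (f : T -> borelRn R n) i :
  measurable_fun setT f -> measurable_fun setT (fun t => (f t : 'rV[R]_n) ord0 i).
Proof. by move=> mf; exact: (measurableT_comp (measurable_coord i) mf). Qed.

Lemma measurable_funZD d (T : measurableType d) (c : R) (f g : T -> borelRn R n) :
  measurable_fun setT f -> measurable_fun setT g ->
  measurable_fun setT (fun t => (c *: (f t : 'rV[R]_n) + g t) : borelRn R n).
Proof.
move=> mf mg; apply: measurable_to_borelRn => i.
rewrite (_ : _ \o _ = fun t => c * (f t : 'rV[R]_n) ord0 i + (g t : 'rV[R]_n) ord0 i); last first.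
  by apply/funext => t; rewrite /borel_coord/= !mxE.
apply: measurable_funD; last exact: measurable_coordRn.
by apply: measurable_funM => //; exact: measurable_coordRn.
Qed.

Lemma measurable_dotp d (T : measurableType d) (f g : T -> borelRn R n) :
  measurable_fun setT f -> measurable_fun setT g ->
  measurable_fun setT (fun t => dotp (f t : Rn R n) (g t)).
Proof.
move=> mf mg; apply: measurable_sum => i.
by apply: measurable_funM; exact: measurable_coordRn.
Qed.

Lemma measurable_eball (y : Rn R n) r : measurable (eball y r : set (borelRn R n)).
Proof.
have -> : eball y r = (fun x : borelRn R n => Num.sqrt (dotp ((1:R) *: (x : Rn R n) + (- y)) ((1:R) *: (x : Rn R n) + (- y)))) @^-1` `]-oo, r[.
  by apply/seteqP; split=> x/=; rewrite /eball/= in_itv/= /enorm scale1r.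
rewrite -[X in measurable X]setTI.
have mb : measurable_fun setT (fun x : borelRn R n => ((1:R) *: (x : 'rV[R]_n) + (- y : 'rV[R]_n)) : borelRn R n).
  exact: measurable_funZD.
apply: (measurableT_comp (continuous_measurable_fun (@sqrt_continuous R)) (measurable_dotp mb mb)) => //.
Qed.

Lemma borel_open (U : set 'rV[R]_n) : open U -> measurable (U : set (borelRn R n)).
Proof.
move=> oU.
(* Boxes with rational centre and radius [1 / k.+1] are countably many; they are balls of the sup
   norm, which is the one that [open] refers to. *)
pose box (p : 'rV[rat]_n * nat) : set (borelRn R n) :=
  [set x | forall i, `|(x : 'rV[R]_n) ord0 i - ratr (p.1 ord0 i)| < p.2.+1%:R^-1].
have mbox p : measurable (box p).
  have -> : box p = \big[setI/setT]_(i <- index_enum 'I_n)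
      ((fun x : borelRn R n => (x : 'rV[R]_n) ord0 i) @^-1` [set t | `|t - ratr (p.1 ord0 i)| < p.2.+1%:R^-1]).
    rewrite -bigcap_seq; apply/seteqP; split => x /= bx i; first by move=> _; exact: bx.
    by apply: (bx i); rewrite /= mem_index_enum.
  apply: bigsetI_measurable => i _; rewrite -[X in measurable X]setTI.
  apply: (measurable_coordRn i (@measurable_id _ _ setT)) => //.
  rewrite (_ : [set t | _] = ball (ratr (p.1 ord0 i) : R) (p.2.+1%:R^-1)).
    by apply: open_measurable; exact: ball_open.
  by apply/seteqP; split => t /=; rewrite /ball/= distrC.
have -> : U = \bigcup_p (if `[< box p `<=` U >] then box p else set0).
  apply/seteqP; split => [x Ux|x [p _]]; last by case: asboolP => // pU; exact: pU.
  have /nbhs_ballP[e /= e0 xeU] : nbhs x U by exact: open_nbhs_nbhs.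
  have e20 : 0 < e / 2 by rewrite divr_gt0.
  have [k ke] := ltr_add_invr e20; rewrite add0r in ke.
  have H i : exists q : rat, `|(x : 'rV[R]_n) ord0 i - ratr q| < k.+1%:R^-1.
    have [q] := @rat_in_itvoo R (x ord0 i - k.+1%:R^-1) (x ord0 i + k.+1%:R^-1) ltac:(by rewrite ltrBlDr -addrA ltrDl addr_gt0// invr_gt0).
    rewrite in_itv/= => /andP[q1 q2]; exists q.
    by rewrite ltr_norml ltrBrDr addrC ltrBlDr q2 ltrBlDr -ltrBlDl q1.
  have [q Hq] := choice H.
  have sub : box (\row_i q i, k) `<=` U; last first.
    exists (\row_i q i, k) => //; rewrite asboolT// => i /=; rewrite mxE; exact: Hq.
  move=> z /= bz; apply: xeU; split => // i j; rewrite ord1.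
  have := bz j; have := Hq j; rewrite /= mxE /ball/= => h1 h2.
  rewrite (le_lt_trans (ler_distD (ratr (q j)) _ _))// (splitr e).
  by rewrite ltrD// ?(lt_trans _ ke)// distrC.
apply: countable_bigcupT_measurable => [|p]; first exact: countableP.
by case: ifP => // _; exact: mbox.
Qed.

Lemma borel_continuous (f : Rn R n -> R) : continuous f ->
  measurable_fun (setT : set (borelRn R n)) (f : borelRn R n -> R).
Proof.
move=> /continuousP cf; apply: (measurability _ (RGenOpens.measurableE R)).
move=> _ [_ [a [b ->] <-]]; rewrite setTI.
by apply: borel_open; exact/cf/interval_open.
Qed.

End measurability.

(** * Affine changes of variables *)

Section affine.
Variable R : realType.

(** Lebesgue measure is determined by half-open intervals, on which it agrees with [c] times its
    image under [x |-> c * x + b]. *)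
Lemma ge0_integral_affine1 (c b : R) (f : R -> \bar R) : 0 < c ->
  measurable_fun setT f -> (forall x, 0 <= f x)%E ->
  (\int[lebesgue_measure]_x f (c * x + b)%R = c^-1%:E * \int[lebesgue_measure]_x f x)%E.
Proof.
move=> c0 mf f0.
pose T (x : measurableTypeR R) : measurableTypeR R := c * x + b.
have mT : measurable_fun setT T.
  by apply: measurable_funD => //; exact: measurable_funM.
pose Tmu : {measure set (measurableTypeR R) -> \bar R} :=
  measure_function_pushforward__canonical__measure_function_Measure (@lebesgue_measure R) mT.
pose cn : {nonneg R} := NngNum (ltW c0).
have E A : measurable A -> lebesgue_measure A = mscale cn Tmu A.
  apply: lebesgue_measure_unique => X -[[u v]] /= uv <-.
  rewrite /mscale/= /pushforward/=.
  have -> : T @^-1` `]u, v] = `](u - b) / c, (v - b) / c]%classic.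
    apply/seteqP; split => x /=; rewrite !in_itv/= /T;
      by rewrite ltr_pdivrMr// ler_pdivlMr// ltrBlDr lerBrDr mulrC.
  rewrite !lebesgue_measure_itv/= !lte_fin ltr_pM2r ?invr_gt0// ltrD2r.
  case: ifPn => // _; last by rewrite mule0.
  by rewrite -!EFinD -EFinM; congr (_%:E); field; rewrite gt_eqF.
have : (\int[lebesgue_measure]_x f x = c%:E * \int[lebesgue_measure]_x f (c * x + b)%R)%E.
  transitivity (\int[mscale cn Tmu]_x f x)%E.
    by apply: eq_measure_integral => A mA _; exact: E.
  rewrite ge0_integral_mscale//; congr *%E.
  by rewrite ge0_integral_pushforward.
by move=> ->; rewrite muleA -EFinM mulVf ?gt_eqF// mul1e.
Qed.

Lemma ge0_integral_consRn n (f : borelRn R n.+1 -> \bar R) :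
  measurable_fun setT f -> (forall x, 0 <= f x)%E ->
  (\int[borel_lebesgue R n.+1]_x f x =
   \int[lebesgue_measure]_t \int[borel_lebesgue R n]_y f (consRn (t, y)))%E.
Proof.
move=> mf f0; rewrite /=.
have := @ge0_integral_pushforward _ _ _ _ R _ (@measurable_consRn R n) (lebesgue_measure \x borel_lebesgue R n)%E setT f measurableT mf (fun x _ => f0 x).
rewrite preimage_setT => H.
transitivity (\int[lebesgue_measure \x borel_lebesgue R n]_x (f \o @consRn R n) x)%E.
  by rewrite -H; apply: eq_measure_integral => [|? A mA _]; first exact: measurable_consRn.
rewrite (fubini_tonelli1 (f \o @consRn R n))//; last by move=> x; exact: f0.
by apply: measurableT_comp => //; exact: measurable_consRn.
Qed.

(** A homothety followed by a translation acts on each coordinate separately, so that the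
    one-dimensional case and integration by coordinates suffice. *)
Lemma ge0_integral_affine_borel n (c : R) (b : 'rV[R]_n) (f : borelRn R n -> \bar R) :
  0 < c -> measurable_fun setT f -> (forall x, 0 <= f x)%E ->
  (\int[borel_lebesgue R n]_x f (c *: (x : 'rV[R]_n) + b)%R =
   (c^-1 ^+ n)%:E * \int[borel_lebesgue R n]_x f x)%E.
Proof.
move=> c0; elim: n b f => [|n IH] b f mf f0.
  rewrite expr0 mul1e; apply: eq_integral => x _; congr f; by apply/rowP => -[].
have mT : measurable_fun setT (fun x : borelRn R n.+1 => (c *: (x : 'rV[R]_n.+1) + b)%R : borelRn R n.+1).
  exact: measurable_funZD.
rewrite ge0_integral_consRn//; last exact: (measurableT_comp mf mT).
rewrite [in RHS]ge0_integral_consRn//.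
have mfc : measurable_fun setT (f \o @consRn R n).
  by apply: measurableT_comp => //; exact: measurable_consRn.
pose b0 : R := (b : 'rV_(1 + n)) ord0 (lshift n ord0).
pose b1 : 'rV[R]_n := rsubmx (b : 'rV_(1 + n)).
have Econs t y : (c *: (consRn (t, y) : 'rV[R]_n.+1) + b)%R = consRn (c * t + b0, (c *: (y : 'rV[R]_n) + b1)%R).
  rewrite /consRn/= -[in LHS](@hsubmxK R 1 1 n b).
  rewrite (@scale_row_mx R 1 1 n) (@add_row_mx R 1 1 n); congr (@row_mx R 1 1 n _ _).
  by apply/rowP => i; rewrite !ord1 !mxE.
transitivity (\int[lebesgue_measure]_t ((c^-1 ^+ n)%:E *
    \int[borel_lebesgue R n]_y f (consRn ((c * t + b0)%R, y))))%E.
  apply: eq_integral => t _; rewrite -(IH b1 (fun y => f (consRn ((c * t + b0)%R, y))))//.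
    by apply: eq_integral => y _; rewrite Econs.
  exact: (measurableT_comp mfc (measurable_pair1 _)).
have mF := measurable_fun_fubini_tonelli_F (m2 := borel_lebesgue R n) _ mfc (fun x => f0 _).
pose H (t : measurableTypeR R) := (\int[borel_lebesgue R n]_y f (consRn (t, y)))%E.
have mH : measurable_fun setT H by exact: mF.
have H0 t : (0 <= H t)%E by apply: integral_ge0 => y _; exact: f0.
rewrite -/(H _); transitivity (\int[lebesgue_measure]_t ((c^-1 ^+ n)%:E * H (c * t + b0)%R))%E => //.
rewrite ge0_integralZl; [|exact: measurableT| |by move=> t _; exact: H0|by rewrite lee_fin exprn_ge0// invr_ge0 ltW]; last first.
  have mt : measurable_fun setT (fun t : measurableTypeR R => c * t + b0 : measurableTypeR R).
    by apply: measurable_funD => //; exact: measurable_funM.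
  exact: (measurableT_comp mH mt).
rewrite (ge0_integral_affine1 b0 c0 mH H0).
by rewrite muleA -EFinM -exprSr.
Qed.

End affine.

(** * Gaussian integrals *)
Section gauss1.
Variable R : realType.
Local Notation mu := (@lebesgue_measure R).
Implicit Types t x xi th : R.

(** Over [[- k.+1, k.+1]] the integral is a difference of values of [F], and it tends to the full
    integral by dominated convergence. *)
Lemma Rintegral_derive_eq0 (F f : R -> R) : (forall x, is_derive x 1 F (f x)) ->
  continuous f -> mu.-integrable setT (EFin \o f) ->
  F k.+1%:R @[k --> \oo] --> 0 -> F (- k.+1%:R) @[k --> \oo] --> 0 ->
  (\int[mu]_x f x)%R = 0.
Proof.
move=> Ff cf intf F1 F2.
have mf : measurable_fun setT f by exact: continuous_measurable_fun.
pose I k : set R := `[- k.+1%:R, k.+1%:R]%classic.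
pose f_ k x := ((f \_ (I k)) x)%:E.
have mf_ k : measurable_fun setT (f_ k).
  apply/measurable_EFinP; apply/(measurable_restrictT _ _).1 => //; first exact: measurable_itv.
  exact: measurable_funTS.
have [_ _ cv] : [/\ mu.-integrable setT (EFin \o f),
  [sequence \int[mu]_x `|f_ k x - (EFin \o f) x|]_k @ \oo --> 0 &
  [sequence \int[mu]_x (f_ k x)]_k @ \oo --> \int[mu]_x (EFin \o f) x]%E.
  apply: (@dominated_convergence _ _ _ mu setT measurableT f_ (EFin \o f) (EFin \o (fun x => `|f x|))) => //.
  - exact/measurable_EFinP.
  - apply: aeW => x _; apply/cvg_EFin; first by apply: nearW.
    apply: cvg_near_cst; near=> k; rewrite /= /patch mem_set// /I/= in_itv/= -ler_norml.
    apply: (@le_trans _ _ k%:R); last by rewrite ler_nat.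
    by near: k; exact: nbhs_infty_ger.
  - exact: (integrable_norm intf).
  - apply: aeW => x k _; rewrite /f_/= lee_fin /patch; case: ifPn => // _.
    by rewrite normr0.
have E k : (\int[mu]_x (f_ k x) = (F k.+1%:R - F (- k.+1%:R))%:E)%E.
  transitivity (\int[mu]_(x in I k) (f x)%:E)%E.
    rewrite [RHS]integral_mkcond; apply: eq_integral => x _; rewrite /f_ !patchE.
    by case: ifPn.
  rewrite /I (@continuous_FTC2 _ f F)//.
  - by rewrite (@lt_trans _ _ 0)// oppr_lt0.
  - exact: continuous_subspaceT.
  - have cF : continuous F by move=> x; apply: differentiable_continuous; apply/derivable1_diffP; have [] := Ff x.
    split => [x _| |]; first by have [] := Ff x.
    + exact/cvg_at_right_filter/cF.
    + exact/cvg_at_left_filter/cF.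
  - by move=> x _; rewrite derive1E; have [_ ->] := Ff x.
have cv0 : [sequence (\int[mu]_x (f_ k x))%E]_k @ \oo --> 0%E.
  rewrite (_ : [sequence _]_k = EFin \o (fun k => F k.+1%:R - F (- k.+1%:R))); last first.
    by apply/funext => k /=; rewrite E.
  apply: cvg_EFin; first exact: nearW.
  by rewrite -[X in _ --> X](subrr 0); exact: cvgB.
rewrite /Rintegral.
by have -> : (\int[mu]_x (f x)%:E)%E = 0%E by exact: (cvg_unique _ cv cv0).
Unshelve. all: by end_near. Qed.

Lemma ge0_integral_gauss t : 0 < t ->
  (\int[mu]_x (expR (- t * x ^+ 2))%:E = (Num.sqrt (pi / t))%:E)%E.
Proof.
move=> t0; have s0 : 0 < Num.sqrt t by rewrite sqrtr_gt0.
have := ge0_integral_affine1 0 s0 (f := EFin \o gauss_fun).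
rewrite integralT_gauss => H.
transitivity (\int[mu]_x (EFin \o gauss_fun) (Num.sqrt t * x + 0)%R)%E.
  by apply: eq_integral => x _ /=; rewrite /gauss_fun addr0 exprMn sqr_sqrtr ?ltW// mulNr.
rewrite H; last 2 first.
- by apply/measurable_EFinP; exact: measurable_gauss_fun.
- by move=> x; rewrite lee_fin gauss_fun_ge0.
by rewrite -EFinM sqrtrM ?pi_ge0// sqrtrV ?ltW// mulrC.
Qed.

Lemma integrable_gauss1 t : 0 < t -> mu.-integrable setT (EFin \o (fun x => expR (- t * x ^+ 2))).
Proof.
move=> t0; apply/ge0_integrableP; last by rewrite ge0_integral_gauss// ltry.
- by apply: measurableT_comp => //; exact: measurable_funM.
- by move=> x; exact: expR_ge0.
Qed.

(** Absorbs the factor [x] that differentiation under the integral produces: half of the exponent of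
    a Gaussian is spent on it, and the other half keeps the majorant integrable. *)
Lemma ler_norm_expR_sqr t x : 0 < t -> `|x| <= (Num.sqrt t)^-1 * expR (t * x ^+ 2).
Proof.
move=> t0; have s0 : 0 < Num.sqrt t by rewrite sqrtr_gt0.
rewrite ler_pdivlMl//.
apply: (le_trans _ (expR_ge1Dx _)).
rewrite -[x ^+ 2]real_normK ?num_real// -{2}(sqr_sqrtr (ltW t0)) -exprMn.
by have : 0 <= (Num.sqrt t * `|x| - 2^-1) ^+ 2 by [exact: sqr_ge0]; nra.
Qed.

Lemma expR_Nsqr_cvg0 t (s : R) : 0 < t -> `|s| = 1 -> expR (- t * (s * k.+1%:R) ^+ 2) @[k --> \oo] --> 0.
Proof.
move=> t0 s1.
apply: (@squeeze_cvgr _ _ _ _ (cst 0) (fun k => t^-1 * harmonic k)).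
- apply: nearW => k /=; rewrite expR_ge0/= /harmonic -invfM mulNr expRN lef_pV2 ?posrE ?expR_gt0 ?mulr_gt0//.
  apply: (le_trans _ (expR_ge1Dx _)).
  rewrite exprMn -[s ^+ 2]real_normK ?num_real// s1 expr1n mul1r.
  have : 1 <= k.+1%:R :> R by rewrite ler1n.
  by nra.
- exact: cvg_cst.
- by rewrite -[X in _ --> X](mulr0 t^-1); apply: cvgM; [exact: cvg_cst|exact: cvg_harmonic].
Qed.

(** The phase [th] makes the family closed, up to a factor [x], under differentiation in [xi], which
    shifts it by [pi / 2]. The phases 0 and [- (pi / 2)] give the real and imaginary parts of the
    Fourier integral. *)
Definition gausscos t th xi x := expR (- t * x ^+ 2) * cos (x * xi + th).

Lemma measurable_gausscos t th xi : measurable_fun setT (gausscos t th xi).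
Proof.
apply: measurable_funM.
  apply: measurableT_comp => //; exact: measurable_funM.
apply: measurableT_comp; first exact: (continuous_measurable_fun (@continuous_cos R)).
by apply: measurable_funD => //; exact: measurable_funM.
Qed.

Lemma integrable_gausscos t th xi : 0 < t -> mu.-integrable setT (EFin \o gausscos t th xi).
Proof.
move=> t0; apply: le_integrable (integrable_gauss1 t0) => //.
  by apply/measurable_EFinP; exact: measurable_gausscos.
move=> x _ /=; rewrite lee_fin normrM ger0_norm ?expR_ge0// ler_piMr ?expR_ge0//.
exact: cos_max.
Qed.

Lemma integrable_mul_gausscos t th xi : 0 < t -> mu.-integrable setT (EFin \o (fun x => x * gausscos t th xi x)).
Proof.
move=> t0; have t20 : 0 < t / 2 by rewrite divr_gt0.
apply: le_integrable (integrableZl measurableT (Num.sqrt (t / 2))^-1 (integrable_gauss1 t20)) => //.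
  by apply/measurable_EFinP; apply: measurable_funM => //; exact: measurable_gausscos.
move=> x _ /=; rewrite lee_fin [leRHS]ger0_norm; last by rewrite mulr_ge0 ?expR_ge0// invr_ge0 sqrtr_ge0.
rewrite normrM; apply: (@le_trans _ _ ((Num.sqrt (t / 2))^-1 * expR (t / 2 * x ^+ 2) * expR (- t * x ^+ 2))).
  apply: ler_pM => //; first exact: ler_norm_expR_sqr.
  by rewrite /gausscos normrM ger0_norm ?expR_ge0// ler_piMr ?expR_ge0// cos_max.
by rewrite -mulrA -expRD; have -> : t / 2 * x ^+ 2 + - t * x ^+ 2 = - (t / 2) * x ^+ 2 by field.
Qed.

Lemma is_derive_gausscos t th xi x : is_derive x 1 (gausscos t th xi)
  (- (2 * t) * (x * gausscos t th xi x) - xi * (expR (- t * x ^+ 2) * sin (x * xi + th))).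
Proof.
have H1 : is_derive x 1 (fun x : R => expR (- t * x ^+ 2)) (expR (- t * x ^+ 2) * (- t * (2 * x))).
  have H0 : is_derive x 1 (fun x : R => - t * x ^+ 2) (- t * (2 * x)).
    have -> : (fun x : R => - t * x ^+ 2) = - t *: ((@id R) ^+ 2) by apply/funext => y.
    by apply: is_derive_eq; rewrite /GRing.scale/= expr1 mulr_natl mulr1.
  exact: (is_derive1_comp (is_derive_expR _) H0).
have H2 : is_derive x 1 (fun x : R => cos (x * xi + th)) (- sin (x * xi + th) * xi).
  have H0 : is_derive x 1 (fun x : R => x * xi + th) xi.
    have -> : (fun x : R => x * xi + th) = xi *: (@id R) + cst th.
      by apply/funext => y; rewrite /GRing.scale/= !fctE mulrC.
    by apply: is_derive_eq; rewrite /GRing.scale/= mulr1 addr0.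
  exact: (is_derive1_comp (is_derive_cos _) H0).
have := is_deriveM H1 H2; rewrite /gausscos; move=> H; apply: (is_derive_eq H).
by rewrite /GRing.scale/=; ring.
Qed.

Lemma is_derive_gausscos_xi t th xi x : is_derive xi 1 (fun xi => gausscos t th xi x)
  (x * (gausscos t (th + pi / 2) xi x)).
Proof.
have H2 : is_derive xi 1 (fun xi : R => cos (x * xi + th)) (- sin (x * xi + th) * x).
  have H0 : is_derive xi 1 (fun xi : R => x * xi + th) x.
    have -> : (fun xi : R => x * xi + th) = x *: (@id R) + cst th by apply/funext => y.
    by apply: is_derive_eq; rewrite /GRing.scale/= mulr1 addr0.
  exact: (is_derive1_comp (is_derive_cos _) H0).
have := is_deriveZ (expR (- t * x ^+ 2)) H2; rewrite /gausscos; move=> H; apply: (is_derive_eq H).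
by rewrite addrA cosDpihalf /GRing.scale/=; ring.
Qed.

(** Integration by parts, in the form that the derivative of [gausscos t (th + pi / 2) xi] has
    integral 0. *)
Lemma integral_mul_gausscos t th xi : 0 < t ->
  (\int[mu]_x (x * gausscos t (th + pi / 2) xi x) = - (xi / (2 * t)) * \int[mu]_x gausscos t th xi x)%R.
Proof.
move=> t0.
have E x : is_derive x 1 (gausscos t (th + pi / 2) xi)
  (- (2 * t) * (x * gausscos t (th + pi / 2) xi x) - xi * gausscos t th xi x).
  apply: is_derive_eq (is_derive_gausscos _ _ _ _) _.
  by rewrite addrA sinDpihalf.
have c_gc th' : continuous (gausscos t th' xi).
  move=> x; apply: differentiable_continuous; apply/derivable1_diffP.
  by have [] := is_derive_gausscos t th' xi x.
have I1 := integrable_mul_gausscos (th + pi / 2) xi t0.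
have I2 := integrable_gausscos th xi t0.
have I1' := integrableZl measurableT (- (2 * t)) I1.
have I2' := integrableZl measurableT xi I2.
have H0 : (\int[mu]_x (- (2 * t) * (x * gausscos t (th + pi / 2) xi x) - xi * gausscos t th xi x))%R = 0.
  have bnd k : `|gausscos t (th + pi / 2) xi k| <= expR (- t * k ^+ 2).
    by rewrite normrM ger0_norm ?expR_ge0// ler_piMr ?expR_ge0// cos_max.
  apply: (Rintegral_derive_eq0 E).
  - by move=> x; apply: cvgB; apply: cvgM; try exact: cvg_cst; [apply: cvgM; [exact: cvg_id|exact: c_gc]|exact: c_gc].
  - exact: (integrableB measurableT I1' I2').
  - apply: norm_cvg0; apply: (@squeeze_cvgr _ _ _ _ (cst 0) _ _ _ _ _ (@expR_Nsqr_cvg0 t 1 t0 (normr1 _))); last exact: cvg_cst.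
    by apply: nearW => k; rewrite normr_ge0/= mul1r bnd.
  - apply: norm_cvg0; apply: (@squeeze_cvgr _ _ _ _ (cst 0) _ _ _ _ _ (@expR_Nsqr_cvg0 t (-1) t0 (normrN1 _))); last exact: cvg_cst.
    by apply: nearW => k; rewrite normr_ge0/= mulN1r bnd.
move: H0; rewrite RintegralB// !RintegralZl// => /eqP; rewrite subr_eq0 => /eqP H.
apply: (@mulfI _ (- (2 * t))); first by rewrite oppr_eq0 mulf_neq0// gt_eqF.
by rewrite H mulrA; congr (_ * _); field; rewrite gt_eqF.
Qed.

(** As a function of [xi], the integral [K] solves a linear differential equation of first order, by
    differentiation under the integral and [integral_mul_gausscos]; its value at 0 is a Gaussian
    integral times [cos th]. *)
Lemma integral_gausscos t th xi : 0 < t ->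
  (\int[mu]_x gausscos t th xi x = Num.sqrt (pi / t) * expR (- (xi ^+ 2 / (4 * t))) * cos th)%R.
Proof.
move=> t0; pose K xi := (\int[mu]_x gausscos t th xi x)%R.
have dK (y : R) : is_derive y 1 K (- (y / (2 * t)) * K y).
  have Iy : `](y - 1), (y + 1)[%classic y by rewrite /= in_itv/= ltrBlDr ltrDl ltr01.
  have dg (x z : R) : is_derive x 1 (fun xi => gausscos t th xi z) (z * gausscos t (th + pi / 2) x z).
    exact: is_derive_gausscos_xi.
  pose G z := (Num.sqrt (t / 2))^-1 * expR (- (t / 2) * z ^+ 2).
  have t20 : 0 < t / 2 by rewrite divr_gt0.
  have int_f x : `](y - 1), (y + 1)[%classic x -> mu.-integrable setT (EFin \o gausscos t th x).
    by move=> _; exact: integrable_gausscos.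
  have der x z : `](y - 1), (y + 1)[%classic x -> setT z -> derivable (fun xi => gausscos t th xi z) x 1.
    by move=> _ _; have [] := dg x z.
  have G0 z : 0 <= G z by rewrite mulr_ge0 ?expR_ge0// invr_ge0 sqrtr_ge0.
  have intG : mu.-integrable setT (EFin \o G) by exact: (integrableZl measurableT (Num.sqrt (t / 2))^-1 (integrable_gauss1 t20)).
  have dE x z : partial1of2 (gausscos t th) x z = z * gausscos t (th + pi / 2) x z.
    by rewrite partial1of2E; have [_ ->] := dg x z.
  have Gub x z : `](y - 1), (y + 1)[%classic x -> setT z -> `|partial1of2 (gausscos t th) x z| <= G z.
    move=> _ _; rewrite dE normrM.
    apply: (@le_trans _ _ ((Num.sqrt (t / 2))^-1 * expR (t / 2 * z ^+ 2) * expR (- t * z ^+ 2))).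
      apply: ler_pM => //; first exact: ler_norm_expR_sqr.
      by rewrite /gausscos normrM ger0_norm ?expR_ge0// ler_piMr ?expR_ge0// cos_max.
    by rewrite -mulrA -expRD; have -> : t / 2 * z ^+ 2 + - t * z ^+ 2 = - (t / 2) * z ^+ 2 by field.
  split; first exact: (derivable_under_integral measurableT Iy int_f der G0 intG Gub).
  rewrite -derive1E (differentiation_under_integral measurableT Iy int_f der G0 intG Gub).
  by rewrite -integral_mul_gausscos//; apply: eq_Rintegral => z _; exact: dE.
(* [E] is the inverse of the expected Gaussian factor, so that [K * E] has derivative 0. *)
pose E y := expR (y ^+ 2 / (4 * t)).
have dE (y : R) : is_derive y 1 E (y / (2 * t) * E y).
  have H0 : is_derive y 1 (fun y : R => y ^+ 2 / (4 * t)) (y / (2 * t)).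
    have -> : (fun y : R => y ^+ 2 / (4 * t)) = (4 * t)^-1 *: ((@id R) ^+ 2).
      by apply/funext => z; rewrite mulrC.
    by apply: is_derive_eq; rewrite /GRing.scale/= expr1 mulr_natl mulr1 -mulr_natl; field; rewrite gt_eqF.
  by apply: is_derive_eq (is_derive1_comp (is_derive_expR _) H0) _; rewrite mulrC.
have C : (K * E) xi = (K * E) 0.
  apply: is_derive_0_is_cst => y.
  by apply: is_derive_eq (is_deriveM (dK y) (dE y)) _; rewrite /GRing.scale/=; ring.
have K0 : K 0 = Num.sqrt (pi / t) * cos th.
  transitivity (\int[mu]_x (cos th * expR (- t * x ^+ 2)))%R.
    by apply: eq_Rintegral => x _; rewrite /gausscos mulr0 add0r mulrC.
  rewrite RintegralZl//; last exact: integrable_gauss1.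
  by rewrite /Rintegral ge0_integral_gauss// mulrC.
apply: (@mulIf _ (E xi)); first by rewrite gt_eqF// expR_gt0.
transitivity (K 0 * E 0); first exact: C.
rewrite K0 /E expr0n/= mul0r expR0 mulr1 mulrAC -[in RHS](mulrA (Num.sqrt _)) -expRD.
by rewrite addNr expR0 mulr1.
Qed.

End gauss1.

(** * Integration by coordinates and Gaussians on R^n *)

Section signed.
Variables (R : realType).

Lemma integral_leb n (f : borelRn R n -> \bar R) : measurable_fun setT f ->
  (\int[leb]_x f x = \int[borel_lebesgue R n]_x f x)%E.
Proof.
move=> mf; rewrite [LHS]integralE [RHS]integralE.
congr (_ - _)%E.
- apply: (ge0_integral_leb (f := f^\+%E)); first exact: measurable_funepos.
  by move=> x; exact: funepos_ge0.
- apply: (ge0_integral_leb (f := f^\-%E)); first exact: measurable_funeneg.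
  by move=> x; exact: funeneg_ge0.
Qed.

Lemma ge0_integral_affine n (c : R) (b : 'rV[R]_n) (f : borelRn R n -> \bar R) :
  0 < c -> measurable_fun setT f -> (forall x, 0 <= f x)%E ->
  (\int[leb]_x f (c *: (x : 'rV[R]_n) + b)%R = (c^-1 ^+ n)%:E * \int[leb]_x f x)%E.
Proof.
move=> c0 mf f0.
have mT : measurable_fun setT (fun x : borelRn R n => (c *: (x : 'rV[R]_n) + b)%R : borelRn R n).
  exact: measurable_funZD.
have := ge0_integral_leb (measurableT_comp mf mT) (fun x => f0 _) => /= ->.
by rewrite ge0_integral_affine_borel// ge0_integral_leb.
Qed.

Lemma Rintegral_affine n (c : R) (b : 'rV[R]_n) (f : borelRn R n -> R) :
  0 < c -> measurable_fun setT f -> leb.-integrable setT (EFin \o (f : Rn R n -> R)) ->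
  (\int[leb]_x f (c *: (x : 'rV[R]_n) + b) = c^-1 ^+ n * \int[leb]_x f x)%R.
Proof.
move=> c0 mf intf.
have cn0 : (0 <= (c^-1 ^+ n)%:E)%E by rewrite lee_fin exprn_ge0// invr_ge0 ltW.
have mEf : measurable_fun setT (EFin \o f) by exact/measurable_EFinP.
have mp := measurable_funepos mEf; have mn := measurable_funeneg mEf.
have ip := integrable_fin_num measurableT (integrable_funepos measurableT intf).
have in_ := integrable_fin_num measurableT (integrable_funeneg measurableT intf).
rewrite /Rintegral -[RHS]/(fine (_%:E) * _) -fineM//; last exact: integrable_fin_num.
congr fine; rewrite [LHS]integralE [X in (_ * X)%E]integralE muleBr//; last first.
  by rewrite fin_num_adde_defl// fin_numN.
congr (_ - _)%E.
- have H := ge0_integral_affine b c0 mp (funepos_ge0 _).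
  by rewrite -[RHS]H; apply: eq_integral => x _; rewrite !funeposE.
- have H := ge0_integral_affine b c0 mn (funeneg_ge0 _).
  by rewrite -[RHS]H; apply: eq_integral => x _; rewrite !funenegE.
Qed.

Lemma integral_consRn n (f : borelRn R n.+1 -> R) :
  measurable_fun setT f -> (borel_lebesgue R n.+1).-integrable setT (EFin \o f) ->
  (\int[borel_lebesgue R n.+1]_x (f x)%:E =
   \int[lebesgue_measure]_t \int[borel_lebesgue R n]_y (f (consRn (t, y)))%:E)%E.
Proof.
move=> mf intf.
have mEf : measurable_fun setT (EFin \o f) by exact/measurable_EFinP.
have mcons := @measurable_consRn R n.
have iE : ((lebesgue_measure \x borel_lebesgue R n)%E).-integrable setT ((EFin \o f) \o @consRn R n).
  apply/integrableP; split; first exact: (measurableT_comp mEf mcons).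
  have /integrableP[_] := intf; rewrite ge0_integral_consRn//; last first.
    exact: (measurableT_comp (@abse_measurable R setT) mEf).
  rewrite -(fubini_tonelli1 (fun p => `|(EFin \o f) (consRn p)|%E))//.
  exact: (measurableT_comp (@abse_measurable R setT) (measurableT_comp mEf mcons)).
transitivity (\int[lebesgue_measure \x borel_lebesgue R n]_x ((EFin \o f) \o @consRn R n) x)%E; last first.
  by rewrite -(integral12_prod_meas1 iE).
have := @integral_pushforward _ _ _ _ R _ mcons (lebesgue_measure \x borel_lebesgue R n)%E setT (EFin \o f) mEf.
rewrite preimage_setT => /(_ iE measurableT) <-.
by apply: eq_measure_integral => A mA _.
Qed.

Lemma integral_prod_consRn n (h : R -> R) (c : R) : measurable_fun setT h -> (forall x, 0 <= h x) ->
  (\int[lebesgue_measure]_x (h x)%:E = c%:E)%E ->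
  (\int[borel_lebesgue R n]_x (\prod_(i < n) h ((x : 'rV[R]_n) ord0 i))%:E = (c ^+ n)%:E)%E.
Proof.
move=> mh h0 hc.
have mprod m : measurable_fun setT (fun x : borelRn R m => \prod_(i < m) h ((x : 'rV[R]_m) ord0 i)).
  apply: measurable_prod => i _; apply: (measurableT_comp mh); exact: (measurable_coordRn i (@measurable_id _ _ setT)).
have prod0 m (x : 'rV[R]_m) : 0 <= \prod_(i < m) h (x ord0 i) by apply: prodr_ge0.
elim: n => [|n IH].
  transitivity (\int[borel_lebesgue R 0]_x 1%:E)%E.
    by apply: eq_integral => x _; rewrite big_ord0.
  by rewrite integral_cst// /= expr0 mul1e diracT.
rewrite ge0_integral_consRn//; last first.
- by move=> x; rewrite lee_fin.
- by apply/measurable_EFinP; exact: mprod.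
have E t y : \prod_(i < n.+1) h ((consRn (t, y) : 'rV[R]_n.+1) ord0 i) = h t * \prod_(i < n) h ((y : 'rV[R]_n) ord0 i).
  rewrite big_ord_recl; congr (h _ * _).
    rewrite (_ : ord0 = @lshift 1 n ord0); last exact/val_inj.
    by rewrite /consRn (@row_mxEl R 1 1 n) mxE.
  apply: eq_bigr => i _; rewrite (_ : lift ord0 i = @rshift 1 n i); last exact/val_inj.
  by rewrite /consRn (@row_mxEr R 1 1 n).
transitivity (\int[lebesgue_measure]_t ((c ^+ n)%:E * (h t)%:E))%E.
  apply: eq_integral => t _; under eq_integral do rewrite E EFinM.
  rewrite ge0_integralZl//; last first.
  - by rewrite lee_fin.
  - by move=> y _; rewrite lee_fin.
  - by apply/measurable_EFinP; exact: mprod.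
  by rewrite IH muleC.
rewrite ge0_integralZl//; last first.
- by rewrite lee_fin exprn_ge0// -lee_fin -hc integral_ge0// => x _; rewrite lee_fin.
- by move=> x _; rewrite lee_fin.
- exact/measurable_EFinP.
by rewrite hc -EFinM exprSr.
Qed.

End signed.

Section gaussn.
Variable R : realType.

Definition gaussn n (t : R) (x : Rn R n) : R := expR (- t * dotp x x).

Lemma dotp_consRn n (s t : R) (x y : Rn R n) :
  dotp (consRn (s, x) : Rn R n.+1) (consRn (t, y)) = s * t + dotp x y.
Proof.
rewrite /dotp big_ord_recl; congr (_ * _ + _).
- rewrite (_ : ord0 = @lshift 1 n ord0) in |- * ; last exact/val_inj.
  by rewrite /consRn (@row_mxEl R 1 1 n) mxE.
- rewrite (_ : ord0 = @lshift 1 n ord0) in |- * ; last exact/val_inj.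
  by rewrite /consRn (@row_mxEl R 1 1 n) mxE.
- apply: eq_bigr => i _; rewrite (_ : lift ord0 i = @rshift 1 n i); last exact/val_inj.
  by rewrite /consRn !(@row_mxEr R 1 1 n).
Qed.

Lemma gaussn_prod n t (x : Rn R n) : gaussn t x = \prod_(i < n) expR (- t * (x ord0 i) ^+ 2).
Proof. by rewrite /gaussn /dotp mulr_sumr expR_sum; apply: eq_bigr => i _; rewrite expr2. Qed.

Lemma borel_gaussn n t : measurable_fun setT (gaussn t : borelRn R n -> R).
Proof.
apply: measurableT_comp => //; apply: measurable_funM => //.
exact: (measurable_dotp (@measurable_id _ _ setT) (@measurable_id _ _ setT)).
Qed.

Lemma gaussn_gt0 n t (x : Rn R n) : 0 < gaussn t x. Proof. exact: expR_gt0. Qed.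

Lemma gaussn_ge0 n t (x : Rn R n) : 0 <= gaussn t x. Proof. exact: expR_ge0. Qed.

Lemma integral_gaussn n t : 0 < t ->
  (\int[borel_lebesgue R n]_x (gaussn t x)%:E = (Num.sqrt (pi / t) ^+ n)%:E)%E.
Proof.
move=> t0.
rewrite -(@integral_prod_consRn R n (fun x => expR (- t * x ^+ 2)) (Num.sqrt (pi / t)))//.
- by apply: eq_integral => x _; rewrite gaussn_prod.
- by apply: measurableT_comp => //; exact: measurable_funM.
- exact: ge0_integral_gauss.
Qed.

Definition gaussncos n (t th : R) (xi x : Rn R n) := gaussn t x * cos (dotp x xi + th).

Lemma borel_gaussncos n t th (xi : Rn R n) : measurable_fun setT (gaussncos t th xi : borelRn R n -> R).
Proof.
apply: measurable_funM; first exact: borel_gaussn.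
apply: measurableT_comp; first exact: (continuous_measurable_fun (@continuous_cos R)).
apply: measurable_funD => //.
exact: (measurable_dotp (@measurable_id _ _ setT) (measurable_cst (xi : borelRn R n))).
Qed.

Lemma integrable_gaussncos n t th (xi : Rn R n) : 0 < t ->
  (borel_lebesgue R n).-integrable setT (EFin \o (gaussncos t th xi : borelRn R n -> R)).
Proof.
move=> t0; apply: (@le_integrable _ _ _ _ _ _ _ (EFin \o (gaussn t : borelRn R n -> R))) => //.
- by apply/measurable_EFinP; exact: borel_gaussncos.
- move=> x _; rewrite /= lee_fin normrM ger0_norm ?gaussn_ge0// ler_piMr ?gaussn_ge0//.
  exact: cos_max.
- apply/ge0_integrableP; last by rewrite integral_gaussn// ltry.
  + exact: borel_gaussn.
  + by move=> x; exact: gaussn_ge0.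
Qed.

(** When the first coordinate is fixed to [x], the inner integral is of the same kind with the phase
    [x * s + th]; hence the induction for all [th] at once. *)
Lemma integral_gaussncos n t th (xi : Rn R n) : 0 < t ->
  (\int[borel_lebesgue R n]_x (gaussncos t th xi x)%:E =
  (Num.sqrt (pi / t) ^+ n * gaussn ((4 * t)^-1) xi * cos th)%:E)%E.
Proof.
move=> t0; elim: n th xi => [|n IH] th xi.
  transitivity (\int[borel_lebesgue R 0]_x (cos th)%:E)%E.
    by apply: eq_integral => x _; rewrite /gaussncos /gaussn /dotp !big_ord0 mulr0 expR0 mul1r add0r.
  by rewrite integral_cst//= diracT mule1 /gaussn /dotp !big_ord0 mulr0 expR0 !mul1r.
rewrite integral_consRn; [|exact: borel_gaussncos|exact: integrable_gaussncos].
rewrite -(unconsRnK xi); case: (unconsRn xi) => s xi'.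
have E x y : gaussncos t th (consRn (s, xi')) (consRn (x, y)) =
   expR (- t * x ^+ 2) * gaussncos t (x * s + th) xi' y.
  rewrite /gaussncos /gaussn !dotp_consRn mulrDr expRD -mulrA -expr2; congr (_ * (_ * cos _)).
  by rewrite [x * s + _]addrC -addrA.
set k := Num.sqrt (pi / t); pose C := k ^+ n * gaussn ((4 * t)^-1) xi'.
transitivity (\int[lebesgue_measure]_x (C * gausscos t th s x)%:E)%E.
  apply: eq_integral => x _; under eq_integral do rewrite E EFinM.
  rewrite integralZl//; last exact: integrable_gaussncos.
  by rewrite IH -EFinM /gausscos /C; congr (_%:E); rewrite -/k; ring.
under eq_integral do rewrite EFinM.
rewrite integralZl//; last exact: integrable_gausscos.
have I := integrable_fin_num measurableT (integrable_gausscos th s t0).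
rewrite -(fineK I) -EFinM; congr (_%:E).
have := integral_gausscos th s t0; rewrite /Rintegral => ->.
rewrite -/k /C /gaussn dotp_consRn mulrDr expRD -expr2.
have -> : - (s ^+ 2 / (4 * t)) = - (4 * t)^-1 * s ^+ 2 by rewrite mulrC mulNr.
by rewrite [k ^+ n.+1]exprSr; ring.
Qed.

End gaussn.

(** * Complex-valued integrals *)
Import ComplexField.Normc.

Section normc.
Variable R : realType.
Implicit Types (x y : R[i]) (r : R).

Lemma ReD x y : complex.Re (x + y) = complex.Re x + complex.Re y. Proof. by case: x; case: y. Qed.
Lemma ImD x y : complex.Im (x + y) = complex.Im x + complex.Im y. Proof. by case: x; case: y. Qed.
Lemma ReN x : complex.Re (- x) = - complex.Re x. Proof. by case: x. Qed.
Lemma ImN x : complex.Im (- x) = - complex.Im x. Proof. by case: x. Qed.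
Lemma ReM x y : complex.Re (x * y) = complex.Re x * complex.Re y - complex.Im x * complex.Im y.
Proof. by case: x; case: y. Qed.
Lemma ImM x y : complex.Im (x * y) = complex.Re x * complex.Im y + complex.Im x * complex.Re y.
Proof. by case: x; case: y. Qed.

Lemma eq_ReIm x y : complex.Re x = complex.Re y -> complex.Im x = complex.Im y -> x = y.
Proof. by case: x; case: y => ? ? ? ? /= -> ->. Qed.

Lemma normc_ge0 x : 0 <= normc x. Proof. by case: x => a b; exact: sqrtr_ge0. Qed.

Lemma normc_sqr x : normc x ^+ 2 = complex.Re x ^+ 2 + complex.Im x ^+ 2.
Proof. by case: x => a b; rewrite sqr_sqrtr// addr_ge0// sqr_ge0. Qed.

Lemma normc_eq0 x : normc x = 0 -> x = 0. Proof. exact: eq0_normc. Qed.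

Lemma normr_Re_le x : `|complex.Re x| <= normc x.
Proof.
rewrite -(@ler_pXn2r _ 2)// ?nnegrE ?normc_ge0// normc_sqr real_normK ?num_real//.
by rewrite lerDl sqr_ge0.
Qed.

Lemma normr_Im_le x : `|complex.Im x| <= normc x.
Proof.
rewrite -(@ler_pXn2r _ 2)// ?nnegrE ?normc_ge0// normc_sqr real_normK ?num_real//.
by rewrite lerDr sqr_ge0.
Qed.

Lemma normc_le_ReIm x : normc x <= `|complex.Re x| + `|complex.Im x|.
Proof.
rewrite -(@ler_pXn2r _ 2)// ?nnegrE ?normc_ge0// ?addr_ge0//.
rewrite normc_sqr sqrrD !real_normK ?num_real// lerD2r lerDl.
by rewrite mulrn_wge0// mulr_ge0.
Qed.

Lemma normc_real r : normc r%:C = `|r|. Proof. by rewrite /= expr0n/= addr0 sqrtr_sqr. Qed.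

Lemma normcB x y : normc (x - y) = normc (y - x). Proof. by rewrite -normcN opprB. Qed.

Lemma normc_conj x : normc (conjc x) = normc x. Proof. by case: x => a b /=; rewrite sqrrN. Qed.

Lemma normc_expi r : normc (expi r) = 1. Proof. by rewrite /= cos2Dsin2 sqrtr1. Qed.

Lemma expiD r s : expi (r + s) = expi r * expi s.
Proof. by apply: eq_ReIm; rewrite ?ReM ?ImM/= ?cosD ?sinD//; ring. Qed.

Lemma conj_expi r : conjc (expi r) = expi (- r). Proof. by rewrite /expi/= cosN sinN. Qed.

Lemma conjM x y : conjc (x * y) = conjc x * conjc y.
Proof. by apply: eq_ReIm; case: x; case: y => a b c d /=; ring. Qed.

Lemma expi0 : expi (0 : R) = 1. Proof. by rewrite /expi cos0 sin0. Qed.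

Lemma mulc_conj x : x * conjc x = (normc x ^+ 2)%:C.
Proof. by apply: eq_ReIm; rewrite ?ReM ?ImM ?normc_sqr; case: x => a b /=; ring. Qed.

Lemma realCM r s : (r * s)%:C = r%:C * s%:C.
Proof. by apply: eq_ReIm; rewrite ?ReM ?ImM/=; ring. Qed.

Lemma ReZ r x : complex.Re (r%:C * x) = r * complex.Re x.
Proof. by rewrite ReM/= mul0r subr0. Qed.

Lemma ImZ r x : complex.Im (r%:C * x) = r * complex.Im x.
Proof. by rewrite ImM/= mul0r addr0. Qed.

Lemma ler_normcD x y z : normc (x - z) <= normc (x - y) + normc (y - z).
Proof. by rewrite (le_trans _ (le_normcD _ _))// addrA subrK. Qed.

Lemma ler_normc_distD x y : normc x <= normc y + normc (x - y).
Proof. by rewrite (le_trans _ (le_normcD _ _))// addrC subrK. Qed.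

Lemma normc_sqrD x y : normc (x + y) ^+ 2 <= 2 * normc x ^+ 2 + 2 * normc y ^+ 2.
Proof.
rewrite !normc_sqr ReD ImD.
have := sqr_ge0 (complex.Re x - complex.Re y).
have := sqr_ge0 (complex.Im x - complex.Im y).
by nra.
Qed.

End normc.

Section cint.
Context d (T : measurableType d) (R : realType).
Variable m : {measure set T -> \bar R}.
Implicit Types (f g : T -> R[i]).

(** The notions of [measurable_cplx] and [integralC] over any measurable space: functions on [Rn],
    on [borelRn] and on products of these all occur. *)
Definition cmeas f := measurable_fun setT (fun x => complex.Re (f x)) /\
  measurable_fun setT (fun x => complex.Im (f x)).

Definition cint f : R[i] := (\int[m]_x complex.Re (f x)) +i* (\int[m]_x complex.Im (f x)).

Definition cintegrable f := m.-integrable setT (EFin \o (fun x => complex.Re (f x))) /\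
  m.-integrable setT (EFin \o (fun x => complex.Im (f x))).

Lemma cmeasD f g : cmeas f -> cmeas g -> cmeas (fun x => f x + g x).
Proof.
move=> [f1 f2] [g1 g2]; split.
- by under eq_fun do rewrite ReD; exact: measurable_funD.
- by under eq_fun do rewrite ImD; exact: measurable_funD.
Qed.

Lemma cmeasN f : cmeas f -> cmeas (fun x => - f x).
Proof.
move=> [f1 f2]; split.
- by under eq_fun do rewrite ReN; exact: measurableT_comp.
- by under eq_fun do rewrite ImN; exact: measurableT_comp.
Qed.

Lemma cmeasB f g : cmeas f -> cmeas g -> cmeas (fun x => f x - g x).
Proof. by move=> mf mg; apply: cmeasD => //; exact: cmeasN. Qed.

Lemma cmeasM f g : cmeas f -> cmeas g -> cmeas (fun x => f x * g x).
Proof.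
move=> [f1 f2] [g1 g2]; split.
- by under eq_fun do rewrite ReM; apply: measurable_funB; exact: measurable_funM.
- by under eq_fun do rewrite ImM; apply: measurable_funD; exact: measurable_funM.
Qed.

Lemma cmeas_cst c : cmeas (fun=> c). Proof. by split; exact: measurable_cst. Qed.

Lemma cmeas_real (h : T -> R) : measurable_fun setT h -> cmeas (fun x => (h x)%:C).
Proof. by move=> mh; split => //=; exact: measurable_cst. Qed.

Lemma cmeas_conj f : cmeas f -> cmeas (fun x => conjc (f x)).
Proof.
move=> [f1 f2]; split.
- by rewrite (_ : (fun x => _) = (fun x => complex.Re (f x)))//; apply/funext => x; case: (f x).
- rewrite (_ : (fun x => _) = (fun x => - complex.Im (f x))); first exact: measurableT_comp.
  by apply/funext => x; case: (f x).
Qed.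

Lemma cmeas_expi (h : T -> R) : measurable_fun setT h -> cmeas (fun x => expi (h x)).
Proof.
move=> mh; split => /=; apply: measurableT_comp => //; apply: continuous_measurable_fun.
- exact: continuous_cos.
- exact: continuous_sin.
Qed.

Lemma measurable_normc f : cmeas f -> measurable_fun setT (fun x => normc (f x)).
Proof.
move=> [f1 f2].
rewrite (_ : (fun x => _) = (fun x => Num.sqrt (complex.Re (f x) ^+ 2 + complex.Im (f x) ^+ 2))); last first.
  by apply/funext => x; case: (f x).
apply: (measurableT_comp (continuous_measurable_fun (@sqrt_continuous R))).
by apply: measurable_funD; exact: measurable_funX.
Qed.

Lemma cintegrable_meas f : cintegrable f -> cmeas f.
Proof.
by move=> [/integrableP[/measurable_EFinP f1 _] /integrableP[/measurable_EFinP f2 _]].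
Qed.

Lemma cintegrable_le f (g : T -> R) : cmeas f -> m.-integrable setT (EFin \o g) ->
  (forall x, normc (f x) <= g x) -> cintegrable f.
Proof.
move=> [f1 f2] ig fg; split; apply: le_integrable ig => //; try exact/measurable_EFinP;
  move=> x _ /=; rewrite lee_fin (le_trans _ (ler_norm _))// (le_trans _ (fg x))//.
- exact: normr_Re_le.
- exact: normr_Im_le.
Qed.

Lemma cintegrable_normc f : cintegrable f -> m.-integrable setT (EFin \o (fun x => normc (f x))).
Proof.
move=> /[dup] /cintegrable_meas mf [f1 f2].
have I := integrableD measurableT (integrable_norm f1) (integrable_norm f2).
apply: le_integrable I => //; first by apply/measurable_EFinP; exact: measurable_normc.
move=> x _ /=; rewrite lee_fin ger0_norm ?normc_ge0// ger0_norm ?addr_ge0//.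
exact: normc_le_ReIm.
Qed.

Lemma cintegrableP f : cmeas f ->
  cintegrable f <-> (\int[m]_x (normc (f x))%:E < +oo)%E.
Proof.
move=> mf; rewrite -(ge0_integrableP _ (measurable_normc mf)) => [|x]; last exact: normc_ge0.
split => [|H]; first exact: cintegrable_normc.
exact: cintegrable_le H _.
Qed.

Lemma cintegrableD f g : cintegrable f -> cintegrable g -> cintegrable (fun x => f x + g x).
Proof.
move=> [f1 f2] [g1 g2]; split.
- apply: eq_integrable (integrableD measurableT f1 g1) => // x _ /=; by rewrite ReD.
- apply: eq_integrable (integrableD measurableT f2 g2) => // x _ /=; by rewrite ImD.
Qed.

Lemma cintD f g : cintegrable f -> cintegrable g ->
  cint (fun x => f x + g x) = cint f + cint g.
Proof.
move=> [f1 f2] [g1 g2]; rewrite /cint; apply: eq_ReIm => /=.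
- by rewrite -RintegralD//; apply: eq_Rintegral => x _; rewrite ReD.
- by rewrite -RintegralD//; apply: eq_Rintegral => x _; rewrite ImD.
Qed.

Lemma cintegrableZ c f : cintegrable f -> cintegrable (fun x => c * f x).
Proof.
move=> /[dup] /cintegrable_meas mf /cintegrable_normc I.
apply: (cintegrable_le (g := fun x => normc c * normc (f x))).
- by apply: cmeasM => //; exact: cmeas_cst.
- exact: (integrableZl measurableT (normc c) I).
- by move=> x; rewrite normcM.
Qed.

Lemma cintZ c f : cintegrable f -> cint (fun x => c * f x) = c * cint f.
Proof.
move=> [f1 f2]; rewrite /cint; apply: eq_ReIm; rewrite ?ReM ?ImM/=.
- rewrite -!RintegralZl// -RintegralB//; [|exact: (integrableZl measurableT _ f1)|exact: (integrableZl measurableT _ f2)].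
  by apply: eq_Rintegral => x _; rewrite ReM.
- rewrite -!RintegralZl// -RintegralD//; [|exact: (integrableZl measurableT _ f2)|exact: (integrableZl measurableT _ f1)].
  by apply: eq_Rintegral => x _; rewrite ImM.
Qed.

Lemma cintegrableN f : cintegrable f -> cintegrable (fun x => - f x).
Proof. by move=> /(cintegrableZ (-1)); under eq_fun do rewrite mulN1r. Qed.

Lemma cintN f : cintegrable f -> cint (fun x => - f x) = - cint f.
Proof. by move=> /(cintZ (-1)); under eq_fun do rewrite mulN1r; rewrite mulN1r. Qed.

Lemma cintB f g : cintegrable f -> cintegrable g ->
  cint (fun x => f x - g x) = cint f - cint g.
Proof. by move=> If Ig; rewrite cintD ?cintN//; exact: cintegrableN. Qed.

Lemma cint_conj f : cintegrable f -> cint (fun x => conjc (f x)) = conjc (cint f).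
Proof.
move=> [f1 f2]; rewrite /cint; apply: eq_ReIm => /=.
- by apply: eq_Rintegral => x _; case: (f x).
- rewrite -mulN1r -RintegralZl//.
  by apply: eq_Rintegral => x _; rewrite mulN1r; case: (f x).
Qed.

Lemma cintegrable_conj f : cintegrable f -> cintegrable (fun x => conjc (f x)).
Proof.
move=> /[dup] /cintegrable_meas mf /cintegrable_normc I.
apply: (cintegrable_le _ I); first exact: cmeas_conj.
by move=> x; rewrite normc_conj.
Qed.

Lemma cint_real (h : T -> R) : cint (fun x => (h x)%:C) = (\int[m]_x h x)%:C.
Proof. by rewrite /cint/=; congr (_ +i* _); rewrite /Rintegral integral0. Qed.

Lemma eq_cint f g : f =1 g -> cint f = cint g.
Proof. by move=> /funext ->. Qed.

Lemma normc_cint f : cintegrable f -> normc (cint f) <= \int[m]_x normc (f x).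
Proof.
move=> If; have If' := cintegrable_normc If.
have [->|z0] := eqVneq (cint f) 0; first by rewrite normc0; apply: Rintegral_ge0 => x _; exact: normc_ge0.
have n0 : 0 < normc (cint f).
  by rewrite lt_neqAle normc_ge0 andbT eq_sym; apply: contra z0 => /eqP/normc_eq0 ->.
(* A factor of modulus 1 that turns the integral into its modulus, so that only a real part remains
   to be estimated. *)
pose c := conjc (cint f) * ((normc (cint f))^-1)%:C.
have c1 : normc c = 1.
  by rewrite normcM normc_conj normc_real ger0_norm ?invr_ge0 ?normc_ge0// mulfV// gt_eqF.
have E : normc (cint f) = complex.Re (cint (fun x => c * f x)).
  rewrite cintZ// /c mulrAC [conjc _ * _]mulrC mulc_conj mulrC ReZ/=.
  by rewrite expr2 mulrA mulVf ?mul1r// gt_eqF.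
rewrite E; apply: le_Rintegral => //.
- by have [] := cintegrableZ c If.
- move=> x _; rewrite (le_trans (ler_norm _))// (le_trans (normr_Re_le _))//.
  by rewrite normcM c1 mul1r.
Qed.

Lemma cintegrable_mul_expi f (h : T -> R) : measurable_fun setT h -> cintegrable f ->
  cintegrable (fun x => f x * expi (h x)).
Proof.
move=> mh If; have mf := cintegrable_meas If.
apply: (cintegrable_le _ (cintegrable_normc If)).
- by apply: cmeasM => //; exact: cmeas_expi.
- by move=> x; rewrite normcM normc_expi mulr1.
Qed.

Lemma measurable_funMl (c : R) (h : T -> R) : measurable_fun setT h -> measurable_fun setT (fun x => c * h x).
Proof. by move=> mh; apply: measurable_funM. Qed.

Lemma le_normc_cint f : cintegrable f -> ((normc (cint f))%:E <= \int[m]_x (normc (f x))%:E)%E.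
Proof.
move=> If; rewrite -[leRHS]fineK; first by rewrite lee_fin; exact: normc_cint.
by apply: integrable_fin_num => //; exact: cintegrable_normc.
Qed.

Lemma normc_cint_mul_expi f (h : T -> R) : measurable_fun setT h -> cintegrable f ->
  normc (cint (fun x => f x * expi (h x))) <= \int[m]_x normc (f x).
Proof.
move=> mh If; apply: (le_trans (normc_cint (cintegrable_mul_expi mh If))).
rewrite le_eqVlt; apply/orP; left; apply/eqP; apply: eq_Rintegral => x _.
by rewrite normcM normc_expi mulr1.
Qed.

End cint.

Lemma cmeas_comp (R : realType) d (T : measurableType d) d' (T' : measurableType d') (f : T' -> R[i]) (g : T -> T') :
  measurable_fun setT g -> cmeas f -> cmeas (f \o g).
Proof. by move=> mg [f1 f2]; split; [exact: (measurableT_comp f1 mg)|exact: (measurableT_comp f2 mg)]. Qed.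

(** * Fubini's theorem for oscillating kernels *)

Section cfubini.
Context d1 d2 (T1 : measurableType d1) (T2 : measurableType d2) (R : realType).
Variables (m1 : {sigma_finite_measure set T1 -> \bar R}) (m2 : {sigma_finite_measure set T2 -> \bar R}).

Lemma Rfubini (f : T1 * T2 -> R) : (m1 \x m2)%E.-integrable setT (EFin \o f) ->
  (forall x, m2.-integrable setT (fun y => (f (x, y))%:E)) ->
  (forall y, m1.-integrable setT (fun x => (f (x, y))%:E)) ->
  (\int[m1]_x \int[m2]_y f (x, y) = \int[m2]_y \int[m1]_x f (x, y))%R.
Proof.
move=> If I1 I2; rewrite /Rintegral; congr fine.
transitivity (\int[m1]_x \int[m2]_y (f (x, y))%:E)%E.
  by apply: eq_integral => x _; rewrite fineK//; exact: integrable_fin_num.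
transitivity (\int[m2]_y \int[m1]_x (f (x, y))%:E)%E; first exact: (Fubini If).
by apply: eq_integral => y _; rewrite fineK//; exact: integrable_fin_num.
Qed.

Lemma cint_fubini (f : T1 * T2 -> R[i]) : cintegrable (m1 \x m2)%E f ->
  (forall x, cintegrable m2 (fun y => f (x, y))) ->
  (forall y, cintegrable m1 (fun x => f (x, y))) ->
  cint m1 (fun x => cint m2 (fun y => f (x, y))) = cint m2 (fun y => cint m1 (fun x => f (x, y))).
Proof.
move=> [f1 f2] I1 I2; rewrite /cint/=; congr (_ +i* _).
- apply: (Rfubini f1) => [x|y]; first by have [] := I1 x.
  by have [] := I2 y.
- apply: (Rfubini f2) => [x|y]; first by have [] := I1 x.
  by have [] := I2 y.
Qed.

Lemma cmeas_cint (f : T1 * T2 -> R[i]) : cintegrable (m1 \x m2)%E f ->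
  cmeas (fun x => cint m2 (fun y => f (x, y))).
Proof.
move=> [f1 f2]; split; apply: measurableT_comp => //.
- exact: (measurable_fubini_F f1).
- exact: (measurable_fubini_F f2).
Qed.

Lemma cintegrable_prod_expi (p : T1 -> R[i]) (q : T2 -> R[i]) (h : T1 * T2 -> R) :
  measurable_fun setT h -> cintegrable m1 p -> cintegrable m2 q ->
  cintegrable (m1 \x m2)%E (fun z => p z.1 * q z.2 * expi (h z)).
Proof.
move=> mh Ip Iq; have mp := cintegrable_meas Ip; have mq := cintegrable_meas Iq.
have mpq : cmeas (fun z : T1 * T2 => p z.1 * q z.2).
  by apply: cmeasM; [exact: (cmeas_comp measurable_fst mp)|exact: (cmeas_comp measurable_snd mq)].
apply: cintegrable_mul_expi => //.
apply/cintegrableP => //.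
have E : (\int[m1 \x m2]_z (normc (p z.1 * q z.2))%:E = \int[m1]_x \int[m2]_y (normc (p x) * normc (q y))%:E)%E.
  rewrite (fubini_tonelli1 (fun z => (normc (p z.1 * q z.2))%:E)).
  - by apply: eq_integral => x _; apply: eq_integral => y _; rewrite /= normcM.
  - by apply/measurable_EFinP; exact: measurable_normc.
  - by move=> z; rewrite lee_fin normc_ge0.
rewrite E.
pose k := (\int[m2]_y (normc (q y))%:E)%E.
have k0 : (0 <= k)%E by apply: integral_ge0 => y _; rewrite lee_fin normc_ge0.
have kf : k \is a fin_num by rewrite ge0_fin_numE//; exact/(cintegrableP m2 mq).
have -> : (\int[m1]_x \int[m2]_y (normc (p x) * normc (q y))%:E = \int[m1]_x (k * (normc (p x))%:E))%E.
  apply: eq_integral => x _; rewrite muleC -ge0_integralZl//.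
  - by apply/measurable_EFinP; exact: measurable_normc.
  - by move=> y _; rewrite lee_fin normc_ge0.
  - by rewrite lee_fin normc_ge0.
rewrite ge0_integralZl//; last 2 first.
- by apply/measurable_EFinP; exact: measurable_normc.
- by move=> y _; rewrite lee_fin normc_ge0.
by rewrite lte_mul_pinfty//; exact/(cintegrableP m1 mp).
Qed.

Lemma cint_swap_expi (p : T1 -> R[i]) (q : T2 -> R[i]) (h : T1 * T2 -> R) :
  measurable_fun setT h -> cintegrable m1 p -> cintegrable m2 q ->
  cint m1 (fun x => p x * cint m2 (fun y => q y * expi (h (x, y)))) =
  cint m2 (fun y => q y * cint m1 (fun x => p x * expi (h (x, y)))).
Proof.
move=> mh Ip Iq.
have I := cintegrable_prod_expi mh Ip Iq.
have I1 x : cintegrable m2 (fun y => q y * expi (h (x, y))).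
  apply: cintegrable_mul_expi => //; exact: (measurableT_comp mh (measurable_pair1 _)).
have I2 y : cintegrable m1 (fun x => p x * expi (h (x, y))).
  apply: cintegrable_mul_expi => //; exact: (measurableT_comp mh (measurable_pair2 _)).
have := cint_fubini I; rewrite /= => H.
transitivity (cint m1 (fun x => cint m2 (fun y => p x * q y * expi (h (x, y))))).
  apply: eq_cint => x; rewrite -cintZ//; apply: eq_cint => y; exact: mulrA.
rewrite H => [|x|y]; last 2 first.
- have := cintegrableZ (p x) (I1 x); congr cintegrable; apply/funext => y; exact: mulrA.
- have := cintegrableZ (q y) (I2 y); congr cintegrable; apply/funext => x.
  by rewrite mulrA (mulrC (q y)).
apply: eq_cint => y; rewrite -cintZ//; apply: eq_cint => x.
by rewrite mulrA (mulrC (q y)).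
Qed.

(** The integrand need not be integrable in [x], so that Fubini's theorem does not give the
    measurability directly; the integrable weight [w] makes it apply, and [w'] removes the weight.
    For Fourier integrals these are [gaussn 1] and [gaussn (-1)]. *)
Lemma cmeas_cint_expi (p : T2 -> R[i]) (h : T1 * T2 -> R) (w w' : T1 -> R) :
  measurable_fun setT h -> cintegrable m2 p -> m1.-integrable setT (EFin \o w) ->
  measurable_fun setT w' -> (forall x, w' x * w x = 1) ->
  cmeas (fun x => cint m2 (fun y => p y * expi (h (x, y)))).
Proof.
move=> mh Ip Iw mw' ww'.
have mw : measurable_fun setT w by apply/measurable_EFinP; exact: (measurable_int m1).
have Iw' : cintegrable m1 (fun x => (w x)%:C).
  apply: (cintegrable_le _ (integrable_norm Iw)); first exact: cmeas_real.
  by move=> x; rewrite normc_real.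
have mI := cmeas_cint (cintegrable_prod_expi mh Iw' Ip).
have -> : (fun x => cint m2 (fun y => p y * expi (h (x, y)))) =
    (fun x => (w' x)%:C * cint m2 (fun y => (w x)%:C * p y * expi (h (x, y)))).
  apply/funext => x; have I : cintegrable m2 (fun y => p y * expi (h (x, y))).
    apply: cintegrable_mul_expi => //; exact: (measurableT_comp mh (measurable_pair1 _)).
  rewrite (_ : cint m2 (fun y => (w x)%:C * p y * expi (h (x, y))) =
    (w x)%:C * cint m2 (fun y => p y * expi (h (x, y)))).
    by rewrite mulrA -rmorphM ww' rmorph1 mul1r.
  by rewrite -cintZ//; apply: eq_cint => y; rewrite mulrA.
by apply: cmeasM => //; exact: cmeas_real.
Qed.

End cfubini.

(** * Squared L^2 norms and their convergence to 0 *)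

Section cvge0.
Variable R : realType.
Implicit Types u v : nat -> \bar R.

Lemma cvge0P u : (forall k, 0 <= u k)%E ->
  u @ \oo --> 0%E <-> forall e : R, 0 < e -> \forall k \near \oo, (u k < e%:E)%E.
Proof.
move=> u0; split => [/fine_cvgP[uf /cvgr0Pnorm_lt cu] e e0|H].
  near=> k; have uk : u k \is a fin_num by near: k.
  rewrite -(fineK uk) lte_fin (le_lt_trans (ler_norm _))//.
  by near: k; exact: cu.
apply/fine_cvgP; split.
  by near=> k; rewrite ge0_fin_numE// (@lt_trans _ _ 1%:E)// ?ltry//; near: k; exact: H.
apply/cvgr0Pnorm_lt => e e0; near=> k.
have uk : u k \is a fin_num.
  by rewrite ge0_fin_numE// (@lt_trans _ _ 1%:E)// ?ltry//; near: k; exact: H.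
rewrite /= ger0_norm ?fine_ge0// -lte_fin fineK//.
by near: k; exact: H.
Unshelve. all: by end_near. Qed.

Lemma le_cvge0 u v : (forall k, 0 <= u k)%E -> (forall k, u k <= v k)%E ->
  v @ \oo --> 0%E -> u @ \oo --> 0%E.
Proof.
move=> u0 uv cv; apply: (@squeeze_cvge _ _ _ _ (cst 0%E) u v) => //; last exact: cvg_cst.
by apply: nearW => k /=; rewrite u0 uv.
Qed.

Lemma cvge0D u v : u @ \oo --> 0%E -> v @ \oo --> 0%E -> (fun k => u k + v k)%E @ \oo --> 0%E.
Proof. by move=> cu cv; rewrite -[X in _ --> X]adde0; apply: cvgeD. Qed.

Lemma cvge0Z (c : R) u : u @ \oo --> 0%E -> (fun k => c%:E * u k)%E @ \oo --> 0%E.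
Proof. by move=> cu; rewrite -[X in _ --> X](mule0 c%:E); apply: cvgeZl. Qed.

End cvge0.

Section E2.
Context d (T : measurableType d) (R : realType).
Variable m : {measure set T -> \bar R}.
Implicit Types (f g : T -> R[i]).

(** Squares avoid roots, at the price of factors 2 in the triangle inequality [E2D]; only finiteness
    and smallness have to be transferred to [L2norm]. *)
Definition E2 f := (\int[m]_x (normc (f x) ^+ 2)%:E)%E.

Lemma E2_ge0 f : (0 <= E2 f)%E.
Proof. by apply: integral_ge0 => x _; rewrite lee_fin sqr_ge0. Qed.

Lemma measurable_normc2 f : cmeas f -> measurable_fun setT (fun x => (normc (f x) ^+ 2)%:E).
Proof. by move=> mf; apply/measurable_EFinP; apply: measurable_funX; exact: measurable_normc. Qed.

Lemma le_E2 f g : cmeas f -> cmeas g -> (forall x, normc (f x) <= normc (g x)) -> (E2 f <= E2 g)%E.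
Proof.
move=> mf mg fg; apply: ge0_le_integral => //.
- by move=> x _; rewrite lee_fin sqr_ge0.
- exact: measurable_normc2.
- exact: measurable_normc2.
- by move=> x _; rewrite lee_fin ler_pXn2r// nnegrE normc_ge0.
Qed.

Lemma E2D f g : cmeas f -> cmeas g -> (E2 (fun x => f x + g x)%R <= 2%:E * E2 f + 2%:E * E2 g)%E.
Proof.
move=> mf mg; rewrite /E2 -!ge0_integralZl//; try exact: measurable_normc2;
  try by move=> x _; rewrite lee_fin sqr_ge0.
rewrite -ge0_integralD//; try (by move=> x _; rewrite mule_ge0// lee_fin sqr_ge0);
  try by (apply: measurable_funeM; exact: measurable_normc2).
apply: ge0_le_integral => //.
- by move=> x _; rewrite lee_fin sqr_ge0.
- by apply: measurable_normc2; exact: cmeasD.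
- by apply: emeasurable_funD; apply: measurable_funeM; exact: measurable_normc2.
- by move=> x _; rewrite -!EFinM -EFinD lee_fin normc_sqrD.
Qed.

Lemma E2Z c f : cmeas f -> E2 (fun x => c * f x) = ((normc c ^+ 2)%:E * E2 f)%E.
Proof.
move=> mf; rewrite /E2 -ge0_integralZl//.
- by apply: eq_integral => x _; rewrite normcM exprMn EFinM.
- exact: measurable_normc2.
- by move=> x _; rewrite lee_fin sqr_ge0.
- by rewrite lee_fin sqr_ge0.
Qed.

Lemma E2N f : E2 (fun x => - f x) = E2 f.
Proof. by apply: eq_integral => x _; rewrite normcN. Qed.

Lemma E2_conj f : E2 (fun x => conjc (f x)) = E2 f.
Proof. by apply: eq_integral => x _; rewrite normc_conj. Qed.

Lemma E2BC f g : E2 (fun x => f x - g x) = E2 (fun x => g x - f x).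
Proof. by apply: eq_integral => x _; rewrite normcB. Qed.

Lemma E2B f g : cmeas f -> cmeas g -> (E2 (fun x => f x - g x)%R <= 2%:E * E2 f + 2%:E * E2 g)%E.
Proof. by move=> mf mg; rewrite -(E2N g); apply: E2D => //; exact: cmeasN. Qed.

Lemma E2_dist f g (h : T -> R[i]) : cmeas f -> cmeas g -> cmeas h ->
  (E2 (fun x => f x - h x)%R <= 2%:E * E2 (fun x => f x - g x)%R + 2%:E * E2 (fun x => g x - h x)%R)%E.
Proof.
move=> mf mg mh; have -> : (fun x => f x - h x) = (fun x => (f x - g x) + (g x - h x)).
  by apply/funext => x; rewrite addrA subrK.
by apply: E2D; exact: cmeasB.
Qed.

Lemma E2_ae f g : cmeas f -> cmeas g -> (\forall x \ae m, f x = g x) -> E2 f = E2 g.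
Proof.
move=> mf mg fg; apply: ae_eq_integral => //; try exact: measurable_normc2.
by apply: filterS fg => x /= ->.
Qed.

Lemma E2_eq0 f : cmeas f -> E2 f = 0%E -> \forall x \ae m, f x = 0.
Proof.
move=> mf f0.
have [H _] := ae_eq_integral_abs m measurableT (measurable_normc2 mf).
have : (\int[m]_x `|(normc (f x) ^+ 2)%:E| = 0)%E.
  by rewrite -[RHS]f0; apply: eq_integral => x _; rewrite gee0_abs// lee_fin sqr_ge0.
move=> /H; apply: filterS => x /(_ I)/= [] /eqP; rewrite sqrf_eq0 => /eqP; exact: normc_eq0.
Qed.

Lemma E2_cvg_dominated (f_ : nat -> T -> R[i]) f (g : T -> R) : (forall k, cmeas (f_ k)) -> cmeas f ->
  m.-integrable setT (fun x => (g x ^+ 2)%:E) ->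
  (\forall x \ae m, normc (f_ k x - f x) @[k --> \oo] --> 0) ->
  (\forall x \ae m, forall k, normc (f_ k x - f x) <= g x) ->
  E2 (fun x => f_ k x - f x) @[k --> \oo] --> 0%E.
Proof.
move=> mf_ mf ig cv fg.
pose F k x := (normc (f_ k x - f x) ^+ 2)%:E.
have mF k : measurable_fun setT (F k) by apply: measurable_normc2; exact: cmeasB.
have cF : \forall x \ae m, setT x -> F k x @[k --> \oo] --> cst 0%E x.
  apply: filterS cv => x cv _; apply: cvg_EFin; first exact: nearW.
  by rewrite -[X in _ --> X](mulr0 0); apply: cvgM.
have dF : \forall x \ae m, forall k, setT x -> (`|F k x| <= (g x ^+ 2)%:E)%E.
  apply: filterS fg => x fg k _; rewrite gee0_abs ?lee_fin ?sqr_ge0//.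
  by rewrite ler_pXn2r// nnegrE ?normc_ge0// (le_trans _ (fg k))// normc_ge0.
have [_ _] := dominated_convergence measurableT mF (measurable_cst _) cF ig dF.
by rewrite integral0.
Qed.

(** The weighted inequality of arithmetic and geometric means; with [s] free, it does the work of
    the Cauchy-Schwarz inequality for [E2]. *)
Lemma ler_normcM_sqr (s : R) (x y : R[i]) : 0 < s ->
  normc (x * y) <= s * normc x ^+ 2 + s^-1 * normc y ^+ 2.
Proof.
move=> s0; rewrite normcM; set a := normc x; set b := normc y.
have h : 0 <= (s * a - b) ^+ 2 by exact: sqr_ge0.
have ab : 0 <= a * b by rewrite mulr_ge0// normc_ge0.
have si : 0 < s^-1 by rewrite invr_gt0.
have : 0 <= s^-1 * (s * a - b) ^+ 2 by rewrite mulr_ge0// ltW.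
have -> : s^-1 * (s * a - b) ^+ 2 = s * a ^+ 2 - 2 * (a * b) + s^-1 * b ^+ 2.
  by field; rewrite gt_eqF.
by lra.
Qed.

Lemma normcM_lty f g : cmeas f -> cmeas g -> (E2 f < +oo)%E -> (E2 g < +oo)%E ->
  cintegrable m (fun x => f x * g x).
Proof.
move=> mf mg f2 g2; apply/cintegrableP; first exact: cmeasM.
apply: (@le_lt_trans _ _ (E2 f + E2 g)%E); last by rewrite lte_add_pinfty.
rewrite /E2 -ge0_integralD//; try exact: measurable_normc2; try by move=> x _; rewrite lee_fin sqr_ge0.
apply: ge0_le_integral => //.
- by move=> x _; rewrite lee_fin normc_ge0.
- by apply/measurable_EFinP; apply: measurable_normc; exact: cmeasM.
- by apply: emeasurable_funD; exact: measurable_normc2.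
- move=> x _; rewrite -EFinD lee_fin (le_trans (ler_normcM_sqr _ _ ltr01))//.
  by rewrite invr1 !mul1r.
Qed.

Lemma normc_cintM_le (s : R) f g : 0 < s -> cmeas f -> cmeas g -> (E2 f < +oo)%E -> (E2 g < +oo)%E ->
  ((normc (cint m (fun x => f x * g x)))%:E <= s%:E * E2 f + s^-1%:E * E2 g)%E.
Proof.
move=> s0 mf mg f2 g2; have I := normcM_lty mf mg f2 g2.
apply: (@le_trans _ _ (\int[m]_x (normc (f x * g x)))%:E); first by rewrite lee_fin normc_cint.
rewrite /Rintegral fineK; last by apply: integrable_fin_num => //; exact: cintegrable_normc.
have s0' : (0 <= s%:E)%E by rewrite lee_fin ltW.
have si0 : (0 <= s^-1%:E)%E by rewrite lee_fin invr_ge0 ltW.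
rewrite /E2 -!ge0_integralZl//; try exact: measurable_normc2;
  try by move=> x _; rewrite lee_fin sqr_ge0.
rewrite -ge0_integralD//; try (by move=> x _; rewrite mule_ge0// lee_fin sqr_ge0);
  try by (apply: measurable_funeM; exact: measurable_normc2).
apply: ge0_le_integral => //.
- by move=> x _; rewrite lee_fin normc_ge0.
- by apply/measurable_EFinP; apply: measurable_normc; exact: cmeasM.
- by apply: emeasurable_funD; apply: measurable_funeM; exact: measurable_normc2.
- by move=> x _; rewrite -!EFinM -EFinD lee_fin ler_normcM_sqr.
Qed.

Lemma cintM_cvg0 f (g_ : nat -> T -> R[i]) : cmeas f -> (forall k, cmeas (g_ k)) ->
  (E2 f < +oo)%E -> E2 (g_ k) @[k --> \oo] --> 0%E ->
  normc (cint m (fun x => f x * g_ k x)) @[k --> \oo] --> 0.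
Proof.
move=> mf mg f2 /(cvge0P (fun k => E2_ge0 _)) cg.
apply/cvgr0Pnorm_lt => e e0.
have ff : E2 f \is a fin_num by rewrite ge0_fin_numE// E2_ge0.
(* This weight keeps the contribution of [f] below [e / 2], while that of [g_ k] is only multiplied
   by the constant [s^-1]. The [+ 1] covers [E2 f = 0]. *)
pose s := e / 2 / (fine (E2 f) + 1).
have F0 : 0 < fine (E2 f) + 1 by rewrite ltr_wpDl// fine_ge0// E2_ge0.
have s0 : 0 < s by rewrite !divr_gt0.
near=> k.
have gk : (E2 (g_ k) < (s * (e / 2))%:E)%E by near: k; apply: cg; rewrite mulr_gt0// divr_gt0.
rewrite ger0_norm ?normc_ge0// -lte_fin.
have g2 : (E2 (g_ k) < +oo)%E by rewrite (lt_trans gk)// ltry.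
apply: (le_lt_trans (normc_cintM_le s0 mf (mg k) f2 g2)).
have gf : E2 (g_ k) \is a fin_num by rewrite ge0_fin_numE// E2_ge0.
rewrite -(fineK ff) -(fineK gf) -!EFinM -EFinD lte_fin.
have h1 : s * fine (E2 f) < e / 2.
  by rewrite /s mulrAC ltr_pdivrMr// ltr_pM2l ?divr_gt0// ltrDl.
have h2 : s^-1 * fine (E2 (g_ k)) < e / 2.
  by rewrite ltr_pdivrMl// -lte_fin fineK.
by rewrite [e in ltRHS]splitr ltrD.
Unshelve. all: by end_near. Qed.

End E2.

Section L2norm.
Variables (R : realType) (n : nat).
Implicit Types f : Rn R n -> R[i].

Lemma E2_L2norm f : E2 leb f = poweR (L2norm f) 2.
Proof.
rewrite /L2norm (@poweR_Lnorm _ _ _ (@leb R n)) ?pnatr_eq0//; apply: eq_integral => x _.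
by rewrite /absC abse_EFin ger0_norm ?normc_ge0// poweR_EFin powR_mulrn// normc_ge0.
Qed.

Lemma L2norm_lt f (e : R) : 0 < e -> (L2norm f < e%:E)%E = (E2 leb f < (e ^+ 2)%:E)%E.
Proof.
move=> e0; rewrite E2_L2norm.
have : (0 <= L2norm f)%E by exact: Lnorm_ge0.
case: (L2norm f) => [r| |]; last by rewrite leeNy_eq.
- rewrite lee_fin => r0; rewrite poweR_EFin !lte_fin powR_mulrn// ltr_pXn2r// nnegrE//; exact: ltW.
- by rewrite poweRyr ?pnatr_eq0.
Qed.

Lemma L2norm_lty f : (L2norm f < +oo)%E <-> (E2 leb f < +oo)%E.
Proof.
rewrite E2_L2norm; have : (0 <= L2norm f)%E by exact: Lnorm_ge0.
case: (L2norm f) => [r| |]; last by rewrite leeNy_eq.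
- by rewrite poweR_EFin !ltry.
- by rewrite poweRyr ?pnatr_eq0.
Qed.

Lemma L2norm_cvg0 (f_ : nat -> Rn R n -> R[i]) :
  L2norm (f_ k) @[k --> \oo] --> 0%E <-> E2 leb (f_ k) @[k --> \oo] --> 0%E.
Proof.
rewrite cvge0P; last by move=> k; exact: Lnorm_ge0.
rewrite cvge0P; last by move=> k; exact: E2_ge0.
split => H e e0.
- have s0 : 0 < Num.sqrt e by rewrite sqrtr_gt0.
  by apply: filterS (H _ s0) => k; rewrite L2norm_lt// sqr_sqrtr// ltW.
- have s0 : 0 < e ^+ 2 by rewrite exprn_gt0.
  by apply: filterS (H _ s0) => k; rewrite L2norm_lt.
Qed.

End L2norm.

(** * The Fourier integral *)

Section dotp.
Variables (R : realType) (n : nat).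
Implicit Types (x y z : Rn R n) (c : R).

Lemma dotpC x y : dotp x y = dotp y x.
Proof. by apply: eq_bigr => i _; rewrite mulrC. Qed.

Lemma dotpDl x y z : dotp (x + y) z = dotp x z + dotp y z.
Proof. by rewrite -big_split/=; apply: eq_bigr => i _; rewrite mxE mulrDl. Qed.

Lemma dotpDr x y z : dotp z (x + y) = dotp z x + dotp z y.
Proof. by rewrite dotpC dotpDl !(dotpC z). Qed.

Lemma dotpZl c x y : dotp (c *: x) y = c * dotp x y.
Proof. by rewrite mulr_sumr; apply: eq_bigr => i _; rewrite mxE mulrA. Qed.

Lemma dotpZr c x y : dotp x (c *: y) = c * dotp x y.
Proof. by rewrite dotpC dotpZl dotpC. Qed.

Lemma dotpNl x y : dotp (- x) y = - dotp x y.
Proof. by rewrite -scaleN1r dotpZl mulN1r. Qed.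

Lemma dotpNr x y : dotp x (- y) = - dotp x y.
Proof. by rewrite dotpC dotpNl dotpC. Qed.

Lemma dotp0l x : dotp 0 x = 0.
Proof. by rewrite /dotp big1// => i _; rewrite mxE mul0r. Qed.

Lemma dotp_ge0 x : 0 <= dotp x x.
Proof. by apply: sumr_ge0 => i _; rewrite -expr2 sqr_ge0. Qed.

Definition dotpE := (dotpDl, dotpDr, dotpZl, dotpZr, dotpNl, dotpNr).

Lemma gaussnM s t x : gaussn s x * gaussn t x = gaussn (s + t) x.
Proof. by rewrite /gaussn -expRD -mulrDl opprD. Qed.

Lemma gaussnN t x : gaussn t (- x) = gaussn t x.
Proof. by rewrite /gaussn dotpNl dotpNr opprK. Qed.

Lemma gaussn_le1 t x : 0 <= t -> gaussn t x <= 1.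
Proof. by move=> t0; rewrite -expR0 ler_expR mulNr oppr_le0 mulr_ge0// dotp_ge0. Qed.

End dotp.

Section fourier_kernel.
Variables (R : realType) (n : nat).
Local Notation V := (Rn R n).
Local Notation leb := (@leb R n).
Implicit Types (f g h p q u : V -> R[i]) (x y xi : V) (s t : R).

(** [s] is the sign of the exponent: -1 for the Fourier transform, 1 for its inverse up to the
    constant of [iFT]. *)
Definition FT s u xi : R[i] := cint leb (fun x => u x * expi (s * dotp xi x)).

Lemma measurable_dotp2 : measurable_fun setT (fun p : V * V => dotp p.1 p.2).
Proof.
apply: (measurable_dotp (f := fun p : V * V => p.1) (g := fun p : V * V => p.2)).
- exact: (measurableT_comp (@measurable_toB R n) measurable_fst).
- exact: (measurableT_comp (@measurable_toB R n) measurable_snd).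
Qed.

Definition phase s (z : V * V) := s * dotp z.1 z.2.

Lemma measurable_phase s : measurable_fun setT (phase s).
Proof. exact: (measurable_funMl s measurable_dotp2). Qed.

Lemma measurable_phase2 s xi : measurable_fun setT (fun x : V => s * dotp xi x).
Proof. exact: (measurableT_comp (measurable_phase s) (measurable_pair1 xi)). Qed.

Definition N1 f := \int[leb]_x normc (f x).

Lemma N1_ge0 f : 0 <= N1 f. Proof. by apply: Rintegral_ge0 => x _; exact: normc_ge0. Qed.

Lemma normc_FT s f xi : cintegrable leb f -> normc (FT s f xi) <= N1 f.
Proof. exact: (normc_cint_mul_expi (measurable_phase2 s xi)). Qed.

Lemma cintegrable_FT s f xi : cintegrable leb f -> cintegrable leb (fun x => f x * expi (s * dotp xi x)).
Proof. exact: (cintegrable_mul_expi (measurable_phase2 s xi)). Qed.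

Lemma measurable_gaussn t : measurable_fun setT (gaussn t : V -> R).
Proof. exact: (borel_measurable_fun (@borel_gaussn R n t)). Qed.

Lemma ge0_integral_gaussn t : 0 < t ->
  (\int[leb]_x (gaussn t x)%:E = (Num.sqrt (pi / t) ^+ n)%:E)%E.
Proof.
move=> t0; rewrite -integral_gaussn//; apply: (ge0_integral_leb (f := fun x => (gaussn t x)%:E)).
- by apply/measurable_EFinP; exact: borel_gaussn.
- by move=> x; rewrite lee_fin gaussn_ge0.
Qed.

Lemma integrable_gaussn t : 0 < t -> leb.-integrable setT (EFin \o gaussn t).
Proof.
move=> t0; apply/(ge0_integrableP leb (measurable_gaussn t)).
- exact: gaussn_ge0.
- by rewrite ge0_integral_gaussn// ltry.
Qed.

Lemma cmeas_FT s f : cintegrable leb f -> cmeas (FT s f).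
Proof.
move=> If.
apply: (cmeas_cint_expi (measurable_phase s) If (integrable_gaussn (@ltr01 R)) (measurable_gaussn (-1))).
by move=> x; rewrite gaussnM addNr /gaussn oppr0 mul0r expR0.
Qed.

(** The multiplication formula: Fubini's theorem, with a phase that is symmetric in its two
    variables. *)
Lemma FT_swap s p q : cintegrable leb p -> cintegrable leb q ->
  cint leb (fun x => p x * FT s q x) = cint leb (fun x => q x * FT s p x).
Proof.
move=> Ip Iq; have := cint_swap_expi (measurable_phase s) Ip Iq; rewrite /phase/= => ->.
by apply: eq_cint => y; congr (_ * _); apply: eq_cint => x; rewrite dotpC.
Qed.

Lemma FTD s f g xi : cintegrable leb f -> cintegrable leb g ->
  FT s (fun x => f x + g x) xi = FT s f xi + FT s g xi.
Proof.
move=> If Ig; rewrite /FT -(cintD (cintegrable_FT s xi If) (cintegrable_FT s xi Ig)).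
by apply: eq_cint => x; rewrite mulrDl.
Qed.

Lemma FTZ s c f xi : cintegrable leb f -> FT s (fun x => c * f x) xi = c * FT s f xi.
Proof.
move=> If; rewrite /FT -(cintZ c (cintegrable_FT s xi If)).
by apply: eq_cint => x; rewrite mulrA.
Qed.

Lemma FTB s f g xi : cintegrable leb f -> cintegrable leb g ->
  FT s (fun x => f x - g x) xi = FT s f xi - FT s g xi.
Proof.
move=> If Ig; rewrite /FT -(cintB (cintegrable_FT s xi If) (cintegrable_FT s xi Ig)).
by apply: eq_cint => x; rewrite mulrBl.
Qed.

Lemma FT_conj s f xi : cintegrable leb f -> FT s (fun x => conjc (f x)) xi = conjc (FT (- s) f xi).
Proof.
move=> If; rewrite /FT -(cint_conj (cintegrable_FT (- s) xi If)).
by apply: eq_cint => x; rewrite conjM conj_expi mulNr opprK.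
Qed.

Definition gaussk t : R := Num.sqrt (pi / t) ^+ n.

Lemma gaussk_gt0 t : 0 < t -> 0 < gaussk t.
Proof. by move=> t0; rewrite exprn_gt0// sqrtr_gt0 divr_gt0// pi_gt0. Qed.

Lemma cint_gaussn_expi t xi : 0 < t ->
  cint leb (fun x => (gaussn t x)%:C * expi (dotp xi x)) = (gaussk t * gaussn ((4 * t)^-1) xi)%:C.
Proof.
move=> t0.
have mE th : measurable_fun setT (fun x : borelRn R n => (gaussncos t th xi x)%:E).
  by apply/measurable_EFinP; exact: borel_gaussncos.
apply: eq_ReIm => /=.
- transitivity (\int[leb]_x gaussncos t 0 xi x).
    by apply: eq_Rintegral => x _; rewrite mul0r subr0 /gaussncos addr0 dotpC.
  rewrite /Rintegral (integral_leb (mE 0)).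
  by have -> := integral_gaussncos 0 xi t0; rewrite /= cos0 mulr1.
- transitivity (\int[leb]_x gaussncos t (- (pi / 2)) xi x).
    by apply: eq_Rintegral => x _; rewrite mul0r addr0 /gaussncos dotpC cosBpihalf.
  rewrite /Rintegral (integral_leb (mE (- (pi / 2)))).
  by have -> := integral_gaussncos (- (pi / 2)) xi t0; rewrite /= cosN cos_pihalf mulr0.
Qed.

Lemma gaussk_fourier t : 0 < t -> gaussk t * gaussk ((4 * t)^-1) = (2 * pi) ^+ n.
Proof.
move=> t0; rewrite /gaussk -exprMn -sqrtrM; last by rewrite divr_ge0// ?pi_ge0// ltW.
have -> : pi / t * (pi / (4 * t)^-1) = (2 * pi) ^+ 2 by field; rewrite gt_eqF.
by rewrite sqrtr_sqr ger0_norm// mulr_ge0// pi_ge0.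
Qed.

(** This family is stable under [FT] up to constants, centre and frequency exchanging their roles
    ([FT_gmod]). *)
Definition gmod t (b c : V) x : R[i] := (gaussn t (x - b))%:C * expi (dotp c x).

Lemma measurable_subRn b : measurable_fun setT (fun x : borelRn R n => (x : 'rV[R]_n) - b : borelRn R n).
Proof.
have := measurable_funZD 1 (@measurable_id _ (borelRn R n) setT) (measurable_cst (- b : borelRn R n)).
by under eq_fun do rewrite scale1r.
Qed.

Lemma borel_gaussnB t b : measurable_fun setT (fun x : borelRn R n => gaussn t ((x : V) - b)).
Proof. exact: (measurableT_comp (borel_gaussn t) (measurable_subRn b)). Qed.

Lemma ge0_integral_shift (f : borelRn R n -> \bar R) b : measurable_fun setT f -> (forall x, 0 <= f x)%E ->
  (\int[leb]_x f ((x : V) - b)%R = \int[leb]_x f x)%E.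
Proof.
move=> mf f0; have := ge0_integral_affine (- b) (@ltr01 R) mf f0.
rewrite invr1 expr1n mul1e => <-; by apply: eq_integral => x _; rewrite scale1r.
Qed.

Lemma integrable_gaussnB t b : 0 < t -> leb.-integrable setT (EFin \o (fun x => gaussn t (x - b))).
Proof.
move=> t0; apply/(ge0_integrableP leb (borel_measurable_fun (borel_gaussnB t b))).
- by move=> x; exact: gaussn_ge0.
- rewrite (ge0_integral_shift (f := fun x => (gaussn t x)%:E)).
  + by rewrite ge0_integral_gaussn// ltry.
  + by apply/measurable_EFinP; exact: borel_gaussn.
  + by move=> x; rewrite lee_fin gaussn_ge0.
Qed.

Lemma cmeas_gmod t b c : cmeas (gmod t b c).
Proof.
apply: cmeasM; first exact: (cmeas_real (borel_measurable_fun (borel_gaussnB t b))).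
apply: cmeas_expi; exact: (measurableT_comp measurable_dotp2 (measurable_pair1 c)).
Qed.

Lemma normc_gmod t b c x : normc (gmod t b c x) = gaussn t (x - b).
Proof. by rewrite normcM normc_expi mulr1 normc_real ger0_norm ?gaussn_ge0. Qed.

Lemma cintegrable_gmod t b c : 0 < t -> cintegrable leb (gmod t b c).
Proof.
move=> t0; apply: (cintegrable_le (cmeas_gmod t b c) (integrable_gaussnB b t0)).
by move=> x; rewrite normc_gmod.
Qed.

Lemma E2_gmod t b c : 0 < t -> (E2 leb (gmod t b c) < +oo)%E.
Proof.
move=> t0; have t20 : 0 < t + t by rewrite addr_gt0.
have := integrable_lty measurableT (integrable_gaussnB b t20).
congr (_ < _)%E; apply: eq_integral => x _; congr (_%:E).
by rewrite normc_gmod expr2 gaussnM.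
Qed.

Lemma Rintegral_shift_cint (f : borelRn R n -> R[i]) b : cmeas f -> cintegrable leb (f : V -> R[i]) ->
  cint leb (fun x => f ((x : V) - b)) = cint leb (f : V -> R[i]).
Proof.
move=> [f1 f2] [I1 I2]; apply: eq_ReIm => /=.
- have := Rintegral_affine (- b) (@ltr01 R) f1 I1.
  rewrite invr1 expr1n mul1r => <-; by apply: eq_Rintegral => x _; rewrite scale1r.
- have := Rintegral_affine (- b) (@ltr01 R) f2 I2.
  rewrite invr1 expr1n mul1r => <-; by apply: eq_Rintegral => x _; rewrite scale1r.
Qed.

Lemma FT_gmod0 s t c xi : 0 < t ->
  FT s (gmod t 0 c) xi = (gaussk t * gaussn ((4 * t)^-1) (s *: xi + c))%:C.
Proof.
move=> t0; rewrite -cint_gaussn_expi//; apply: eq_cint => x.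
by rewrite /gmod subr0 -mulrA -expiD; congr (_ * expi _); rewrite !dotpE addrC.
Qed.

Lemma FT_gmod s t b c xi : 0 < t ->
  FT s (gmod t b c) xi = (gaussk t)%:C * expi (dotp c b) * (gaussn ((4 * t)^-1) (s *: xi + c))%:C * expi (s * dotp xi b).
Proof.
move=> t0.
pose F (y : borelRn R n) := gmod t 0 c y * expi (s * dotp xi (y : V)) * (expi (dotp c b) * expi (s * dotp xi b)).
have -> : FT s (gmod t b c) xi = cint leb (fun x : V => F (x - b)).
  apply: eq_cint => x; rewrite /F /gmod subr0.
  rewrite -!mulrA; congr (_ * _); rewrite -!expiD; congr expi; rewrite !dotpE; ring.
have I := cintegrable_FT s xi (cintegrable_gmod 0 c t0).
rewrite (Rintegral_shift_cint (f := F)); last 2 first.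
- apply: cmeasM; last exact: cmeas_cst.
  have md (e : V) : measurable_fun setT (fun y : borelRn R n => dotp e (y : V)).
    exact: (measurable_dotp (measurable_cst (e : borelRn R n)) (@measurable_id _ _ setT)).
  apply: cmeasM; last by apply: cmeas_expi; exact: (measurable_funMl s (md xi)).
  by apply: cmeasM; [exact: (cmeas_real (borel_gaussnB t 0))|exact: (cmeas_expi (md c))].
- have := cintegrableZ (expi (dotp c b) * expi (s * dotp xi b)) I.
  by congr cintegrable; apply/funext => x; rewrite mulrC.
rewrite (_ : cint _ _ = expi (dotp c b) * expi (s * dotp xi b) * FT s (gmod t 0 c) xi); last first.
  by rewrite /FT -(cintZ _ I); apply: eq_cint => x; rewrite mulrC.
by rewrite FT_gmod0// rmorphM; ring.
Qed.

End fourier_kernel.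

(** * The L^2 bound for the Fourier integral *)

Section fourier_bound.
Variables (R : realType) (n : nat).
Local Notation V := (Rn R n).
Local Notation leb := (@leb R n).
Implicit Types (f g h p q u : V -> R[i]) (x y xi : V) (s t : R).

Lemma measurable_subRn2 : measurable_fun setT (fun z : V * V => (z.1 : 'rV[R]_n) - z.2 : borelRn R n).
Proof.
have := measurable_funZD (-1) (measurableT_comp (@measurable_toB R n) (@measurable_snd _ _ V V))
  (measurableT_comp (@measurable_toB R n) (@measurable_fst _ _ V V)).
congr measurable_fun; apply/funext => z; by rewrite scaleN1r addrC.
Qed.

(** The two halves of Schur's test for an even convolution kernel: whichever variable is integrated
    out first contributes the total mass of [k]. *)
Lemma integral_kernel (u : V -> \bar R) (k : borelRn R n -> R) :
  measurable_fun setT u -> (forall x, 0 <= u x)%E -> measurable_fun setT k -> (forall x, 0 <= k x) ->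
  (forall x, k (- x) = k x) ->
  (\int[leb]_x \int[leb]_y (u x * (k ((x : V) - y)%R)%:E) = (\int[leb]_x (k x)%:E) * \int[leb]_x u x)%E /\
  (\int[leb]_x \int[leb]_y (u y * (k ((x : V) - y)%R)%:E) = (\int[leb]_x (k x)%:E) * \int[leb]_x u x)%E.
Proof.
move=> mu u0 mk k0 kN.
have mk2 : measurable_fun setT (fun z : V * V => (k ((z.1 : V) - z.2)%R)%:E).
  by apply/measurable_EFinP; exact: (measurableT_comp mk measurable_subRn2).
have G0 : (0 <= \int[leb]_x (k x)%:E)%E by apply: integral_ge0 => x _; rewrite lee_fin.
have shift b : (\int[leb]_y (k ((y : V) - b)%R)%:E = \int[leb]_x (k x)%:E)%E.
  apply: (ge0_integral_shift (f := fun x => (k x)%:E)); first exact/measurable_EFinP.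
  by move=> x; rewrite lee_fin.
have shift' b : (\int[leb]_y (k (b - (y : V))%R)%:E = \int[leb]_x (k x)%:E)%E.
  by rewrite -(shift b); apply: eq_integral => x _; rewrite -kN opprB.
have mks b : measurable_fun setT (fun y : V => (k (b - y)%R)%:E).
  exact: (measurableT_comp mk2 (measurable_pair1 b)).
have mks' b : measurable_fun setT (fun y : V => (k (y - b)%R)%:E).
  exact: (measurableT_comp mk2 (measurable_pair2 b)).
have E1 : (\int[leb]_x \int[leb]_y (u x * (k ((x : V) - y)%R)%:E) = (\int[leb]_x (k x)%:E) * \int[leb]_x u x)%E.
  transitivity (\int[leb]_x ((\int[leb]_x (k x)%:E) * u x))%E; last exact: ge0_integralZlT.
  apply: eq_integral => x _.
  have kx y : (0 <= (k (x - y)%R)%:E)%E by rewrite lee_fin.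
  by rewrite (ge0_integralZlT leb (mks x) kx (u0 x)) shift' muleC.
split; first exact: E1.
have mF : measurable_fun setT (fun z : V * V => (u z.2 * (k ((z.1 : V) - z.2)%R)%:E)%E).
  by apply: emeasurable_funM; [exact: (measurableT_comp mu measurable_snd)|exact: mk2].
have F0 (z : V * V) : (0 <= u z.2 * (k ((z.1 : V) - z.2)%R)%:E)%E by rewrite mule_ge0// lee_fin.
have /= -> := fubini_tonelli (m1 := leb) (m2 := leb) _ mF F0.
rewrite -[RHS]E1; apply: eq_integral => y _; apply: eq_integral => x _.
by rewrite -kN opprB.
Qed.

(* Damped by a Gaussian, the integral of [|FT s h|^2] is a double integral of
   [h x * conjc (h y)] against a Gaussian kernel of mass [(2 * pi) ^+ n]. *)
Lemma E2_FT_regularized s t h : s ^+ 2 = 1 -> 0 < t -> cintegrable leb h -> (E2 leb h < +oo)%E ->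
  (\int[leb]_x (normc (FT s h x) ^+ 2 * gaussn t x)%:E <= ((2 * pi) ^+ n)%:E * E2 leb h)%E.
Proof.
move=> s1 t0 Ih h2; set K := gaussk n t; set t' := (4 * t)^-1.
have t'0 : 0 < t' by rewrite invr_gt0 mulr_gt0.
have K0 : 0 < K by exact: gaussk_gt0.
have mh := cintegrable_meas Ih; have mH := cmeas_FT s Ih.
have mg := @measurable_gaussn R n t.
(* With this [q], the damped integral becomes that of [h x * FT s q x] by [FT_swap], and [FTq]
   writes [FT s q] as an integral against a Gaussian kernel. *)
pose q xi := conjc (FT s h xi) * (gaussn t xi)%:C.
have mq : cmeas q by exact: (cmeasM (cmeas_conj mH) (cmeas_real mg)).
have Iq : cintegrable leb q.
  apply: (cintegrable_le mq (integrableZl measurableT (N1 h) (integrable_gaussn n t0))) => x.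
  rewrite /q normcM normc_conj normc_real (ger0_norm (gaussn_ge0 _ _)).
  by rewrite ler_wpM2r ?gaussn_ge0// normc_FT.
have Ich := cintegrable_conj Ih.
have FTq x : FT s q x = cint leb (fun y => conjc (h y) * (K * gaussn t' (x - y))%:C).
  transitivity (cint leb (fun xi => gmod t 0 (s *: x) xi * FT (- s) (fun y => conjc (h y)) xi)).
    apply: eq_cint => xi; rewrite FT_conj// opprK /q /gmod subr0 dotpZl.
    by rewrite -mulrA mulrC.
  rewrite FT_swap//; last exact: cintegrable_gmod.
  apply: eq_cint => y; congr (_ * _); rewrite (FT_gmod0 _ _ _ t0); congr ((K * _)%:C).
  have -> : - s *: y + s *: x = s *: (x - y) by rewrite scaleNr addrC scalerBr.
  by rewrite /gaussn dotpZl dotpZr !mulrA -[- _ * s * s]mulrA -expr2 s1 mulr1.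
have L : ((\int[leb]_x (normc (FT s h x) ^+ 2 * gaussn t x))%:C = cint leb (fun x => h x * FT s q x)).
  rewrite (FT_swap s Ih Iq) -cint_real; apply: eq_cint => x.
  by rewrite realCM -mulc_conj /q; ring.
have bFq : forall x, normc (FT s q x) <= N1 q by move=> x; exact: normc_FT.
have IhF : cintegrable leb (fun x => h x * FT s q x).
  apply: (cintegrable_le (cmeasM mh (cmeas_FT s Iq)) (integrableZl measurableT (N1 q) (cintegrable_normc Ih))) => x.
  by rewrite normcM mulrC ler_wpM2r ?normc_ge0.
have I2 : leb.-integrable setT (EFin \o (fun x => normc (FT s h x) ^+ 2 * gaussn t x)).
  apply: (le_integrable measurableT _ _ (integrableZl measurableT (N1 h ^+ 2) (integrable_gaussn n t0))).
    apply/measurable_EFinP; apply: (measurable_funM _ mg); apply: measurable_funX.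
    exact: (measurable_normc mH).
  move=> x _; rewrite /= lee_fin [leLHS]normrM [leRHS]normrM ler_wpM2r ?normr_ge0// !ger0_norm ?sqr_ge0//.
  by rewrite ler_pXn2r// ?nnegrE ?normc_ge0 ?N1_ge0// normc_FT.
have -> : (\int[leb]_x (normc (FT s h x) ^+ 2 * gaussn t x)%:E =
    (normc (cint leb (fun x => h x * FT s q x)))%:E)%E.
  rewrite -L normc_real ger0_norm.
    by rewrite /Rintegral fineK//; exact: integrable_fin_num.
  by apply: Rintegral_ge0 => x _; rewrite mulr_ge0 ?sqr_ge0 ?gaussn_ge0.
apply: (le_trans (le_normc_cint IhF)).
(* Half of the kernel, because the product of the moduli at [x] and [y] is bounded by half of the
   sum of their squares, and [integral_kernel] treats the two squares separately. *)
pose k (z : borelRn R n) := K / 2 * gaussn t' z.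
have mk : measurable_fun setT k by exact: (measurable_funMl (K / 2) (@borel_gaussn R n t')).
have k0 z : 0 <= k z by rewrite mulr_ge0 ?gaussn_ge0// divr_ge0// ltW.
have kN z : k (- z) = k z by rewrite /k gaussnN.
pose u x := (normc (h x) ^+ 2)%:E.
have mu : measurable_fun setT u by exact: (measurable_normc2 mh).
have u0 x : (0 <= u x)%E by rewrite lee_fin sqr_ge0.
pose A x := (\int[leb]_y (u x * (k ((x : V) - y)%R)%:E))%E.
pose B x := (\int[leb]_y (u y * (k ((x : V) - y)%R)%:E))%E.
have uk0 x y z : (0 <= u x * (k (y - z)%R)%:E)%E by rewrite mule_ge0// lee_fin.
have A0 x : (0 <= A x)%E by exact: integral_ge0.
have B0 x : (0 <= B x)%E by exact: integral_ge0.
have mk2 : measurable_fun setT (fun z : V * V => (k ((z.1 : V) - z.2)%R)%:E).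
  by apply/measurable_EFinP; exact: (measurableT_comp mk measurable_subRn2).
have mF1 : measurable_fun setT (fun z : V * V => (u z.1 * (k ((z.1 : V) - z.2)%R)%:E)%E).
  by apply: emeasurable_funM; [exact: (measurableT_comp mu measurable_fst)|exact: mk2].
have mF2 : measurable_fun setT (fun z : V * V => (u z.2 * (k ((z.1 : V) - z.2)%R)%:E)%E).
  by apply: emeasurable_funM; [exact: (measurableT_comp mu measurable_snd)|exact: mk2].
have mA : measurable_fun setT A by exact: (measurable_fun_fubini_tonelli_F _ mF1 (fun z => uk0 _ _ _)).
have mB : measurable_fun setT B by exact: (measurable_fun_fubini_tonelli_F _ mF2 (fun z => uk0 _ _ _)).
have [EA EB] := integral_kernel mu u0 mk k0 kN.
have Gk : (\int[leb]_x (k x)%:E = ((2 * pi) ^+ n / 2)%:E)%E.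
  transitivity (\int[leb]_x ((K / 2)%:E * (gaussn t' x)%:E))%E; first by apply: eq_integral => x _; rewrite -EFinM.
  rewrite ge0_integralZlT.
  - rewrite ge0_integral_gaussn// -EFinM -(gaussk_fourier n t0) -/K -/t'.
    by rewrite mulrAC.
  - by apply/measurable_EFinP; exact: measurable_gaussn.
  - by move=> x; rewrite lee_fin gaussn_ge0.
  - by rewrite lee_fin divr_ge0// ltW.
apply: (@le_trans _ _ (\int[leb]_x (A x + B x))%E); last first.
  have p0 : 0 <= (2 * pi) ^+ n / 2 :> R by rewrite divr_ge0// exprn_ge0// mulr_ge0// pi_ge0.
  rewrite ge0_integralDT// EA EB Gk [in leRHS](splitr ((2 * pi) ^+ n)) EFinD.
  by rewrite ge0_muleDl// lee_fin.
apply: ge0_le_integralT.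
- by apply/measurable_EFinP; exact: (measurable_normc (cintegrable_meas IhF)).
- by move=> x; rewrite lee_fin normc_ge0.
- exact: emeasurable_funD.
move=> x.
have mAx : measurable_fun setT (fun y : V => u x * (k ((x : V) - y)%R)%:E)%E.
  exact: (measurableT_comp mF1 (measurable_pair1 x)).
have mBx : measurable_fun setT (fun y : V => u y * (k ((x : V) - y)%R)%:E)%E.
  exact: (measurableT_comp mF2 (measurable_pair1 x)).
rewrite /A /B -(ge0_integralDT leb mAx (uk0 x x) mBx (fun y => uk0 y x y)).
have mgx : measurable_fun setT (fun y : V => gaussn t' (x - y)).
  exact: (measurableT_comp (measurableT_comp (@borel_gaussn R n t') measurable_subRn2) (measurable_pair1 x)).
have mE : cmeas (fun y => conjc (h y) * (K * gaussn t' (x - y))%:C).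
  by apply: (cmeasM (cmeas_conj mh)); apply: cmeas_real; exact: measurable_funMl.
have IE : cintegrable leb (fun y => conjc (h y) * (K * gaussn t' (x - y))%:C).
  apply: (cintegrable_le mE (integrableZl measurableT K (cintegrable_normc Ih))) => y.
  rewrite normcM normc_conj normc_real mulrC ler_wpM2r ?normc_ge0//.
  rewrite ger0_norm; last by rewrite mulr_ge0 ?gaussn_ge0// ltW.
  by rewrite ler_piMr ?gaussn_le1// ltW.
rewrite FTq -(cintZ (h x) IE); apply: (le_trans (le_normc_cint (cintegrableZ (h x) IE))).
apply: ge0_le_integralT.
- by apply/measurable_EFinP; exact: (measurable_normc (cintegrable_meas (cintegrableZ (h x) IE))).
- by move=> y; rewrite lee_fin normc_ge0.
- exact: (emeasurable_funD mAx mBx).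
move=> y; rewrite -!EFinM -EFinD lee_fin !normcM normc_conj normc_real.
rewrite ger0_norm; last by rewrite mulr_ge0 ?gaussn_ge0// ltW.
rewrite -mulrDl /k !mulrA ler_wpM2r ?gaussn_ge0//.
have hh : normc (h x) * normc (h y) <= (normc (h x) ^+ 2 + normc (h y) ^+ 2) / 2.
  by rewrite ler_pdivlMr//; have := sqr_ge0 (normc (h x) - normc (h y)); nra.
have := ler_wpM2r (ltW K0) hh.
by set a := normc (h x); set b := normc (h y); lra.
Qed.

(** Monotone convergence: the damping factor [gaussn (k.+1%:R^-1)] increases to 1, and the
    regularized bound does not depend on it. *)
Lemma E2_FT_le s h : s ^+ 2 = 1 -> cintegrable leb h -> (E2 leb h < +oo)%E ->
  (E2 leb (FT s h) <= ((2 * pi) ^+ n)%:E * E2 leb h)%E.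
Proof.
move=> s1 Ih h2; have mH := cmeas_FT s Ih.
pose F (k : nat) x := (normc (FT s h x) ^+ 2 * gaussn (k.+1%:R^-1) x)%:E.
have cF x : F k x @[k --> \oo] --> (normc (FT s h x) ^+ 2)%:E.
  apply: cvg_EFin; first exact: nearW.
  have c1 : gaussn (k.+1%:R^-1) x @[k --> \oo] --> expR (- 0 * dotp x x).
    apply: continuous_cvg; first exact: continuous_expR.
    by apply: cvgM; [apply: cvgN; exact: cvg_harmonic|exact: cvg_cst].
  rewrite oppr0 mul0r expR0 in c1.
  by rewrite -[X in _ --> X]mulr1; apply: cvgM => //; exact: cvg_cst.
have mF k : measurable_fun setT (F k).
  apply/measurable_EFinP; apply: (measurable_funM _ (@measurable_gaussn R n _)); apply: measurable_funX.
  exact: (measurable_normc mH).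
have F0 k x : setT x -> (0 <= F k x)%E by move=> _; rewrite lee_fin mulr_ge0 ?sqr_ge0 ?gaussn_ge0.
have ndF x : setT x -> {homo F ^~ x : k l / (k <= l)%N >-> (k <= l)%E}.
  move=> _ k l kl; rewrite lee_fin ler_wpM2l ?sqr_ge0// ler_expR ler_wpM2r ?dotp_ge0//.
  by rewrite lerN2 lef_pV2 ?posrE// ler_nat ltnS.
have cI := cvg_monotone_convergence measurableT mF F0 ndF.
rewrite (_ : E2 leb (FT s h) = \int[leb]_x limn (F^~ x))%E; last first.
  by apply: eq_integral => x _; apply/esym/cvg_lim => //; exact: cF.
apply: (cvge_to_le (cI leb)).
by apply: nearW => k; apply: E2_FT_regularized => //; rewrite invr_gt0.
Qed.

End fourier_bound.

(** * Schwartz functions *)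

Section directional.
Variables (R : realType) (n : nat).
Local Notation V := (Rn R n).
Implicit Types (f g : V -> R) (df dg : V -> V -> R).

(** Differentiability and directional derivatives are carried together because [schwartz_real]
    requires the former for iterates of the latter. *)
Definition has_diff f df := forall x : V, differentiable f x /\ forall v : V, 'D_v f x = df x v.

Lemma has_diff_ext f g df dg : f =1 g -> (forall x v, df x v = dg x v) -> has_diff f df -> has_diff g dg.
Proof. by move=> /funext <- E H x; have [d1 d2] := H x; split => // v; rewrite d2 E. Qed.

Lemma has_diff_cst (c : R) : has_diff (fun=> c) (fun _ _ => 0).
Proof. by move=> x; split; [exact: differentiable_cst|move=> v; exact: derive_cst]. Qed.

Lemma has_diffD f g df dg : has_diff f df -> has_diff g dg ->
  has_diff (fun x => f x + g x) (fun x v => df x v + dg x v).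
Proof.
move=> Hf Hg x; have [f1 f2] := Hf x; have [g1 g2] := Hg x; split.
  exact: differentiableD.
by move=> v; rewrite -f2 -g2 -deriveD//; exact: diff_derivable.
Qed.

Lemma has_diffM f g df dg : has_diff f df -> has_diff g dg ->
  has_diff (fun x => f x * g x) (fun x v => f x * dg x v + g x * df x v).
Proof.
move=> Hf Hg x; have [f1 f2] := Hf x; have [g1 g2] := Hg x; split.
  exact: differentiableM.
move=> v; rewrite -f2 -g2; apply: (@deriveM _ _ f g x v); exact: diff_derivable.
Qed.

Lemma has_diffZ (c : R) f df : has_diff f df -> has_diff (fun x => c * f x) (fun x v => c * df x v).
Proof.
move=> Hf; apply: has_diff_ext (has_diffM (has_diff_cst c) Hf) => // x v.
by rewrite mulr0 addr0.
Qed.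

Lemma has_diff_sum (I : Type) (s : seq I) (F : I -> V -> R) (dF : I -> V -> V -> R) :
  (forall i, has_diff (F i) (dF i)) ->
  has_diff (fun x => \sum_(i <- s) F i x) (fun x v => \sum_(i <- s) dF i x v).
Proof.
move=> H; elim: s => [|i s IH].
  by apply: has_diff_ext (has_diff_cst 0) => [x|x v]; rewrite big_nil.
by apply: has_diff_ext (has_diffD (H i) IH) => [x|x v]; rewrite big_cons.
Qed.

Lemma has_diff_comp f df (phi dphi : R -> R) : has_diff f df ->
  (forall y : R, is_derive y 1 phi (dphi y)) ->
  has_diff (fun x => phi (f x)) (fun x v => dphi (f x) * df x v).
Proof.
move=> Hf Hphi x; have [f1 f2] := Hf x; have [p1 p2] := Hphi (f x).
have dp : differentiable phi (f x) by exact/derivable1_diffP.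
split; first exact: differentiable_comp.
move=> v; rewrite deriveE; last exact: differentiable_comp.
rewrite (_ : (fun x => phi (f x)) = phi \o f)// diff_comp//= diff1E// derive1E p2.
by rewrite -f2 deriveE// /GRing.scale/= mulrC.
Qed.

Lemma has_diff_coord (i : 'I_n) : has_diff (fun x => x ord0 i) (fun _ v => v ord0 i).
Proof.
move=> x.
pose f : V -> R := fun N => N ord0 i.
have lf : linear f by move=> a y z; rewrite /f !mxE.
pose F : {linear V -> R} := HB.pack f (GRing.isLinear.Build _ _ _ _ f lf).
have cF : continuous F by exact: coord_continuous.
split; first exact: (@linear_differentiable _ V R F x cF).
move=> v; rewrite deriveE; last exact: (@linear_differentiable _ V R F x cF).
by rewrite (_ : (fun x : V => x ord0 i) = F)// diff_lin.
Qed.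

Lemma has_diff_dotp (c : V) : has_diff (fun x => dotp c x) (fun _ v => dotp c v).
Proof. by apply: has_diff_sum => i; apply: has_diffZ; exact: has_diff_coord. Qed.

Lemma has_diff_dist2 (b : V) : has_diff (fun x => dotp (x - b) (x - b)) (fun x v => 2 * dotp v (x - b)).
Proof.
have H i : has_diff (fun x => (x - b) ord0 i) (fun _ v => v ord0 i).
  apply: has_diff_ext (has_diffD (has_diff_coord i) (has_diff_cst (- b ord0 i))) => [x|x v].
    by rewrite !mxE.
  by rewrite addr0.
apply: has_diff_ext (has_diff_sum (index_enum 'I_n) (fun i => has_diffM (H i) (H i))) => // x v.
by rewrite /dotp mulr_sumr; apply: eq_bigr => i _; ring.
Qed.

Definition gcos (t d : R) (b c x : V) := gaussn t (x - b) * cos (dotp c x + d).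

Lemma has_diff_gcos t d b c : has_diff (gcos t d b c)
  (fun x v => - (2 * t) * dotp v (x - b) * gcos t d b c x + dotp c v * gcos t (d + pi / 2) b c x).
Proof.
have H1 := has_diff_comp (has_diffZ (- t) (has_diff_dist2 b)) (fun y => is_derive_expR y).
have H2 := has_diff_comp (has_diffD (has_diff_dotp c) (has_diff_cst d)) (fun y => is_derive_cos y).
apply: has_diff_ext (has_diffM H1 H2) => // x v.
by rewrite /gcos addrA cosDpihalf /gaussn addr0; ring.
Qed.

(** Trigonometric Gaussians with polynomial coefficients. The class is closed under partial
    derivatives, so that the decay of its members already makes them Schwartz functions. *)
Inductive gauss_class : (V -> R) -> Prop :=
| gauss_class_base t d b c : 0 < t -> gauss_class (gcos t d b c)
| gauss_class_coord i f : gauss_class f -> gauss_class (fun x => x ord0 i * f x)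
| gauss_classD f g : gauss_class f -> gauss_class g -> gauss_class (fun x => f x + g x)
| gauss_classZ k f : gauss_class f -> gauss_class (fun x => k * f x).

Lemma gauss_class_derive f : gauss_class f ->
  exists2 df, has_diff f df & forall i, gauss_class (fun x => df x (delta_mx ord0 i)).
Proof.
elim=> {f}.
- move=> t d b c t0; exists (fun x v => - (2 * t) * dotp v (x - b) * gcos t d b c x + dotp c v * gcos t (d + pi / 2) b c x).
    exact: has_diff_gcos.
  move=> i.
  have dl (z : V) : dotp (delta_mx ord0 i) z = z ord0 i.
    rewrite /dotp (bigD1 i)//= mxE !eqxx mul1r big1 ?addr0// => j ji.
    by rewrite mxE eqxx (negbTE ji) mul0r.
  pose F (x : V) := (- (2 * t) * (x ord0 i * gcos t d b c x) + (2 * t * b ord0 i) * gcos t d b c x)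
    + c ord0 i * gcos t (d + pi / 2) b c x.
  rewrite (_ : (fun x => _) = F); last first.
    by apply/funext => x; rewrite /F (dotpC c) !dl !mxE; ring.
  apply: gauss_classD; [apply: gauss_classD|]; apply: gauss_classZ; do ?apply: gauss_class_coord; exact: gauss_class_base.
- move=> i f gf [df Hf Hg]; exists (fun x v : V => x ord0 i * df x v + f x * v ord0 i).
    exact: has_diffM (has_diff_coord i) Hf.
  move=> j; apply: gauss_classD; first exact: gauss_class_coord.
  have -> : (fun x => f x * (delta_mx ord0 j : V) ord0 i) = (fun x => (delta_mx ord0 j : V) ord0 i * f x).
    by apply/funext => x; rewrite mulrC.
  exact: gauss_classZ.
- move=> f g _ [df Hf Cf] _ [dg Hg Cg]; exists (fun x v => df x v + dg x v); first exact: has_diffD.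
  by move=> i; exact: gauss_classD.
- move=> k f _ [df Hf Cf]; exists (fun x v => k * df x v); first exact: has_diffZ.
  by move=> i; exact: gauss_classZ.
Qed.

Lemma normr_coord_le (x : V) i : `|x ord0 i| <= enorm x.
Proof.
rewrite -sqrtr_sqr ler_sqrt ?dotp_ge0// /dotp (bigD1 i)//= -expr2 lerDl.
by apply: sumr_ge0 => j _; rewrite -expr2 sqr_ge0.
Qed.

Lemma enorm_ge0 (x : V) : 0 <= enorm x. Proof. exact: sqrtr_ge0. Qed.

Lemma enorm_sqr (x : V) : enorm x ^+ 2 = dotp x x.
Proof. by rewrite sqr_sqrtr// dotp_ge0. Qed.

Lemma gauss_class_decay f : gauss_class f ->
  forall k, exists C : R, forall x, (1 + enorm x) ^+ k * `|f x| <= C.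
Proof.
elim=> {f}.
- move=> t d b c t0 k.
  (* Constants for the chain [(1 + enorm x) ^+ 2 <= A + 4 * r <= B * (1 + t * r / k.+1%:R)], where
     the power [k.+1] of the last factor is at most [expR (t * r)]. *)
  pose A := 2 + 4 * dotp b b; pose B := A + 4 * k.+1%:R / t.
  have B0 : 0 <= B.
    have := dotp_ge0 b; rewrite /B /A => b0; rewrite addr_ge0//; first by rewrite addr_ge0// mulr_ge0.
    by rewrite divr_ge0// ltW.
  exists (B ^+ k.+1) => x; set r := dotp (x - b) (x - b).
  have r0 : 0 <= r by exact: dotp_ge0.
  have h1 : (1 + enorm x) ^+ 2 <= A + 4 * r.
    have -> : A + 4 * r = 2 + 2 * dotp x x + 2 * dotp (x - 2 *: b) (x - 2 *: b).
      by rewrite /A /r !dotpE (dotpC b x); ring.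
    have := dotp_ge0 (x - 2 *: b); rewrite -(enorm_sqr x) => h.
    by have := sqr_ge0 (1 - enorm x); nra.
  have h2 : A + 4 * r <= B * (1 + t * r / k.+1%:R).
    have k0 : 0 < k.+1%:R :> R by [].
    have A0 : 0 <= A by rewrite addr_ge0// mulr_ge0// dotp_ge0.
    have -> : B * (1 + t * r / k.+1%:R) = A + 4 * r + (4 * k.+1%:R / t + A * (t * r / k.+1%:R)).
      by rewrite /B; field; rewrite !gt_eqF.
    rewrite lerDl addr_ge0//; first by rewrite divr_ge0// ltW.
    by rewrite mulr_ge0// divr_ge0// mulr_ge0// ltW.
  have h3 : (1 + enorm x) ^+ k <= (A + 4 * r) ^+ k.+1.
    have e1 : 1 <= 1 + enorm x by rewrite lerDl enorm_ge0.
    apply: (@le_trans _ _ (((1 + enorm x) ^+ 2) ^+ k.+1)).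
      by rewrite -exprM; apply: ler_weXn2l => //; exact: leq_trans (leqnSn k) (leq_pmull _ _).
    by rewrite ler_pXn2r// nnegrE ?sqr_ge0// (le_trans _ h1)// sqr_ge0.
  have h4 : (1 + t * r / k.+1%:R) ^+ k.+1 <= expR (t * r).
    have -> : expR (t * r) = expR (t * r / k.+1%:R) ^+ k.+1.
      by rewrite -expRM_natl; congr expR; rewrite mulrCA divff ?mulr1// pnatr_eq0.
    have p0 : 0 <= 1 + t * r / k.+1%:R.
      by rewrite addr_ge0// divr_ge0// mulr_ge0// ltW.
    by rewrite ler_pXn2r ?nnegrE ?expR_ge0// expR_ge1Dx.
  rewrite /gcos normrM (ger0_norm (gaussn_ge0 _ _)) mulrA.
  apply: (@le_trans _ _ ((1 + enorm x) ^+ k * gaussn t (x - b))).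
    by rewrite ler_piMr ?cos_max// mulr_ge0 ?gaussn_ge0// exprn_ge0// addr_ge0// enorm_ge0.
  rewrite /gaussn -/r mulNr expRN ler_pdivrMr ?expR_gt0//.
  apply: (le_trans h3); apply: (@le_trans _ _ ((B * (1 + t * r / k.+1%:R)) ^+ k.+1)).
    rewrite ler_pXn2r// nnegrE; last by rewrite mulr_ge0// addr_ge0// divr_ge0// mulr_ge0// ltW.
    by rewrite (le_trans _ h1)// sqr_ge0.
  by rewrite exprMn ler_wpM2l// exprn_ge0.
- move=> i f _ IH k; have [C HC] := IH k.+1; exists C => x.
  apply: le_trans (HC x); rewrite normrM exprSr -!mulrA ler_wpM2l//.
    by rewrite exprn_ge0// addr_ge0// enorm_ge0.
  by rewrite ler_wpM2r// (le_trans (normr_coord_le x i))// lerDr.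
- move=> f g _ IHf _ IHg k; have [C HC] := IHf k; have [D HD] := IHg k; exists (C + D) => x.
  rewrite (le_trans _ (lerD (HC x) (HD x)))// -mulrDr ler_wpM2l ?ler_normD//.
  by rewrite exprn_ge0// addr_ge0// enorm_ge0.
- move=> k f _ IH m; have [C HC] := IH m; exists (`|k| * C) => x.
  by rewrite normrM mulrCA ler_wpM2l.
Qed.

Lemma gauss_class_schwartz f : gauss_class f -> schwartz_real f.
Proof.
move=> gf.
have P s : gauss_class (partials s f).
  elim: s => [//|i s IH] /=.
  have [df Hd Hg] := gauss_class_derive IH.
  rewrite (_ : (fun x => _) = (fun x => df x (delta_mx ord0 i))); first exact: Hg.
  by apply/funext => x; have [_] := Hd x; apply.
split => s; last exact: gauss_class_decay.
by move=> x; have [df Hd _] := gauss_class_derive (P s); have [] := Hd x.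
Qed.

End directional.

Section schwartz.
Variables (R : realType) (n : nat).
Local Notation V := (Rn R n).
Local Notation leb := (@leb R n).

Lemma ge0_integral_oneDsqrV : (\int[@lebesgue_measure R]_x ((oneDsqr x)^-1)%:E = pi%:E)%E.
Proof.
rewrite ge0_symfun_integralT.
- rewrite (_ : [set x | _] = `[0, +oo[%classic); last first.
    by apply/seteqP; split => x/=; rewrite in_itv/= andbT.
  by rewrite integral0y_oneDsqr -EFinM; congr (_%:E); field.
- by move=> x; rewrite invr_ge0 (le_trans ler01)// oneDsqr_ge1.
- exact: continuous_oneDsqrV.
- by move=> x /=; rewrite /oneDsqr sqrrN.
Qed.

(** Integrable because it is a product over the coordinates, and bounded below by a power of
    [1 + enorm x] ([weight_enorm]), so that its multiples dominate all Schwartz functions. *)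
Definition weight (x : V) : R := \prod_(i < n) (oneDsqr (x ord0 i))^-1.

Lemma weight_ge0 x : 0 <= weight x.
Proof. by apply: prodr_ge0 => i _; rewrite invr_ge0 (le_trans ler01)// oneDsqr_ge1. Qed.

Lemma weight_le1 x : weight x <= 1.
Proof.
apply: prodr_ile1 => i _; rewrite invr_ge0 (le_trans ler01) ?oneDsqr_ge1//=.
by rewrite invf_le1 ?oneDsqr_ge1// (lt_le_trans ltr01)// oneDsqr_ge1.
Qed.

Lemma measurable_weight : measurable_fun setT (weight : borelRn R n -> R).
Proof.
apply: measurable_prod => i _.
apply: (measurableT_comp (continuous_measurable_fun (@continuous_oneDsqrV R))).
exact: (measurable_coordRn i (@measurable_id _ _ setT)).
Qed.

Lemma integrable_weight : leb.-integrable setT (EFin \o weight).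
Proof.
apply/(ge0_integrableP leb (borel_measurable_fun measurable_weight)); first exact: weight_ge0.
rewrite (ge0_integral_leb (f := fun x => (weight x)%:E)).
- have mo := continuous_measurable_fun (@continuous_oneDsqrV R).
  have o0 (x : R) : 0 <= (oneDsqr x)^-1 by rewrite invr_ge0 (le_trans ler01)// oneDsqr_ge1.
  by rewrite (integral_prod_consRn n mo o0 ge0_integral_oneDsqrV) ltry.
- by apply/measurable_EFinP; exact: measurable_weight.
- by move=> x; rewrite lee_fin weight_ge0.
Qed.

Lemma weight_enorm x : ((1 + enorm x) ^+ (2 * n))^-1 <= weight x.
Proof.
have e0 := enorm_ge0 x.
rewrite /weight prodfV lef_pV2 ?posrE.
- rewrite exprM -[X in _ ^+ X](card_ord n) -prodr_const; apply: ler_prod => i _.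
  rewrite (le_trans ler01 (oneDsqr_ge1 _))//= /oneDsqr.
  have : x ord0 i ^+ 2 <= enorm x ^+ 2.
    by rewrite -(real_normK (num_real (x ord0 i))) ler_pXn2r ?nnegrE// normr_coord_le.
  by nra.
- by rewrite exprn_gt0// ltr_pwDl.
- by apply: prodr_gt0 => i _; rewrite (lt_le_trans ltr01)// oneDsqr_ge1.
Qed.

Lemma schwartz_real_weight (g : V -> R) : schwartz_real g ->
  exists2 C : R, 0 <= C & forall x, `|g x| <= C * weight x.
Proof.
move=> [_ /(_ [::] (2 * n)%N)[C HC]]; exists C.
  by apply: le_trans (HC 0); rewrite mulr_ge0// exprn_ge0// addr_ge0// enorm_ge0.
move=> x; have p0 : 0 < (1 + enorm x) ^+ (2 * n) by rewrite exprn_gt0// ltr_pwDl// enorm_ge0.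
have C0 : 0 <= C by apply: le_trans (HC 0); rewrite mulr_ge0// exprn_ge0// addr_ge0// enorm_ge0.
apply: (@le_trans _ _ (C * ((1 + enorm x) ^+ (2 * n))^-1)).
  by rewrite ler_pdivlMr// mulrC; exact: HC.
by rewrite ler_wpM2l// weight_enorm.
Qed.

Lemma schwartz_real_borel (g : V -> R) : schwartz_real g -> measurable_fun setT (g : borelRn R n -> R).
Proof.
move=> [/(_ [::])/= dg _]; apply: borel_continuous => x.
exact: differentiable_continuous.
Qed.

Lemma schwartz_cmeas f : schwartz f -> cmeas (f : V -> R[i]).
Proof.
by move=> [f1 f2]; split; apply: borel_measurable_fun; exact: schwartz_real_borel.
Qed.

Lemma schwartz_integrable f : schwartz f -> cintegrable leb f /\ (E2 leb f < +oo)%E.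
Proof.
move=> sf; have mf := schwartz_cmeas sf; have [f1 f2] := sf.
have [C C0 HC] := schwartz_real_weight f1; have [D D0 HD] := schwartz_real_weight f2.
have CD0 : 0 <= C + D by rewrite addr_ge0.
have H x : normc (f x) <= (C + D) * weight x.
  by rewrite (le_trans (normc_le_ReIm _))// mulrDl lerD.
split; first exact: (cintegrable_le mf (integrableZl measurableT (C + D) integrable_weight) H).
have I := integrable_lty measurableT (integrableZl measurableT ((C + D) ^+ 2) integrable_weight).
apply: le_lt_trans I; apply: ge0_le_integralT.
- exact: measurable_normc2.
- by move=> x; rewrite lee_fin sqr_ge0.
- by apply/measurable_EFinP; apply: measurable_funMl; exact: (borel_measurable_fun measurable_weight).
- move=> x; rewrite -EFinM lee_fin (@le_trans _ _ (((C + D) * weight x) ^+ 2))//.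
    by rewrite ler_pXn2r// nnegrE ?normc_ge0// mulr_ge0// weight_ge0.
  rewrite exprMn ler_wpM2l ?sqr_ge0// expr2 ler_piMr ?weight_ge0//; exact: weight_le1.
Qed.

Lemma schwartz_real_class (f : V -> R[i]) : gauss_class (fun x => complex.Re (f x)) ->
  gauss_class (fun x => complex.Im (f x)) -> schwartz f.
Proof. by move=> f1 f2; split; exact: gauss_class_schwartz. Qed.

End schwartz.

(** * Density of Gaussians in L^1 and L^2 *)

Section threshold.
Variable R : realType.
Implicit Types (y z : R) (k m : nat).

Lemma bernoulli_sub z m : 0 <= z <= 1 -> 1 - m%:R * z <= (1 - z) ^+ m.
Proof.
move=> /andP[z0 z1]; elim: m => [|m IH]; first by rewrite mul0r subr0 expr0.
have q0 : 0 <= 1 - z by rewrite subr_ge0.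
rewrite exprS -natr1; apply: (@le_trans _ _ ((1 - z) * (1 - m%:R * z))); last by rewrite ler_wpM2l.
have : 0 <= m%:R * z ^+ 2 :> R by rewrite mulr_ge0// sqr_ge0.
by nra.
Qed.

Lemma bernoulli_add z m : 0 <= z -> 1 + m%:R * z <= (1 + z) ^+ m.
Proof.
move=> z0; elim: m => [|m IH]; first by rewrite mul0r addr0 expr0.
have q0 : 0 <= 1 + z by rewrite addr_ge0.
rewrite exprS -natr1; apply: (@le_trans _ _ ((1 + z) * (1 + m%:R * z))); last by rewrite ler_wpM2l.
have : 0 <= m%:R * z ^+ 2 :> R by rewrite mulr_ge0// sqr_ge0.
by nra.
Qed.

(* These polynomials without constant term converge on [0, 1] to the indicator
   of [1/2, 1]; the factor [k.+1] in the exponent takes care of the point 1/2. *)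
Definition threshold k y := 1 - (1 - y ^+ k.+1) ^+ (k.+1 * 2 ^ k.+1).

Lemma threshold_itv k y : 0 <= y <= 1 -> 0 <= threshold k y <= 1.
Proof.
move=> /andP[y0 y1]; have yk0 : 0 <= y ^+ k.+1 by rewrite exprn_ge0.
have yk1 : y ^+ k.+1 <= 1 by rewrite exprn_ile1.
rewrite /threshold subr_ge0 lerBlDr lerDl exprn_ge0 ?subr_ge0// andbT.
by rewrite exprn_ile1// ?subr_ge0// lerBlDr lerDl.
Qed.

Lemma threshold_le_pow k y : 0 <= y <= 1 -> threshold k y <= k.+1%:R * (2 * y) ^+ k.+1.
Proof.
move=> /andP[y0 y1]; rewrite /threshold lerBlDl -lerBlDr.
have yk : 0 <= y ^+ k.+1 <= 1 by rewrite exprn_ge0//= exprn_ile1.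
apply: le_trans (bernoulli_sub _ yk).
by rewrite natrM natrX exprMn !mulrA.
Qed.

(** The majorant does not depend on [k]: when [y] is the value of a Gaussian, it is the integrable
    function that dominates the approximations in [gauss_indic]. *)
Lemma threshold_le k y : 0 <= y <= 1 -> threshold k y <= 8 * y.
Proof.
move=> y01; have /andP[y0 y1] := y01.
have [y8|y8] := leP (8^-1) y.
  have /andP[_ t1] := threshold_itv k y01; rewrite (le_trans t1)//.
  by rewrite mulrC -ler_pdivrMr// mul1r.
apply: (le_trans (threshold_le_pow k y01)).
rewrite exprS mulrCA; apply: (@le_trans _ _ (2 * y * 1)); last by lra.
rewrite ler_wpM2l ?mulr_ge0//.
apply: (@le_trans _ _ (4 ^+ k * (4^-1) ^+ k)); last by rewrite -exprMn mulfV ?expr1n// pnatr_eq0.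
apply: ler_pM => //; first by rewrite exprn_ge0// mulr_ge0.
  by rewrite -natrX ler_nat ltn_expl.
by rewrite lerXn2r ?nnegrE ?mulr_ge0//; lra.
Qed.

Lemma threshold_cvg1 y : 2^-1 <= y <= 1 -> threshold k y @[k --> \oo] --> (1 : R).
Proof.
move=> /andP[y2 y1]; have y0 : 0 <= y by rewrite (le_trans _ y2).
apply: (@squeeze_cvgr _ _ _ _ (fun k => 1 - harmonic k) (cst 1)); last exact: cvg_cst.
- apply: nearW => k /=; have /andP[_ ->] := threshold_itv k (introT andP (conj y0 y1)); rewrite andbT.
  rewrite /threshold lerD2l lerN2 /harmonic.
  have yk0 : 0 <= y ^+ k.+1 by rewrite exprn_ge0.
  apply: (@le_trans _ _ (expR (- y ^+ k.+1) ^+ (k.+1 * 2 ^ k.+1))).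
    by rewrite lerXn2r ?nnegrE ?expR_ge0 ?expR_ge1Dx// subr_ge0 exprn_ile1.
  rewrite -expRM_natl mulrN expRN lef_pV2 ?posrE ?expR_gt0//.
  apply: (le_trans _ (expR_ge1Dx _)).
  rewrite natrM natrX -mulrA -exprMn -[leLHS]add0r lerD// ler_peMr//.
  by rewrite exprn_ege1// mulrC -ler_pdivrMr// mul1r.
- by rewrite -[X in _ --> X](subr0 1); apply: cvgB; [exact: cvg_cst|exact: cvg_harmonic].
Qed.

Lemma threshold_cvg0 y : 0 < y < 2^-1 -> threshold k y @[k --> \oo] --> (0 : R).
Proof.
move=> /andP[y0 y2]; have y01 : 0 <= y <= 1 by rewrite ltW//= (le_trans (ltW y2))// invf_le1// ler1n.
pose r := 2 * y; have r0 : 0 < r by rewrite mulr_gt0.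
have r1 : r < 1 by rewrite /r mulrC -ltr_pdivlMr// mul1r.
(* With [r^-1 = (1 + s) ^+ 2], Bernoulli's inequality bounds [r ^+ k.+1] by the inverse of a
   quadratic term in [k.+1], which beats the factor [k.+1] of [threshold_le_pow]. *)
pose s := Num.sqrt r^-1 - 1.
have s1 : 1 < Num.sqrt r^-1 by rewrite -[X in X < _]sqrtr1 ltr_sqrt ?invr_gt0// invf_gt1.
have s0 : 0 < s by rewrite subr_gt0.
have rE : r^-1 = (1 + s) ^+ 2 by rewrite /s addrC subrK sqr_sqrtr// invr_ge0 ltW.
apply: (@squeeze_cvgr _ _ _ _ (cst 0) (fun k => (s ^+ 2)^-1 * harmonic k)).
- apply: nearW => k /=; have /andP[-> _] := threshold_itv k y01; rewrite /=.
  apply: (le_trans (threshold_le_pow k y01)); rewrite -/r -[r]invrK rE exprVn -exprM mulrC.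
  have k0 : 0 < k.+1%:R :> R by [].
  have B := bernoulli_add k.+1 (ltW s0).
  have B' : k.+1%:R * s <= (1 + s) ^+ k.+1 by rewrite (le_trans _ B)// lerDr.
  have s10 : 0 < 1 + s by exact: addr_gt0 ltr01 s0.
  rewrite /harmonic/= -invfM ler_pdivrMl ?exprn_gt0//.
  rewrite ler_pdivlMr ?mulr_gt0 ?exprn_gt0//.
  have -> : k.+1%:R * (s ^+ 2 * k.+1%:R) = (k.+1%:R * s) ^+ 2 by ring.
  by rewrite mulnC exprM lerXn2r// nnegrE ?exprn_ge0// ?mulr_ge0// ltW.
- exact: cvg_cst.
- by rewrite -[X in _ --> X](mulr0 (s ^+ 2)^-1); apply: cvgM; [exact: cvg_cst|exact: cvg_harmonic].
Qed.

End threshold.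

(** * The algebra spanned by Gaussians *)

Section gauss_span.
Variables (R : realType) (n : nat).
Local Notation V := (Rn R n).
Local Notation leb := (@leb R n).

Definition L12 (f : V -> R[i]) := cintegrable leb f /\ (E2 leb f < +oo)%E.

Lemma L12_meas f : L12 f -> cmeas f. Proof. by move=> [If _]; exact: cintegrable_meas If. Qed.

Lemma L12D f g : L12 f -> L12 g -> L12 (fun x => f x + g x).
Proof.
move=> Lf Lg; have mf := L12_meas Lf; have mg := L12_meas Lg; have [If f2] := Lf; have [Ig g2] := Lg.
split; first exact: cintegrableD.
by apply: (le_lt_trans (E2D leb mf mg)); rewrite lte_add_pinfty// lte_mul_pinfty// E2_ge0.
Qed.

Lemma L12Z c f : L12 f -> L12 (fun x => c * f x).
Proof.
move=> Lf; have mf := L12_meas Lf; have [If f2] := Lf; split; first exact: cintegrableZ.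
by rewrite (E2Z leb c mf) lte_mul_pinfty ?lee_fin ?sqr_ge0.
Qed.

Lemma L12B f g : L12 f -> L12 g -> L12 (fun x => f x - g x).
Proof.
by move=> Lf /(L12Z (-1)) Lg; have := L12D Lf Lg; congr L12; apply/funext => x; rewrite mulN1r.
Qed.

Lemma L12_le f g : cmeas f -> L12 g -> (forall x, normc (f x) <= normc (g x)) -> L12 f.
Proof.
move=> mf Lg fg; have mg := L12_meas Lg; have [Ig g2] := Lg; split.
  exact: (cintegrable_le mf (cintegrable_normc Ig) fg).
by apply: le_lt_trans g2; exact: le_E2.
Qed.

Inductive gauss_span : (V -> R) -> Prop :=
| gauss_span_base t b : 0 < t -> gauss_span (fun x => gaussn t (x - b))
| gauss_spanD f g : gauss_span f -> gauss_span g -> gauss_span (fun x => f x + g x)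
| gauss_spanZ c f : gauss_span f -> gauss_span (fun x => c * f x).

Lemma gauss_spanB f g : gauss_span f -> gauss_span g -> gauss_span (fun x => f x - g x).
Proof.
by move=> Sf /(gauss_spanZ (-1)) Sg; have := gauss_spanD Sf Sg; congr gauss_span; apply/funext => x; rewrite mulN1r.
Qed.

Lemma gauss_span_borel f : gauss_span f -> measurable_fun setT (f : borelRn R n -> R).
Proof.
elim=> {f}.
- move=> t b _; exact: borel_gaussnB.
- by move=> f g _ mf _ mg; exact: measurable_funD.
- by move=> c f _ mf; exact: measurable_funMl.
Qed.

Lemma L12_gaussn t b : 0 < t -> L12 (fun x => (gaussn t (x - b))%:C).
Proof.
move=> t0; have E : (fun x => (gaussn t (x - b))%:C) = gmod t b 0.
  by apply/funext => x; rewrite /gmod dotp0l expi0 mulr1.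
by rewrite E; split; [exact: cintegrable_gmod|exact: E2_gmod].
Qed.

Lemma gauss_span_L12 f : gauss_span f -> L12 (fun x => (f x)%:C).
Proof.
elim=> {f}.
- by move=> t b; exact: L12_gaussn.
- move=> f g _ Lf _ Lg; have := L12D Lf Lg; congr L12; apply/funext => x.
  by apply: eq_ReIm => //=; rewrite addr0.
- by move=> c f _ /(L12Z c%:C); congr L12; apply/funext => x; rewrite realCM.
Qed.

(** Completing the square: this is what makes the span of Gaussians an algebra. *)
Lemma gaussn_mul_shift s t (a b x : V) : 0 < s -> 0 < t ->
  gaussn s (x - a) * gaussn t (x - b) =
  expR (- s * dotp a a - t * dotp b b + (s + t)^-1 * dotp (s *: a + t *: b) (s *: a + t *: b)) *
  gaussn (s + t) (x - (s + t)^-1 *: (s *: a + t *: b)).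
Proof.
move=> s0 t0; rewrite /gaussn -!expRD; congr expR.
set c := s *: a + t *: b.
have -> : - s * dotp (x - a) (x - a) + - t * dotp (x - b) (x - b) =
  - s * dotp a a - t * dotp b b - (s + t) * dotp x x + 2 * dotp c x.
  by rewrite /c !dotpE (dotpC x a) (dotpC x b); ring.
clearbody c; rewrite (dotpDl x (- _)) !(dotpDr _ _ _) !(dotpNl, dotpNr) !(dotpZl, dotpZr) (dotpC x c).
by field; rewrite gt_eqF// addr_gt0.
Qed.

Lemma gauss_spanM f g : gauss_span f -> gauss_span g -> gauss_span (fun x => f x * g x).
Proof.
move=> Sf Sg; elim: Sf => {f} [t b t0|f1 f2 _ H1 _ H2|c f _ H].
- elim: Sg => {g} [s a s0|g1 g2 _ H1 _ H2|c g _ H].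
  + under eq_fun do rewrite gaussn_mul_shift//.
    by apply: gauss_spanZ; apply: gauss_span_base; rewrite addr_gt0.
  + by have := gauss_spanD H1 H2; congr gauss_span; apply/funext => x; rewrite mulrDr.
  + by have := gauss_spanZ c H; congr gauss_span; apply/funext => x; rewrite mulrCA.
- by have := gauss_spanD H1 H2; congr gauss_span; apply/funext => x; rewrite mulrDl.
- by have := gauss_spanZ c H; congr gauss_span; apply/funext => x; rewrite mulrA.
Qed.

Lemma gauss_spanX k f : gauss_span f -> gauss_span (fun x => f x ^+ k.+1).
Proof.
move=> Sf; elim: k => [|k IH]; first by under eq_fun do rewrite expr1.
by under eq_fun do rewrite exprS; exact: gauss_spanM.
Qed.

(** The constant 1 is not among the generators of the span, so powers of [1 - y] are not at hand.
    Instead, if [P] is [1 - (1 - y) ^+ m.+1], the same expression for the next exponent is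
    [P + y - y * P]. *)
Lemma gauss_span_threshold k f : gauss_span f -> gauss_span (fun x => threshold k (f x)).
Proof.
move=> /(gauss_spanX k) Sf; rewrite /threshold.
have : (0 < k.+1 * 2 ^ k.+1)%N by rewrite muln_gt0/= expn_gt0.
case: (k.+1 * 2 ^ k.+1)%N => // m _.
elim: m => [|m IH].
  by move: Sf; congr gauss_span; apply/funext => x; rewrite expr1 opprB addrC subrK.
have := gauss_spanB (gauss_spanD IH Sf) (gauss_spanM Sf IH); congr gauss_span; apply/funext => x.
by rewrite [_ ^+ m.+2]exprS; ring.
Qed.

End gauss_span.
Import HBNNSimple.

(** * An induction principle for functions in L^1 and L^2 *)

Section density.
Variables (R : realType) (n : nat).
Local Notation V := (Rn R n).
Local Notation leb := (@leb R n).

(** Beside pointwise convergence, the Gaussian majorant gives integrability, and the values in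
    [[0, 1]] make the notion stable under products, hence under intersections. *)
Definition gauss_indic (E : set V) := exists (t : R) (b : V) (f : nat -> V -> R),
  [/\ 0 < t, forall k, gauss_span (f k), forall k x, 0 <= f k x <= 1,
      forall k x, f k x <= 8 * gaussn t (x - b) & forall x, f k x @[k --> \oo] --> (\1_E x : R)].

Lemma gauss_indic_ball t b : 0 < t -> gauss_indic [set x | 2^-1 <= gaussn t (x - b)].
Proof.
move=> t0; exists t, b, (fun k x => threshold k (gaussn t (x - b))); split.
- exact: t0.
- by move=> k; apply: gauss_span_threshold; exact: gauss_span_base.
- by move=> k x; apply: threshold_itv; rewrite gaussn_ge0 gaussn_le1// ltW.
- by move=> k x; apply: threshold_le; rewrite gaussn_ge0 gaussn_le1// ltW.
- move=> x; rewrite indicE; case: (leP 2^-1 (gaussn t (x - b))) => h.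
    by rewrite mem_set//=; apply: threshold_cvg1; rewrite h gaussn_le1// ltW.
  by rewrite memNset/= ?leNgt ?h//; apply: threshold_cvg0; rewrite h gaussn_gt0.
Qed.

Lemma gauss_indicI : setI_closed gauss_indic.
Proof.
move=> E F [t [b [f [t0 f1 f2 f3 f4]]]] [t' [b' [g [_ g1 g2 g3 g4]]]].
exists t, b, (fun k x => f k x * g k x); split.
- exact: t0.
- by move=> k; exact: gauss_spanM.
- move=> k x; have /andP[? ?] := f2 k x; have /andP[? ?] := g2 k x.
  by rewrite mulr_ge0//= mulr_ile1.
- move=> k x; apply: le_trans (f3 k x); have /andP[? ?] := f2 k x; have /andP[? ?] := g2 k x.
  by rewrite ler_piMr.
- by move=> x; rewrite indicI; exact: (cvgM (f4 x) (g4 x)).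
Qed.

Lemma gauss_indic_measurable (E : set V) : gauss_indic E -> measurable (E : set (borelRn R n)).
Proof.
move=> [t [b [f [t0 f1 f2 f3 f4]]]].
have mE : measurable_fun setT (\1_E : borelRn R n -> R).
  apply: (measurable_fun_cvg (h := fun k => f k : borelRn R n -> R)).
  - by move=> k; exact: gauss_span_borel.
  - by move=> x _; exact: f4.
have := mE measurableT _ (measurable_set1 1); rewrite setTI; congr measurable.
apply/seteqP; split=> x /=; rewrite indicE.
  by case: (boolP (x \in E)) => [/set_mem//|_ /esym/eqP]; rewrite oner_eq0.
by move=> /mem_set ->.
Qed.

(* the half-space [x_i < c] is the increasing union of the balls of centre
   [c - k] on the i-th axis and radius less than [k] *)
Lemma halfspace_bigcup (i : 'I_n) (c : R) :
  [set x : V | x ord0 i < c] =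
  \bigcup_k [set x : V | 2^-1 <= gaussn (ln 2 / (k.+2%:R ^+ 2 - 1))
                                  (x - (c - k.+2%:R) *: delta_mx ord0 i)].
Proof.
have dx (x : V) : dotp x (delta_mx ord0 i) = x ord0 i.
  rewrite /dotp (bigD1 i)//= mxE !eqxx mulr1 big1 ?addr0// => j ji.
  by rewrite mxE eqxx (negbTE ji) mulr0.
have dE (x : V) r : dotp (x - r *: delta_mx ord0 i) (x - r *: delta_mx ord0 i) =
    dotp x x - 2 * r * x ord0 i + r ^+ 2.
  rewrite (dotpDl x (- _)) !(dotpDr _ _ _) !(dotpNl, dotpNr) !(dotpZl, dotpZr).
  rewrite (dotpC (delta_mx ord0 i) x) !dx mxE !eqxx mulr1n; ring.
(* The level 1/2 of this Gaussian bounds the ball of squared radius [k.+2%:R ^+ 2 - 1]; the shift by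
   2 keeps this positive, and the [- 1] keeps the ball off the bounding hyperplane. *)
have key (k : nat) (x : V) :
    (2^-1 <= gaussn (ln 2 / (k.+2%:R ^+ 2 - 1)) (x - (c - k.+2%:R) *: delta_mx ord0 i)) =
    (dotp x x - 2 * (c - k.+2%:R) * x ord0 i + (c - k.+2%:R) ^+ 2 <= k.+2%:R ^+ 2 - 1).
  have K0 : 0 < k.+2%:R ^+ 2 - 1 :> R by rewrite subr_gt0 exprn_egt1// ltr1n.
  have l2 : 0 < ln 2 :> R by rewrite ln_gt0// ltr1n.
  rewrite /gaussn dE -[2^-1]lnK ?posrE ?invr_gt0// ler_expR lnV ?posrE// mulNr lerN2.
  by rewrite mulrAC ler_pdivrMr// ler_pM2l.
apply/seteqP; split=> x /=.
- move=> xc; have d0 : 0 < 2 * (c - x ord0 i) by rewrite mulr_gt0// subr_gt0.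
  pose q := (dotp x x - x ord0 i * x ord0 i + (c - x ord0 i) ^+ 2 + 1) / (2 * (c - x ord0 i)).
  exists (Num.bound `|q|) => //=; rewrite key.
  have : q <= (Num.bound `|q|).+2%:R.
    rewrite (le_trans (ler_norm q))// ltW// (lt_le_trans (archi_boundP (normr_ge0 q)))//.
    by rewrite ler_nat ltnW// ltnW.
  rewrite /q ler_pdivrMr//; move: (_.+2%:R) => K.
  by move: (dotp x x) (x ord0 i) => s z; nra.
- move=> [k _ /=]; rewrite key.
  have : x ord0 i * x ord0 i <= dotp x x.
    by rewrite /dotp (bigD1 i)//= lerDl; apply: sumr_ge0 => j _; rewrite -expr2 sqr_ge0.
  have : 2 <= k.+2%:R :> R by rewrite ler_nat.
  by move: (k.+2%:R) (x ord0 i) (dotp x x) => K z s ? ? ?; nra.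
Qed.

Lemma borel_sub_gauss_indic : @measurable _ (borelRn R n) `<=` <<s gauss_indic >>.
Proof.
have mid : measurable_fun setT (id : g_sigma_algebraType gauss_indic -> borelRn R n).
  apply: measurable_to_borelRn => i.
  apply: (measurability _ (RGenInftyO.measurableE R)) => _ [_ [c ->] <-]; rewrite setTI.
  have -> : (borel_coord i \o id) @^-1` `]-oo, c[%classic = [set x : V | x ord0 i < c].
    by apply/seteqP; split=> x /=; rewrite in_itv.
  rewrite halfspace_bigcup; apply: bigcupT_measurable => k; apply: sub_sigma_algebra.
  apply: gauss_indic_ball; rewrite divr_gt0 ?ln_gt0 ?ltr1n// subr_gt0.
  by rewrite exprn_egt1// ltr1n.
by move=> A mA; have := mid measurableT _ mA; rewrite setTI.
Qed.

Lemma normc_realB (r s : R) : normc (r%:C - s%:C) = `|r - s|.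
Proof. by rewrite -(normc_real (r - s)); congr normc; apply: eq_ReIm => //=; rewrite subr0. Qed.

Lemma sqr_indic (E : set V) x : (\1_E x : R) ^+ 2 = \1_E x.
Proof. by rewrite indicE; case: (_ \in _); rewrite ?expr1n ?expr0n. Qed.

Lemma normc_indic (E : set V) x : normc ((\1_E x : R)%:C) = \1_E x.
Proof. by rewrite normc_real ger0_norm. Qed.

Lemma L12_indic (E : set V) : measurable E -> (leb E < +oo)%E -> L12 (fun x => (\1_E x : R)%:C).
Proof.
move=> mE Eoo; have mi : cmeas (fun x : V => (\1_E x : R)%:C) by apply: cmeas_real; exact: measurable_indic.
split.
  apply/(cintegrableP leb mi); under eq_integral do rewrite normc_indic.
  by rewrite integral_indic// setIT.
rewrite /E2; under eq_integral do rewrite normc_indic sqr_indic.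
by rewrite integral_indic// setIT.
Qed.

Lemma L12_indicS (A E : set V) : measurable A -> A `<=` E ->
  L12 (fun x => (\1_E x : R)%:C) -> L12 (fun x => (\1_A x : R)%:C).
Proof.
move=> mA AE LE; have mi : cmeas (fun x : V => (\1_A x : R)%:C) by apply: cmeas_real; exact: measurable_indic.
apply: (L12_le mi LE) => x; rewrite !normc_indic !indicE.
by case: (boolP (x \in A)) => // /set_mem /AE /mem_set ->.
Qed.

Lemma L12_indic_lty (E : set V) : measurable E -> L12 (fun x => (\1_E x : R)%:C) -> (leb E < +oo)%E.
Proof.
move=> mE LE; have [/(cintegrableP leb (L12_meas LE)) + _] := LE.
by under eq_integral do rewrite normc_indic; rewrite integral_indic// setIT.
Qed.

(** [P] is arbitrary because the principle is applied to [FT (-1)] and to [iFT]. [Pcvg] asks for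
    convergence in L^2 only, which is what [E2_FT_le] transfers to the transforms. *)
Variable P : (V -> R[i]) -> Prop.
Hypothesis Pgauss : forall t b, 0 < t -> P (fun x => (gaussn t (x - b))%:C).
Hypothesis PD : forall c f g, L12 f -> L12 g -> P f -> P g -> P (fun x => f x + c * g x).
Hypothesis Pcvg : forall f_ f, (forall k, L12 (f_ k)) -> (forall k, P (f_ k)) -> L12 f ->
  E2 leb (fun x => f_ k x - f x) @[k --> \oo] --> 0%E -> P f.

Let PZ c f : L12 f -> P f -> P (fun x => c * f x).
Proof.
move=> Lf Pf; have := PD (c - 1) Lf Lf Pf Pf; congr P; apply/funext => x.
by rewrite mulrBl mul1r addrC subrK.
Qed.

Let Pspan f : gauss_span f -> P (fun x => (f x)%:C).
Proof.
elim=> {f}.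
- by move=> t b; exact: Pgauss.
- move=> f g Sf Pf Sg Pg; have := PD 1 (gauss_span_L12 Sf) (gauss_span_L12 Sg) Pf Pg.
  by congr P; apply/funext => x; rewrite mul1r; apply: eq_ReIm => //=; rewrite addr0.
- move=> c f Sf Pf; have := PZ c%:C (gauss_span_L12 Sf) Pf.
  by congr P; apply/funext => x; rewrite realCM.
Qed.

Let Pdom f_ f g : (forall k, L12 (f_ k)) -> (forall k, P (f_ k)) -> L12 f -> L12 g ->
  (forall x, normc (f_ k x - f x) @[k --> \oo] --> 0) ->
  (forall k x, normc (f_ k x - f x) <= normc (g x)) -> P f.
Proof.
move=> Lf_ Pf_ Lf Lg cf fg; apply: (Pcvg Lf_ Pf_ Lf).
apply: (@E2_cvg_dominated _ _ _ leb f_ f (fun x => normc (g x))).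
- by move=> k; exact: (L12_meas (Lf_ k)).
- exact: (L12_meas Lf).
- have mg := measurable_normc (L12_meas Lg).
  apply/(ge0_integrableP leb); first exact: measurable_funX.
    by move=> x; rewrite sqr_ge0.
  by have [_] := Lg.
- by apply: aeW => x; exact: cf.
- by apply: aeW => x k; exact: fg.
Qed.

Let Pae f g : L12 f -> L12 g -> (\forall x \ae leb, f x = g x) -> P f -> P g.
Proof.
move=> Lf Lg fg Pf; apply: (@Pcvg (fun=> f) g) => //.
have -> : E2 leb (fun x => f x - g x) = E2 leb (fun=> 0).
  apply: E2_ae; first exact: (cmeasB (L12_meas Lf) (L12_meas Lg)).
    exact: cmeas_cst.
  by apply: filterS fg => x ->; rewrite subrr.
suff -> : E2 leb (fun=> 0) = 0%E by exact: cvg_cst.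
by rewrite /E2; under eq_integral do rewrite normc0 expr0n; rewrite integral0.
Qed.

Let Pgi (E : set V) : gauss_indic E -> L12 (fun x => (\1_E x : R)%:C) /\ P (fun x => (\1_E x : R)%:C).
Proof.
move=> GE; have mE := borel_measurable (gauss_indic_measurable GE).
have mi : cmeas (fun x : V => (\1_E x : R)%:C) by apply: cmeas_real; exact: measurable_indic.
case: (GE) => t [b [f [t0 f1 f2 f3 f4]]].
have f8 x : \1_E x <= 8 * gaussn t (x - b).
  have cf : f k x @[k --> \oo] --> (\1_E x : R) by exact: f4.
  have := limr_le _ _; move=> /(_ _ _ _ _ (8 * gaussn t (x - b))) H.
  rewrite -(cvg_lim (@Rhausdorff _) cf); apply: H; first by apply/cvg_ex; exists (\1_E x).
  by apply: nearW => k; exact: f3.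
have L8 : L12 (fun x => (8 : R)%:C * (gaussn t (x - b))%:C) by apply: L12Z; exact: L12_gaussn.
have n8 x : normc ((8 : R)%:C * (gaussn t (x - b))%:C) = 8 * gaussn t (x - b).
  by rewrite normcM !normc_real !ger0_norm// gaussn_ge0.
have LE : L12 (fun x => (\1_E x : R)%:C).
  by apply: (L12_le mi L8) => x; rewrite normc_indic n8.
split; first exact: LE.
apply: (Pdom (f_ := fun k x => (f k x)%:C) _ _ LE L8).
- by move=> k; exact: gauss_span_L12.
- by move=> k; exact: Pspan.
- move=> x; under eq_fun do rewrite normc_realB.
  have := cvg_norm (cvgB (f4 x) (cvg_cst (\1_E x : R))); rewrite subrr normr0; exact.
- move=> k x; rewrite normc_realB n8.
  have /andP[f0 _] := f2 k x; have i0 : 0 <= \1_E x :> R by [].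
  by rewrite ler_norml; have := f3 k x; have := f8 x; move: f0 i0; lra.
Qed.

Let Pup (A : nat -> set V) (E : set V) : (forall k, measurable (A k)) ->
  (forall k, A k `<=` E) -> (forall x, E x -> exists N, forall k, (N <= k)%N -> A k x) ->
  L12 (fun x => (\1_E x : R)%:C) -> (forall k, P (fun x => (\1_(A k) x : R)%:C)) ->
  P (fun x => (\1_E x : R)%:C).
Proof.
move=> mA AE EA LE PA; apply: (Pdom (f_ := fun k x => (\1_(A k) x : R)%:C) _ PA LE LE).
- by move=> k; exact: (L12_indicS (mA k) (AE k) LE).
- move=> x; apply: cvg_near_cst; have [Ex|nEx] := pselect (E x).
    have [N H] := EA x Ex; exists N => // k /= Nk.
    by rewrite !indicE (mem_set Ex) (mem_set (H k Nk)); apply: etrans (normc_realB _ _) _; rewrite subrr normr0.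
  apply: nearW => k; rewrite !indicE (memNset nEx) memNset ?normc_realB ?subrr ?normr0//.
  by move=> /AE.
- move=> k x; rewrite normc_realB normc_indic !indicE.
  case: (boolP (x \in A k)) => [/set_mem/AE/mem_set ->|_]; rewrite ?subrr ?normr0//.
  by case: (x \in E); rewrite ?subrr ?sub0r ?normrN ?normr0 ?normr1.
Qed.

(** Dynkin's lemma is applied inside a fixed [B], so that complements still have an integrable
    indicator. *)
Let Pborel (E B : set V) : gauss_indic B -> measurable (E : set (borelRn R n)) ->
  P (fun x => (\1_(E `&` B) x : R)%:C).
Proof.
move=> GB mE; have [LB PB] := Pgi GB; have mB := borel_measurable (gauss_indic_measurable GB).
have mI (A : set V) : measurable (A : set (borelRn R n)) -> measurable (A `&` B).
  by move=> mA; apply: measurableI => //; exact: borel_measurable.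
have LI (A : set V) : measurable (A : set (borelRn R n)) -> L12 (fun x => (\1_(A `&` B) x : R)%:C).
  by move=> mA; apply: L12_indicS LB; [exact: mI|exact: subIsetr].
pose D := [set A : set V | measurable (A : set (borelRn R n)) /\ P (fun x => (\1_(A `&` B) x : R)%:C)].
suff : <<d gauss_indic >> `<=` D.
  rewrite (setI_closed_g_dynkin_g_sigma_algebra gauss_indicI) => H.
  by have [] := H _ (borel_sub_gauss_indic mE).
apply: smallest_sub; last first.
  move=> A GA; split; first exact: gauss_indic_measurable.
  by have [] := Pgi (gauss_indicI GA GB).
split.
- by split; [exact: measurableT|rewrite setTI].
- move=> A [mA PA]; split; first exact: measurableC.
  have := PD (-1) LB (LI _ mA) PB PA; congr P; apply/funext => x.
  rewrite !indicE !in_setI in_setC.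
  by case: (x \in A); case: (x \in B); rewrite /= ?mulr1n ?mulr0n ?mulr0 ?addr0// mulN1r subrr.
- move=> F tF DF.
  have mF : measurable (\bigcup_k F k : set (borelRn R n)).
    by apply: bigcupT_measurable => k; have [] := DF k.
  split; first exact: mF.
  pose A k := \big[setU/set0]_(i < k) F i.
  have mA k : measurable (A k : set (borelRn R n)).
    by apply: bigsetU_measurable => i _; have [] := DF i.
  apply: (Pup (A := fun k => A k `&` B)).
  + by move=> k; exact: mI.
  + move=> k; apply: setSI; rewrite /A -bigcup_mkord.
    by apply: bigcup_subset.
  + move=> x [[i _ Fix] Bx]; exists i.+1 => k ik; split => //.
    by rewrite /A -bigcup_mkord; exists i.
  + exact: LI.
  + elim=> [|k IH].
      rewrite /A big_ord0 set0I.
      have := PZ 0 LB PB; congr P; apply/funext => x.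
      by rewrite indic0 mul0r.
    have [mFk PFk] := DF k; have := PD 1 (LI _ (mA k)) (LI _ mFk) IH PFk.
    congr P; apply/funext => x; rewrite mul1r.
    have -> : A k.+1 = A k `|` F k by rewrite /A big_ord_recr.
    rewrite !indicE !in_setI in_setU.
    have dis : ~~ ((x \in A k) && (x \in F k)).
      apply/negP => /andP[/set_mem + /set_mem Fx]; rewrite /A -bigcup_mkord => -[i /= ik Fix].
      move/trivIsetP : tF => /(_ i k I I); rewrite ltn_eqF// => /(_ isT) H.
      by have : set0 x by rewrite -H.
    move: dis; case: (x \in A k); case: (x \in F k); case: (x \in B) => //= _;
    by apply: eq_ReIm; rewrite /= ?addr0 ?add0r.
Qed.

(** Up to a null set, [E] is a Borel set, and this one is exhausted by its intersections with
    centred balls, the level sets of ever flatter Gaussians. *)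
Let Plebesgue (E : set V) : measurable E -> L12 (fun x => (\1_E x : R)%:C) ->
  P (fun x => (\1_E x : R)%:C).
Proof.
move=> mE LE; have Eoo := L12_indic_lty mE LE.
have [B [mB EB BE0]] := leb_borel_hull mE Eoo.
have mB' : measurable (B : set V) := borel_measurable mB.
have LB : L12 (fun x => (\1_B x : R)%:C).
  apply: L12_indic; first exact: mB'.
  have -> : (B : set V) = E `|` (B `\` E) by rewrite setDUK.
  apply: (@le_lt_trans _ _ (leb E + leb (B `\` E))%E); last by rewrite BE0 adde0.
  by apply: measureU2 => //; exact: measurableD.
have eBE : \forall x \ae leb, (\1_B x : R)%:C = (\1_E x : R)%:C.
  exists (B `\` E); split => //; first exact: measurableD.
  move=> x /= H; apply: contrapT => nBE; apply: H.
  rewrite !indicE; case: (boolP (x \in E)) => [/set_mem/EB/mem_set ->//|nE].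
  rewrite memNset// => Bx; apply: nBE; split=> //; move=> Ex; move: nE.
  by rewrite mem_set.
apply: (Pae LB LE eBE).
pose G k := [set x : V | 2^-1 <= gaussn (k.+1%:R^-1) (x - 0)].
have GG k : gauss_indic (G k) by apply: gauss_indic_ball; rewrite invr_gt0.
apply: (Pup (A := fun k => B `&` G k)).
- by move=> k; apply: measurableI => //; exact: borel_measurable (gauss_indic_measurable (GG k)).
- by move=> k; exact: subIsetl.
- move=> x Bx; exists (Num.bound (dotp x x / ln 2)) => k xk; split => //.
  have l2 : 0 < ln 2 :> R by rewrite ln_gt0// ltr1n.
  rewrite /G/= subr0 /gaussn -[2^-1]lnK ?posrE ?invr_gt0// ler_expR lnV ?posrE// mulNr lerN2.
  rewrite mulrC ler_pdivrMr// mulrC -ler_pdivrMr//.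
  apply: ltW; apply: (lt_le_trans (archi_boundP _)).
    by rewrite divr_ge0 ?dotp_ge0// ltW.
  by rewrite ler_nat ltnW.
- exact: LB.
- by move=> k; exact: (Pborel (GG k)).
Qed.

(** The alternative [c i = 0] covers the set where a simple function vanishes, whose measure may be
    infinite. *)
Let Psum (m : nat) (c : nat -> R) (A : nat -> set V) : (forall i, measurable (A i)) ->
  (forall i, c i = 0 \/ L12 (fun x => (\1_(A i) x : R)%:C)) ->
  L12 (fun x => (\sum_(i < m) (c i * \1_(A i) x))%:C) /\
  P (fun x => (\sum_(i < m) (c i * \1_(A i) x))%:C).
Proof.
have L0 : L12 (fun x : V => (gaussn 1 (x - 0))%:C) by exact: L12_gaussn.
have P0 : P (fun x : V => (gaussn 1 (x - 0))%:C) by exact: Pgauss.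
move=> mA H; elim: m => [|m [IHL IHP]].
  have -> : (fun x => (\sum_(i < 0) (c i * \1_(A i) x))%:C) = fun x : V => 0 * (gaussn 1 (x - 0))%:C.
    by apply/funext => x; rewrite big_ord0 mul0r.
  by split; [exact: L12Z|exact: PZ].
have -> : (fun x => (\sum_(i < m.+1) (c i * \1_(A i) x))%:C) =
   fun x => (\sum_(i < m) (c i * \1_(A i) x))%:C + (c m)%:C * (\1_(A m) x : R)%:C.
  by apply/funext => x; rewrite big_ord_recr/= -realCM; apply: eq_ReIm => //=; rewrite addr0.
case: (H m) => [-> | LA].
  by under eq_fun do rewrite mul0r addr0.
split; first by apply: L12D IHL _; exact: L12Z.
apply: PD => //; exact: Plebesgue.
Qed.

Let Psimple (f : {nnsfun V >-> R}) : L12 (fun x => (f x)%:C) -> P (fun x => (f x)%:C).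
Proof.
move=> Lf; under eq_fun do rewrite fimfunEord.
pose s : seq R := finmap.enum_fset (fset_set (range f)).
have [||_ //] := @Psum (size s) (fun i => s`_i) (fun i => f @^-1` [set s`_i]).
  by move=> i; exact: measurable_funPTI.
move=> i; have [|si] := eqVneq (s`_i) 0; first by left.
(* On the level set of a nonzero value, [f] divided by this value is 1, so it dominates the
   indicator. *)
right; apply: (L12_le _ (L12Z ((s`_i)^-1)%:C Lf)).
  by apply: cmeas_real; apply: measurable_indic; exact: measurable_funPTI.
move=> x; rewrite normc_indic indicE normcM !normc_real; case: (boolP (x \in _)) => [/set_mem /= fx|_].
  by rewrite fx -normrM mulVf// normr1.
by rewrite mulr_ge0.
Qed.

Let Pnneg (f : V -> R) : (forall x, 0 <= f x) -> L12 (fun x => (f x)%:C) -> P (fun x => (f x)%:C).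
Proof.
move=> f0 Lf; have mf : measurable_fun setT f by have [] := L12_meas Lf.
have mef : measurable_fun setT (EFin \o f) by exact/measurable_EFinP.
pose g := nnsfun_approx measurableT mef.
have ndg := nd_nnsfun_approx measurableT mef.
have cg x : g k x @[k --> \oo] --> f x.
  have : EFin \o g^~ x @ \oo --> (f x)%:E.
    by apply: (cvg_nnsfun_approx measurableT mef) => // y _; rewrite lee_fin.
  by move/fine_cvgP => [_].
have gf k x : g k x <= f x.
  have cgx := cg x.
  rewrite -(cvg_lim (@Rhausdorff _) cgx); apply: nondecreasing_cvgn_le.
    by move=> i j ij; exact/lefP/ndg.
  by apply/cvg_ex; exists (f x).
have g0 k x : 0 <= g k x by [].
have mg k : cmeas (fun x => (g k x)%:C) by apply: cmeas_real; exact: measurable_funPT.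
have Lg k : L12 (fun x => (g k x)%:C).
  by apply: (L12_le (mg k) Lf) => x; rewrite !normc_real !ger0_norm.
apply: (Pdom (f_ := fun k x => (g k x)%:C) Lg _ Lf Lf).
- by move=> k; exact: Psimple (Lg k).
- move=> x; under eq_fun do rewrite normc_realB.
  have := cvg_norm (cvgB (cg x) (cvg_cst (f x : R))); rewrite subrr normr0; exact.
- move=> k x; rewrite normc_realB normc_real (ger0_norm (f0 x)).
  by rewrite ler_norml; have := gf k x; have := g0 k x; have := f0 x; lra.
Qed.

Let Preal (f : V -> R) : L12 (fun x => (f x)%:C) -> P (fun x => (f x)%:C).
Proof.
have mx (y : R) : `|Num.max y 0| <= `|y| by rewrite maxEle; case: ifP => // _; rewrite normr0.
have mx0 (y : R) : 0 <= Num.max y 0 by rewrite le_max lexx orbT.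
move=> Lf; have mf : measurable_fun setT f by have [] := L12_meas Lf.
have L1 : L12 (fun x => (Num.max (f x) 0)%:C).
  apply: (L12_le _ Lf) => [|x]; last by rewrite !normc_real.
  by apply: cmeas_real; exact: measurable_maxr.
have L2 : L12 (fun x => (Num.max (- f x) 0)%:C).
  apply: (L12_le _ Lf) => [|x]; last by rewrite !normc_real -[leRHS]normrN.
  by apply: cmeas_real; apply: measurable_maxr; [exact: (measurableT_comp (@oppr_measurable R setT) mf)|exact: measurable_cst].
have := PD (-1) L1 L2 (Pnneg (fun x => mx0 (f x)) L1) (Pnneg (fun x => mx0 (- f x)) L2).
congr P; apply/funext => x; rewrite mulN1r; apply: eq_ReIm; rewrite /= ?subr0//.
by rewrite !maxEle; case: ifP; case: ifP => //; lra.
Qed.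

(* Polynomials in Gaussians give the indicators of finite intersections of
   balls, Dynkin's lemma those of bounded Borel sets. *)
Theorem L12_ind f : L12 f -> P f.
Proof.
move=> Lf; have [mf1 mf2] := L12_meas Lf.
have L1 : L12 (fun x => (complex.Re (f x))%:C).
  by apply: (L12_le _ Lf) => [|x]; [exact: cmeas_real|rewrite normc_real normr_Re_le].
have L2 : L12 (fun x => (complex.Im (f x))%:C).
  by apply: (L12_le _ Lf) => [|x]; [exact: cmeas_real|rewrite normc_real normr_Im_le].
have := PD 'i%C L1 L2 (Preal L1) (Preal L2); congr P; apply/funext => x.
by apply: eq_ReIm; rewrite ?ReD ?ImD ?ReM ?ImM/=; ring.
Qed.

End density.

(** * The Fourier transform on L^2 *)

Section fourier_L12.
Variables (R : realType) (n : nat).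
Local Notation V := (Rn R n).
Local Notation leb := (@leb R n).
Implicit Types u v f g w : V -> R[i].

Lemma L2P f : L2 f <-> cmeas f /\ (E2 leb f < +oo)%E.
Proof. by split=> -[mf f2]; split => //; exact/L2norm_lty. Qed.

Lemma L12_L2 f : L12 f -> L2 f.
Proof. by move=> Lf; apply/L2P; split; [exact: L12_meas|case: Lf]. Qed.

Lemma FT_meas s f : L12 f -> cmeas (FT s f).
Proof. by move=> [If _]; exact: cmeas_FT. Qed.

Lemma L2_FT s f : s ^+ 2 = 1 -> L12 f -> L2 (FT s f).
Proof.
move=> s1 Lf; apply/L2P; split; first exact: FT_meas.
have [If f2] := Lf; apply: (le_lt_trans (E2_FT_le s1 If f2)).
by rewrite lte_mul_pinfty// lee_fin exprn_ge0// mulr_ge0// pi_ge0.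
Qed.

Lemma sqrN1 : (-1) ^+ 2 = 1 :> R. Proof. by rewrite sqrrN expr1n. Qed.

Definition modgauss f := gauss_class (fun x => complex.Re (f x)) /\ gauss_class (fun x => complex.Im (f x)).

Lemma modgauss_schwartz f : modgauss f -> schwartz f.
Proof. by move=> [f1 f2]; exact: schwartz_real_class. Qed.

Lemma modgaussDZ c f g : modgauss f -> modgauss g -> modgauss (fun x => f x + c * g x).
Proof.
move=> [f1 f2] [g1 g2]; split.
- have := gauss_classD f1 (gauss_classD (gauss_classZ (complex.Re c) g1) (gauss_classZ (- complex.Im c) g2)).
  by congr gauss_class; apply/funext => x; case: (f x) (g x) (c) => ? ? [? ?] [? ?] /=; ring.
- have := gauss_classD f2 (gauss_classD (gauss_classZ (complex.Re c) g2) (gauss_classZ (complex.Im c) g1)).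
  by congr gauss_class; apply/funext => x; case: (f x) (g x) (c) => ? ? [? ?] [? ?] /=; ring.
Qed.

(** An epsilon form of [fourier_graph], with Gaussian functions for Schwartz functions: it passes to
    linear combinations and to L^2 limits without diagonal sequences. *)
Definition fourier_approx u v := forall e : R, 0 < e -> exists w,
  [/\ modgauss w, (E2 leb (fun x => w x - u x)%R < e%:E)%E &
      (E2 leb (fun x => FT (-1) w x - v x)%R < e%:E)%E].

Lemma modgauss_L12 f : modgauss f -> L12 f.
Proof. by move=> /modgauss_schwartz /schwartz_integrable. Qed.

Lemma fourier_schwartzE w : fourier_schwartz w = FT (-1) w.
Proof. by apply/funext => x; apply: eq_cint => y; rewrite mulN1r dotpC. Qed.

Lemma fourier_approx_graph u v : L2 u -> L2 v -> fourier_approx u v -> fourier_graph u v.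
Proof.
move=> Lu Lv H; split; [exact: Lu|exact: Lv|].
have /choice[w Hw] : forall k, exists w, [/\ modgauss w,
    (E2 leb (fun x => w x - u x)%R < (k.+1%:R^-1)%:E)%E &
    (E2 leb (fun x => FT (-1) w x - v x)%R < (k.+1%:R^-1)%:E)%E].
  by move=> k; apply: H; rewrite invr_gt0.
have tiny (F : nat -> \bar R) : (forall k, 0 <= F k)%E -> (forall k, F k < (k.+1%:R^-1)%:E)%E -> F @ \oo --> 0%E.
  move=> F0 HF; apply: (le_cvge0 F0 (fun k => ltW (HF k))).
  by apply: cvg_EFin; [exact: nearW|exact: cvg_harmonic].
exists w; split.
- by move=> k; have [/modgauss_schwartz] := Hw k.
- by apply/L2norm_cvg0; apply: tiny => k; [exact: E2_ge0|case: (Hw k)].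
- apply/L2norm_cvg0; apply: tiny => k; first exact: E2_ge0.
  by rewrite fourier_schwartzE; case: (Hw k).
Qed.

Lemma fourier_approx_closed (u_ v_ : nat -> V -> R[i]) u v :
  (forall k, cmeas (u_ k)) -> (forall k, cmeas (v_ k)) -> cmeas u -> cmeas v ->
  (forall k, fourier_approx (u_ k) (v_ k)) ->
  E2 leb (fun x => u_ k x - u x) @[k --> \oo] --> 0%E ->
  E2 leb (fun x => v_ k x - v x) @[k --> \oo] --> 0%E -> fourier_approx u v.
Proof.
move=> mu_ mv_ mu mv H cu cv e e0.
have e4 : 0 < e / 4 by rewrite divr_gt0.
move/(cvge0P (fun k => E2_ge0 _ _)) : cu => /(_ _ e4) cu.
move/(cvge0P (fun k => E2_ge0 _ _)) : cv => /(_ _ e4) cv.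
have [N _ /(_ N (leqnn N)) [/= uN vN]] := filterI cu cv.
have [w [Sw wu wv]] := H N _ e4; exists w; split; first exact: Sw.
- apply: (le_lt_trans (E2_dist leb (L12_meas (modgauss_L12 Sw)) (mu_ N) mu)).
  have -> : e%:E = (2%:E * (e / 4)%:E + 2%:E * (e / 4)%:E)%E.
    by rewrite -!EFinM -EFinD; congr (_%:E); field.
  by apply: lteD; rewrite lte_pmul2l.
- apply: (le_lt_trans (E2_dist leb (FT_meas (-1) (modgauss_L12 Sw)) (mv_ N) mv)).
  have -> : e%:E = (2%:E * (e / 4)%:E + 2%:E * (e / 4)%:E)%E.
    by rewrite -!EFinM -EFinD; congr (_%:E); field.
  by apply: lteD; rewrite lte_pmul2l.
Qed.

Lemma E2_lincomb_lt c f g f' g' (e : R) : 0 < e -> cmeas f -> cmeas g -> cmeas f' -> cmeas g' ->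
  (E2 leb (fun x => f x - f' x)%R < (e / (4 * (1 + normc c ^+ 2)))%:E)%E ->
  (E2 leb (fun x => g x - g' x)%R < (e / (4 * (1 + normc c ^+ 2)))%:E)%E ->
  (E2 leb (fun x => (f x + c * g x) - (f' x + c * g' x))%R < e%:E)%E.
Proof.
move=> e0 mf mg mf' mg' Hf Hg.
have -> : (fun x => (f x + c * g x) - (f' x + c * g' x)) = (fun x => (f x - f' x) + c * (g x - g' x)).
  by apply/funext => x; ring.
have mff := cmeasB mf mf'; have mgg := cmeasB mg mg'.
have mcg : cmeas (fun x => c * (g x - g' x)) by apply: cmeasM mgg; exact: cmeas_cst.
apply: (le_lt_trans (E2D leb mff mcg)); rewrite (E2Z leb c mgg).
set q := normc c ^+ 2 in Hf Hg *; have q0 : 0 <= q by rewrite sqr_ge0.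
set d := e / _ in Hf Hg.
have -> : e%:E = (2%:E * d%:E + (2%:E * (1 + 2 * q)%:E * d%:E))%E.
  by rewrite -!EFinM -EFinD; congr (_%:E); rewrite /d; field; rewrite gt_eqF// ltr_pwDl.
have d0 : 0 < d by rewrite divr_gt0// mulr_gt0// ltr_pwDl.
apply: lteD; first by rewrite lte_pmul2l.
apply: (@le_lt_trans _ _ (2%:E * (q%:E * d%:E))%E).
  by rewrite lee_pmul2l// lee_wpmul2l// ltW.
by rewrite -!EFinM lte_fin; nra.
Qed.

Lemma fourier_approxDZ c u v u' v' : cmeas u -> cmeas v -> cmeas u' -> cmeas v' ->
  fourier_approx u v -> fourier_approx u' v' ->
  fourier_approx (fun x => u x + c * u' x) (fun x => v x + c * v' x).
Proof.
move=> mu mv mu' mv' H H' e e0.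
have d0 : 0 < e / (4 * (1 + normc c ^+ 2)).
  by rewrite divr_gt0// mulr_gt0// ltr_pwDl// sqr_ge0.
have [w [Sw wu wv]] := H _ d0; have [w' [Sw' wu' wv']] := H' _ d0.
have Lw := modgauss_L12 Sw; have Lw' := modgauss_L12 Sw'.
exists (fun x => w x + c * w' x); split; first exact: modgaussDZ.
  exact: (E2_lincomb_lt e0 (L12_meas Lw) (L12_meas Lw') mu mu' wu wu').
have [Iw _] := Lw; have [Iw' _] := Lw'.
have -> : FT (-1) (fun x => w x + c * w' x) = fun x => FT (-1) w x + c * FT (-1) w' x.
  by apply/funext => x; rewrite (FTD _ _ Iw (cintegrableZ c Iw')) (FTZ _ _ _ Iw').
exact: (E2_lincomb_lt e0 (FT_meas _ Lw) (FT_meas _ Lw') mv mv' wv wv').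
Qed.

Definition iFT g : V -> R[i] := fun x => (((2 * pi) ^+ n)^-1)%:C * FT 1 g x.

Lemma iFT_meas g : L12 g -> cmeas (iFT g).
Proof. by move=> Lg; apply: cmeasM; [exact: cmeas_cst|exact: FT_meas]. Qed.

Lemma L2_iFT g : L12 g -> L2 (iFT g).
Proof.
move=> Lg; apply/L2P; split; first exact: iFT_meas.
have /L2P[_ f2] := L2_FT (expr1n R 2) Lg.
by rewrite (E2Z leb _ (FT_meas 1 Lg)) lte_mul_pinfty// lee_fin sqr_ge0.
Qed.

Lemma E2_FTB_le s f g : s ^+ 2 = 1 -> L12 f -> L12 g ->
  (E2 leb (fun x => FT s f x - FT s g x)%R <= ((2 * pi) ^+ n)%:E * E2 leb (fun x => f x - g x)%R)%E.
Proof.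
move=> s1 Lf Lg; have [IB B2] := L12B Lf Lg; have [If _] := Lf; have [Ig _] := Lg.
apply: le_trans (E2_FT_le s1 IB B2).
by have -> : FT s (fun x => f x - g x) = fun x => FT s f x - FT s g x by apply/funext => x; exact: FTB.
Qed.

Lemma E2_FTB_cvg s (f_ : nat -> V -> R[i]) f : s ^+ 2 = 1 -> (forall k, L12 (f_ k)) -> L12 f ->
  E2 leb (fun x => f_ k x - f x) @[k --> \oo] --> 0%E ->
  E2 leb (fun x => FT s (f_ k) x - FT s f x) @[k --> \oo] --> 0%E.
Proof.
move=> s1 Lf_ Lf /(cvge0Z ((2 * pi) ^+ n)); apply: le_cvge0 => k; first exact: E2_ge0.
exact: E2_FTB_le.
Qed.

Lemma modgauss_gmod t b c : 0 < t -> modgauss (gmod t b c).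
Proof.
move=> t0; split.
- rewrite (_ : (fun x => _) = gcos t 0 b c); first exact: gauss_class_base.
  by apply/funext => x; rewrite /gmod /gcos /= mul0r subr0 addr0.
- rewrite (_ : (fun x => _) = gcos t (- (pi / 2)) b c); first exact: gauss_class_base.
  by apply/funext => x; rewrite /gmod /gcos /= mul0r addr0 cosBpihalf.
Qed.

Lemma fourier_approx_refl w : modgauss w -> fourier_approx w (FT (-1) w).
Proof.
move=> Sw e e0; exists w; split; first exact: Sw.
- by under [E2 _ _]eq_integral do rewrite subrr normc0 expr0n; rewrite integral0 lte_fin.
- by under [E2 _ _]eq_integral do rewrite subrr normc0 expr0n; rewrite integral0 lte_fin.
Qed.

Lemma fourier_approx_FT u : L12 u -> fourier_approx u (FT (-1) u).
Proof.
apply: (L12_ind (P := fun u => fourier_approx u (FT (-1) u))).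
- move=> t b t0; have -> : (fun x => (gaussn t (x - b))%:C) = gmod t b 0.
    by apply/funext => x; rewrite /gmod dotp0l expi0 mulr1.
  by apply: fourier_approx_refl; exact: modgauss_gmod.
- move=> c f g Lf Lg Pf Pg; have [If _] := Lf; have [Ig _] := Lg.
  have -> : FT (-1) (fun x => f x + c * g x) = fun x => FT (-1) f x + c * FT (-1) g x.
    by apply/funext => x; rewrite (FTD _ _ If (cintegrableZ c Ig)) (FTZ _ _ _ Ig).
  exact: (fourier_approxDZ c (L12_meas Lf) (FT_meas _ Lf) (L12_meas Lg) (FT_meas _ Lg)).
- move=> f_ f Lf_ Pf_ Lf cf.
  apply: (fourier_approx_closed _ _ (L12_meas Lf) (FT_meas _ Lf) Pf_ cf).
  + by move=> k; exact: (L12_meas (Lf_ k)).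
  + by move=> k; exact: (FT_meas _ (Lf_ k)).
  + exact: (E2_FTB_cvg (sqrN1) Lf_ Lf cf).
Qed.

(** Fourier inversion by explicit computation, the constants cancelling by [gaussk_fourier];
    [fourier_approx_iFT] extends it by density. *)
Lemma iFT_gaussn t b : 0 < t -> exists2 c : R[i], iFT (fun x => (gaussn t (x - b))%:C) =
  (fun x => c * gmod (4 * t)^-1 0 b x) & (fun x => (gaussn t (x - b))%:C) = FT (-1) (fun x => c * gmod (4 * t)^-1 0 b x).
Proof.
move=> t0; have t40 : 0 < (4 * t)^-1 by rewrite invr_gt0 mulr_gt0.
exists (((2 * pi) ^+ n)^-1 * gaussk n t)%:C; apply/funext => x.
- have -> : (fun x => (gaussn t (x - b))%:C) = gmod t b 0.
    by apply/funext => y; rewrite /gmod dotp0l expi0 mulr1.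
  rewrite /iFT FT_gmod// dotp0l expi0 mulr1 scale1r addr0 mul1r /gmod subr0 dotpC.
  by rewrite realCM !mulrA.
- rewrite (FTZ _ _ _ (cintegrable_gmod 0 b t40)) FT_gmod0// -realCM; congr (_%:C).
  have -> : (4 * (4 * t)^-1)^-1 = t by field; rewrite gt_eqF.
  have -> : gaussn t (-1 *: x + b) = gaussn t (x - b) by rewrite scaleN1r addrC -opprB gaussnN.
  rewrite mulrA -[_ * gaussk n _]mulrA gaussk_fourier// mulVf ?mul1r//.
  by rewrite expf_neq0// mulf_neq0// gt_eqF// pi_gt0.
Qed.

Lemma fourier_approx_iFT g : L12 g -> fourier_approx (iFT g) g.
Proof.
apply: (L12_ind (P := fun g => fourier_approx (iFT g) g)).
- move=> t b t0; have [c -> ->] := iFT_gaussn b t0.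
  apply: fourier_approx_refl.
  have t40 : 0 < (4 * t)^-1 by rewrite invr_gt0 mulr_gt0.
  have := modgaussDZ (c - 1) (modgauss_gmod 0 b t40) (modgauss_gmod 0 b t40).
  by congr modgauss; apply/funext => x; ring.
- move=> c f h Lf Lh Pf Ph; have [If _] := Lf; have [Ih _] := Lh.
  have -> : iFT (fun x => f x + c * h x) = fun x => iFT f x + c * iFT h x.
    by apply/funext => x; rewrite /iFT (FTD _ _ If (cintegrableZ c Ih)) (FTZ _ _ _ Ih); ring.
  exact: (fourier_approxDZ c (iFT_meas Lf) (L12_meas Lf) (iFT_meas Lh) (L12_meas Lh)).
- move=> f_ f Lf_ Pf_ Lf cf.
  apply: (fourier_approx_closed _ _ (iFT_meas Lf) (L12_meas Lf) Pf_ _ cf).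
  + by move=> k; exact: (iFT_meas (Lf_ k)).
  + by move=> k; exact: (L12_meas (Lf_ k)).
  + have := cvge0Z (normc ((((2 * pi) ^+ n)^-1)%:C) ^+ 2) (E2_FTB_cvg (expr1n R 2) Lf_ Lf cf).
    apply: le_cvge0 => k; first exact: E2_ge0.
    rewrite -(E2Z leb _ (cmeasB (FT_meas 1 (Lf_ k)) (FT_meas 1 Lf))).
    by under [leRHS]eq_integral do rewrite mulrBr.
Qed.

Lemma fourier_graph_iFT g : L12 g -> fourier_graph (iFT g) g.
Proof.
move=> Lg; apply: (fourier_approx_graph (L2_iFT Lg) (L12_L2 Lg)).
exact: fourier_approx_iFT.
Qed.

End fourier_L12.

(** * Completeness of L^2 *)

Section L2_complete.
Context {R : realType} d (T : measurableType d) (m : {measure set T -> \bar R}).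
Implicit Types f g : T -> R[i].

Lemma E2_eq0_ae f g : (\forall x \ae m, f x = g x) -> cmeas f -> cmeas g ->
  E2 m (fun x => f x - g x) = 0%E.
Proof.
move=> fg mf mg; rewrite (@E2_ae _ _ _ m _ (fun=> 0)).
- by rewrite /E2; under eq_integral do rewrite normc0 expr0n; rewrite integral0.
- exact: cmeasB.
- exact: cmeas_cst.
- by apply: filterS fg => x ->; rewrite subrr.
Qed.

Lemma cvg_expV2 (c : R) : c * (2 ^+ k)^-1 @[k --> \oo] --> (0 : R).
Proof.
under eq_fun do rewrite -exprVn.
by apply: cvg_geometric; rewrite ger0_norm// invf_lt1// ltr1n.
Qed.

(** Subtracting the tail bound [2 * c * (2 ^+ k)^-1] makes the sequence nondecreasing, so that it
    converges by monotonicity. *)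
Lemma fast_cauchy (a : nat -> R) (c : R) :
  (forall k, `|a k.+1 - a k| <= c * (2 ^+ k)^-1) ->
  a @ \oo --> limn a /\ forall k, `|limn a - a k| <= 2 * c * (2 ^+ k)^-1.
Proof.
move=> H.
have step k : (2 ^+ k.+1)^-1 = (2 ^+ k)^-1 / 2 :> R by rewrite exprSr invfM.
have tele k j : `|a (k + j)%N - a k| <= 2 * c * (2 ^+ k)^-1 - 2 * c * (2 ^+ (k + j))^-1.
  elim: j => [|j IH]; first by rewrite addn0 !subrr normr0.
  rewrite addnS; have := H (k + j)%N; move: IH; rewrite step.
  move: (a (k + j)%N) (a (k + j).+1) (a k) => x y z.
  move: ((2 ^+ (k + j))^-1) ((2 ^+ k)^-1) => p q; rewrite !ler_norml => /andP[? ?] /andP[? ?].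
  by apply/andP; split; lra.
have c0 : 0 <= c by have := le_trans (normr_ge0 _) (H 0%N); rewrite expr0 invr1 mulr1.
have cva : cvgn a.
  pose b k := a k - 2 * c * (2 ^+ k)^-1.
  have cb : cvgn b.
    apply: nondecreasing_is_cvgn.
      apply/nondecreasing_seqP => k; rewrite /b step; have := H k.
      by rewrite ler_norml => /andP[? ?]; lra.
    exists (a 0%N + 2 * c) => _ [k _ <-]; rewrite /b; have := tele 0%N k.
    have q0 : 0 <= c * (2 ^+ k)^-1 by rewrite mulr_ge0// invr_ge0 exprn_ge0.
    by rewrite add0n expr0 invr1 mulr1 ler_norml => /andP[? ?]; lra.
  have -> : a = (fun k => b k + 2 * c * (2 ^+ k)^-1) by apply/funext => k; rewrite /b subrK.
  by apply: is_cvgD; [exact: cb|apply/cvg_ex; exists 0; exact: cvg_expV2].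
split; first exact: cva.
move=> k.
have cvd : `|a j - a k| @[j --> \oo] --> `|limn a - a k|.
  by apply: cvg_norm; apply: cvgB; [exact: cva|exact: cvg_cst].
rewrite -(cvg_lim (@Rhausdorff R) cvd); apply: limr_le; first by apply/cvg_ex; eexists; exact: cvd.
exists k => // j /= kj; have := tele k (j - k)%N; rewrite subnKC// => /le_trans; apply.
by rewrite lerBlDr lerDl !mulr_ge0// invr_ge0 exprn_ge0.
Qed.

(** The Riesz-Fischer argument for a fast Cauchy sequence. The series [h] of the squared increments
    weighted by [4 ^+ k] has integral at most 1; where it is finite, the increments are at most the
    root of [h] divided by [2 ^+ k], hence summable. *)
Lemma L2_complete (u_ : nat -> T -> R[i]) : (forall k, cmeas (u_ k)) ->
  (forall k, E2 m (fun x => u_ k.+1 x - u_ k x)%R <= ((4 ^+ k)^-1 * (2 ^+ k.+1)^-1)%:E)%E ->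
  exists2 u, cmeas u & E2 m (fun x => u_ k x - u x) @[k --> \oo] --> 0%E.
Proof.
move=> mu Hu.
pose g k x := ((4 ^+ k * normc (u_ k.+1 x - u_ k x) ^+ 2)%:E : \bar R).
have g0 k x : (0 <= g k x)%E by rewrite lee_fin mulr_ge0 ?sqr_ge0// exprn_ge0.
have md k := measurable_normc2 (cmeasB (mu k.+1) (mu k)).
have mg k : measurable_fun setT (g k).
  have -> : g k = fun x => ((4 ^+ k)%:E * (normc (u_ k.+1 x - u_ k x) ^+ 2)%:E)%E by [].
  by apply: measurable_funeM; exact: md.
pose h x := (\sum_(k <oo) g k x)%E.
have mh : measurable_fun setT h by exact: ge0_emeasurable_sum.
have h0 x : (0 <= h x)%E by apply: nneseries_ge0.
have ih : (\int[m]_x h x <= 1)%E.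
  rewrite integral_nneseries//.
  apply: (@le_trans _ _ (\sum_(k <oo) (1 / (2 ^ (k + 0.+1))%:R : R)%:E)%E).
    apply: lee_nneseries => k _; first by move=> _; apply: integral_ge0.
    under eq_integral do rewrite /g EFinM.
    rewrite ge0_integralZl//; last by move=> x _; rewrite lee_fin sqr_ge0.
    apply: (@le_trans _ _ ((4 ^+ k)%:E * ((4 ^+ k)^-1 * (2 ^+ k.+1)^-1)%:E)%E).
      by rewrite lee_wpmul2l ?lee_fin ?exprn_ge0//; exact: Hu.
    by rewrite -EFinM lee_fin mulrA mulfV ?expf_neq0// addn1 natrX.
  have := @cvg_geometric_eseries_half R 1 0; rewrite expr0 divr1 => H.
  by rewrite (cvg_lim (@ereal_hausdorff R) H).
pose A := [set x | h x \is a fin_num].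
have hfin : \forall x \ae m, A x.
  have ih' : m.-integrable setT h.
    apply/integrableP; split => //; under eq_integral do rewrite gee0_abs//.
    exact: le_lt_trans ih (ltry _).
  by have := integrable_ae measurableT ih'; apply: filterS => x /(_ I).
have mA : measurable A by rewrite -[A]setTI; exact: emeasurable_fin_num.
pose c x : R := Num.sqrt (fine (h x)).
have dc k x : A x -> normc (u_ k.+1 x - u_ k x) <= c x * (2 ^+ k)^-1.
  move=> hx.
  have : (g k x <= h x)%E.
    rewrite /h; apply: le_trans (nneseries_lim_ge k.+1 _) => //.
    by rewrite big_nat_recr//= leeDr// sume_ge0.
  rewrite -[h x]fineK// lee_fin => H.
  rewrite ler_pdivlMr ?exprn_gt0// -(@ler_pXn2r _ 2)// ?nnegrE ?mulr_ge0 ?exprn_ge0 ?sqrtr_ge0 ?normc_ge0//.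
  rewrite sqr_sqrtr ?fine_ge0// exprMn -exprM mulnC exprM mulrC (_ : 2 ^+ 2 = 4)//.
  by rewrite expr2 -natrM.
(* Cutting off to [A], where [h] is finite, makes the limits exist at every point, so that [u] is
   measurable as a pointwise limit. *)
pose vr k x : R := \1_A x * complex.Re (u_ k x).
pose vi k x : R := \1_A x * complex.Im (u_ k x).
pose cA x := \1_A x * c x.
have i0 x : 0 <= \1_A x :> R by [].
have bound k x : \1_A x * normc (u_ k.+1 x - u_ k x) <= cA x * (2 ^+ k)^-1.
  rewrite -mulrA; have [Ax|nAx] := pselect (A x); last by rewrite indicE memNset// !mul0r.
  by rewrite ler_wpM2l// dc.
have [cvr br] : (forall x, vr k x @[k --> \oo] --> limn (vr^~ x)) /\
    forall x k, `|limn (vr^~ x) - vr k x| <= 2 * cA x * (2 ^+ k)^-1.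
  suff H x : vr^~ x @ \oo --> limn (vr^~ x) /\ forall k, `|limn (vr^~ x) - vr k x| <= 2 * cA x * (2 ^+ k)^-1.
    by split => x; have [] := H x.
  apply: fast_cauchy => k; apply: le_trans (bound k x).
  rewrite /vr -mulrBr normrM ger0_norm// ler_wpM2l//.
  by apply: le_trans (normr_Re_le _); case: (u_ k.+1 x) (u_ k x) => ? ? [].
have [cvi bi] : (forall x, vi k x @[k --> \oo] --> limn (vi^~ x)) /\
    forall x k, `|limn (vi^~ x) - vi k x| <= 2 * cA x * (2 ^+ k)^-1.
  suff H x : vi^~ x @ \oo --> limn (vi^~ x) /\ forall k, `|limn (vi^~ x) - vi k x| <= 2 * cA x * (2 ^+ k)^-1.
    by split => x; have [] := H x.
  apply: fast_cauchy => k; apply: le_trans (bound k x).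
  rewrite /vi -mulrBr normrM ger0_norm// ler_wpM2l//.
  by apply: le_trans (normr_Im_le _); case: (u_ k.+1 x) (u_ k x) => ? ? [].
have miA : measurable_fun setT (\1_A : T -> R) by exact: measurable_indic.
pose u x : R[i] := limn (vr^~ x) +i* limn (vi^~ x).
have mru : cmeas u.
  split.
  - apply: (measurable_fun_cvg (h := vr)) => [k|x _]; last exact: cvr.
    by apply: measurable_funM => //; case: (mu k).
  - apply: (measurable_fun_cvg (h := vi)) => [k|x _]; last exact: cvi.
    by apply: measurable_funM => //; case: (mu k).
exists u; first exact: mru.
(* The tails of the real and imaginary parts add up to at most [4 * c x * (2 ^+ k)^-1], whose square
   is at most [16 * (2 ^+ k)^-1 * h x]. *)
have key k : (E2 m (fun x => u_ k x - u x)%R <= (16 * (2 ^+ k)^-1)%:E)%E.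
  have p0 : 0 < (2 ^+ k)^-1 :> R by rewrite invr_gt0 exprn_gt0.
  have p1 : (2 ^+ k)^-1 <= 1 :> R by rewrite invf_le1 ?exprn_gt0// exprn_ege1// ler1n.
  apply: (@le_trans _ _ (\int[m]_x ((16 * (2 ^+ k)^-1)%:E * h x))%E).
    apply: ae_ge0_le_integral => //.
    - by move=> x _; rewrite lee_fin sqr_ge0.
    - by apply: measurable_normc2; exact: cmeasB.
    - by move=> x _; rewrite mule_ge0// lee_fin mulr_ge0// ltW.
    - exact: measurable_funeM.
    apply: filterS hfin => x Ax _.
    have iA : \1_A x = 1 :> R by rewrite indicE mem_set.
    have hx : h x = (c x ^+ 2)%:E by rewrite /c sqr_sqrtr ?fine_ge0// fineK.
    have c0 : 0 <= c x by exact: sqrtr_ge0.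
    rewrite hx -EFinM lee_fin.
    apply: (@le_trans _ _ ((4 * c x * (2 ^+ k)^-1) ^+ 2)).
      rewrite lerXn2r ?nnegrE ?normc_ge0//; first by rewrite !mulr_ge0// ltW.
      rewrite (le_trans (normc_le_ReIm _))//.
      have := br x k; have := bi x k; rewrite /cA iA mul1r.
      have -> : vr k x = complex.Re (u_ k x) by rewrite /vr iA mul1r.
      have -> : vi k x = complex.Im (u_ k x) by rewrite /vi iA mul1r.
      move=> Hi Hr.
      have -> : complex.Re (u_ k x - u x) = - (limn (vr^~ x) - complex.Re (u_ k x)) by rewrite opprB; case: (u_ k x).
      have -> : complex.Im (u_ k x - u x) = - (limn (vi^~ x) - complex.Im (u_ k x)) by rewrite opprB; case: (u_ k x).
      by rewrite !normrN; lra.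
    by rewrite !exprMn; move: p0 p1; move: ((2 ^+ k)^-1) => p p0 p1; nra.
  rewrite ge0_integralZl//.
  by rewrite -[leRHS]mule1 lee_wpmul2l// lee_fin mulr_ge0// ltW.
apply: (le_cvge0 (fun k => E2_ge0 _ _) key).
by apply: cvg_EFin; [exact: nearW|exact: cvg_expV2].
Qed.

End L2_complete.

Section E2_limits.
Context {R : realType} d (T : measurableType d) (m : {measure set T -> \bar R}).
Implicit Types f g h p q : T -> R[i].

Let le3 (X Y a b c : \bar R) : (0 <= a)%E -> (0 <= b)%E -> (0 <= c)%E ->
  (X <= 2%:E * a + 2%:E * Y)%E -> (Y <= 2%:E * b + 2%:E * c)%E -> (X <= 4%:E * (a + b + c))%E.
Proof.
move=> a0 b0 c0 H1 H2; apply: (le_trans H1).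
rewrite -addeA (ge0_muleDr _ a0 (adde_ge0 b0 c0)); apply: leeD.
  by rewrite lee_wpmul2r// lee_fin; lra.
apply: (@le_trans _ _ (2%:E * (2%:E * b + 2%:E * c))%E); first by rewrite lee_wpmul2l.
by rewrite -(ge0_muleDr _ b0 c0) muleA -EFinM (_ : 2 * 2 = 4 :> R)// -natrM.
Qed.

Let le5 (c : R) (X a b p q r : \bar R) : 0 <= c -> (0 <= a)%E -> (0 <= b)%E ->
  (0 <= p)%E -> (0 <= q)%E -> (0 <= r)%E -> (X <= c%:E * (4%:E * (p + q + r)))%E ->
  (4%:E * (a + X + b) <= 4%:E * (a + b) + (16 * c)%:E * (p + r) + (16 * c)%:E * q)%E.
Proof.
move=> c0 a0 b0 p0 q0 r0 HX.
have Y0 : (0 <= c%:E * (4%:E * (p + q + r)))%E by rewrite !mule_ge0// !adde_ge0.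
apply: (@le_trans _ _ (4%:E * ((a + b) + c%:E * (4%:E * (p + q + r))))%E).
  by rewrite lee_wpmul2l// addeAC leeD2l.
rewrite (ge0_muleDr _ (adde_ge0 a0 b0) Y0) -[leRHS]addeA; apply: leeD => //.
rewrite !muleA -!EFinM (_ : 4 * c * 4 = 16 * c :> R); last by ring.
by rewrite -(ge0_muleDr _ (adde_ge0 p0 r0) q0) addeAC.
Qed.

Lemma E2_dist3 f g h p : cmeas f -> cmeas g -> cmeas h -> cmeas p ->
  (E2 m (fun x => f x - p x)%R <=
   4%:E * (E2 m (fun x => f x - g x)%R + E2 m (fun x => g x - h x)%R + E2 m (fun x => h x - p x)%R))%E.
Proof.
move=> mf mg mh mp.
exact: (le3 (E2_ge0 _ _) (E2_ge0 _ _) (E2_ge0 _ _) (E2_dist m mf mg mp) (E2_dist m mg mh mp)).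
Qed.

(** The triangle inequality for squares costs a factor 4 on either side, whence the 16. The loss is
    harmless, because the inequality serves to see that one side vanishes with the other. *)
Lemma E2_limit_le (f_ g_ p_ q_ : nat -> T -> R[i]) f g p q (c : R) : 0 <= c ->
  (forall k, [/\ cmeas (f_ k), cmeas (g_ k), cmeas (p_ k) & cmeas (q_ k)]) ->
  [/\ cmeas f, cmeas g, cmeas p & cmeas q] ->
  E2 m (fun x => f_ k x - f x) @[k --> \oo] --> 0%E -> E2 m (fun x => g_ k x - g x) @[k --> \oo] --> 0%E ->
  E2 m (fun x => p_ k x - p x) @[k --> \oo] --> 0%E -> E2 m (fun x => q_ k x - q x) @[k --> \oo] --> 0%E ->
  (forall k, E2 m (fun x => f_ k x - g_ k x)%R <= c%:E * E2 m (fun x => p_ k x - q_ k x)%R)%E ->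
  (E2 m (fun x => f x - g x)%R <= (16 * c)%:E * E2 m (fun x => p x - q x)%R)%E.
Proof.
move=> c0 M [mf mg mp mq] cf cg cp cq H.
pose t k := (4%:E * (E2 m (fun x => f_ k x - f x)%R + E2 m (fun x => g_ k x - g x)%R) +
  (16 * c)%:E * (E2 m (fun x => p_ k x - p x)%R + E2 m (fun x => q_ k x - q x)%R))%E.
have t0 : t @ \oo --> 0%E by apply: cvge0D; apply: cvge0Z; exact: cvge0D.
have key k : (E2 m (fun x => f x - g x)%R <= t k + (16 * c)%:E * E2 m (fun x => p x - q x)%R)%E.
  have [mfk mgk mpk mqk] := M k.
  apply: (le_trans (E2_dist3 mf mfk mgk mg)); rewrite (E2BC m f) /t.
  apply: (le5 c0); try exact: E2_ge0.
  apply: (le_trans (H k)); rewrite lee_wpmul2l ?lee_fin//.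
  by rewrite (E2BC m (q_ k)) (E2BC m q) (E2BC m (q_ k)); exact: E2_dist3.
apply/lee_addgt0Pr => e e0.
have tge0 : forall k, (0 <= t k)%E by move=> k; apply: adde_ge0; apply: mule_ge0; rewrite ?lee_fin ?mulr_ge0//; apply: adde_ge0; exact: E2_ge0.
have [N _ /(_ N (leqnn N))/= tN] := (cvge0P tge0).1 t0 e e0.
by apply: (le_trans (key N)); rewrite addeC leeD2l// ltW.
Qed.

Lemma integrable_normc2 f : cmeas f -> (E2 m f < +oo)%E ->
  m.-integrable setT (fun x => (normc (f x) ^+ 2)%:E).
Proof.
move=> mf f2; apply/(ge0_integrableP m) => [|x|]; last exact: f2.
- by apply: measurable_funX; exact: measurable_normc.
- by rewrite sqr_ge0.
Qed.

Lemma cmeas_indicM (A : set T) f : measurable A -> cmeas f -> cmeas (fun x => (\1_A x : R)%:C * f x).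
Proof. by move=> mA mf; apply: cmeasM => //; apply: cmeas_real; exact: measurable_indic. Qed.

End E2_limits.

(** * Plancherel's theorem *)

Section plancherel.
Variables (R : realType) (n : nat).
Local Notation V := (Rn R n).
Local Notation leb := (@leb R n).
Local Notation C := ((2 * pi) ^+ n : R).
Implicit Types u v f g w z y : V -> R[i].

Lemma pi2n_gt0 : 0 < C.
Proof. by rewrite exprn_gt0// mulr_gt0// pi_gt0. Qed.

Lemma cint_mul_conj f : cint leb (fun x => f x * conjc (f x)) = (fine (E2 leb f))%:C.
Proof.
rewrite (eq_cint leb (g := fun x => (normc (f x) ^+ 2)%:C)); first by rewrite cint_real.
by move=> x; rewrite mulc_conj.
Qed.

Lemma fourier_graph_seq u v : fourier_graph u v -> exists w : nat -> V -> R[i],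
  [/\ forall k, L12 (w k), E2 leb (fun x => w k x - u x) @[k --> \oo] --> 0%E &
      E2 leb (fun x => FT (-1) (w k) x - v x) @[k --> \oo] --> 0%E].
Proof.
move=> [_ _ [w [Sw wu wv]]]; exists w; split.
- by move=> k; exact: schwartz_integrable (Sw k).
- by move/L2norm_cvg0 : wu.
- have -> : (fun k => E2 leb (fun x => FT (-1) (w k) x - v x)) = (fun k => E2 leb (fourier_schwartz (w k) - v)).
    by apply/funext => k; rewrite fourier_schwartzE.
  exact/L2norm_cvg0.
Qed.

(* Approximate [iFT y] by functions [w k] such that [FT (-1) (w k)] tends to [y],
   and apply [FT_swap]. *)
Lemma parseval z y : L12 z -> L12 y ->
  cint leb (fun x => z x * y x) = cint leb (fun x => FT (-1) z x * iFT y x).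
Proof.
move=> Lz Ly; have [Iz z2] := Lz; have mz := L12_meas Lz.
have [w [Lw wu wv]] := fourier_graph_seq (fourier_graph_iFT Ly).
have /L2P[mF F2] := L2_FT (sqrN1 R) Lz.
have /L2P[mI I2] := L2_iFT Ly.
have mw k := L12_meas (Lw k).
have mFw k := FT_meas (-1) (Lw k).
have ca := cintM_cvg0 mz (fun k => cmeasB (mFw k) (L12_meas Ly)) z2 wv.
have cb := cintM_cvg0 mF (fun k => cmeasB (mw k) mI) F2 wu.
set D := cint leb (fun x => z x * y x) - cint leb (fun x => FT (-1) z x * iFT y x).
have HD k : normc D <= normc (cint leb (fun x => z x * (FT (-1) (w k) x - y x))) +
    normc (cint leb (fun x => FT (-1) z x * (w k x - iFT y x))).
  have [_ w2] := Lw k; have /L2P[_ Fw2] := L2_FT (sqrN1 R) (Lw k); have [_ y2] := Ly.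
  have E1 : cint leb (fun x => z x * (FT (-1) (w k) x - y x)) =
      cint leb (fun x => z x * FT (-1) (w k) x) - cint leb (fun x => z x * y x).
    rewrite -(cintB (normcM_lty mz (mFw k) z2 Fw2) (normcM_lty mz (L12_meas Ly) z2 y2)).
    by apply: eq_cint => x; rewrite mulrBr.
  have E3 : cint leb (fun x => FT (-1) z x * (w k x - iFT y x)) =
      cint leb (fun x => FT (-1) z x * w k x) - cint leb (fun x => FT (-1) z x * iFT y x).
    rewrite -(cintB (normcM_lty mF (mw k) F2 w2) (normcM_lty mF mI F2 I2)).
    by apply: eq_cint => x; rewrite mulrBr.
  have E4 : cint leb (fun x => FT (-1) z x * w k x) = cint leb (fun x => z x * FT (-1) (w k) x).
    have [Iw _] := Lw k; rewrite (FT_swap (-1) Iz Iw).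
    by apply: eq_cint => x; rewrite mulrC.
  rewrite E1 E3 E4 /D.
  move: (cint _ _) (cint _ _) (cint _ _) => p q r.
  have -> : r - q = (p - q) - (p - r) by ring.
  by rewrite [leRHS]addrC; apply: le_trans (ler_normcD _ 0 _) _; rewrite subr0 sub0r normcN addrC.
have D0 : D = 0.
  apply/eq0_normc/le_anti; rewrite normc_ge0 andbT.
  pose ab k := normc (cint leb (fun x => z x * (FT (-1) (w k) x - y x))) +
    normc (cint leb (fun x => FT (-1) z x * (w k x - iFT y x))).
  have cab : ab k @[k --> \oo] --> (0 : R) by rewrite -[X in _ --> X](addr0 0); apply: cvgD; [exact: ca|exact: cb].
  rewrite -(cvg_lim (@Rhausdorff R) cab); apply: limr_ge; first by apply/cvg_ex; eexists; exact: cab.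
  by apply: nearW => k; exact: HD.
exact: subr0_eq D0.
Qed.

(** This is [parseval] for the conjugate of [z], whose [iFT] is the conjugate of [FT (-1) z] divided
    by [(2 * pi) ^+ n]. *)
Lemma plancherel z : L12 z -> E2 leb (FT (-1) z) = (C%:E * E2 leb z)%E.
Proof.
move=> Lz; have [Iz z2] := Lz; have mz := L12_meas Lz.
have Ly : L12 (fun x => conjc (z x)) by split; [exact: cintegrable_conj|rewrite E2_conj].
have /L2P[mF F2] := L2_FT (sqrN1 R) Lz.
have := parseval Lz Ly; rewrite cint_mul_conj.
have -> : cint leb (fun x => FT (-1) z x * iFT (fun x => conjc (z x)) x) = (C^-1 * fine (E2 leb (FT (-1) z)))%:C.
  rewrite realCM -cint_mul_conj -(cintZ _ (normcM_lty mF (cmeas_conj mF) F2 _)); last by rewrite E2_conj.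
  apply: eq_cint => x; rewrite /iFT (FT_conj _ _ Iz) mulrCA; congr (_ * (_ * _)).
move=> /(congr1 (@complex.Re R))/= H.
rewrite -[LHS]fineK; last by rewrite ge0_fin_numE ?E2_ge0.
rewrite -[E2 leb z]fineK; last by rewrite ge0_fin_numE ?E2_ge0.
by rewrite -EFinM H mulrA mulfV ?mul1r// gt_eqF// pi2n_gt0.
Qed.

Lemma plancherelB f g : L12 f -> L12 g ->
  E2 leb (fun x => FT (-1) f x - FT (-1) g x) = (C%:E * E2 leb (fun x => f x - g x)%R)%E.
Proof.
move=> Lf Lg; rewrite -(plancherel (L12B Lf Lg)); have [If _] := Lf; have [Ig _] := Lg.
by congr E2; apply/funext => x; rewrite FTB.
Qed.

Lemma L2_meas f : L2 f -> cmeas f. Proof. by case. Qed.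

Lemma fourier_graph_le u v u' v' : fourier_graph u v -> fourier_graph u' v' ->
  (E2 leb (fun x => v x - v' x)%R <= (16 * C)%:E * E2 leb (fun x => u x - u' x)%R)%E /\
  (E2 leb (fun x => u x - u' x)%R <= (16 * C^-1)%:E * E2 leb (fun x => v x - v' x)%R)%E.
Proof.
move=> G G'; have [w [Lw wu wv]] := fourier_graph_seq G; have [w' [Lw' wu' wv']] := fourier_graph_seq G'.
have [/L2_meas mu /L2_meas mv _] := G; have [/L2_meas mu' /L2_meas mv' _] := G'.
have C0 := pi2n_gt0.
have mw k := L12_meas (Lw k); have mFw k := FT_meas (-1) (Lw k).
have mw' k := L12_meas (Lw' k); have mFw' k := FT_meas (-1) (Lw' k).
split.
- apply: (E2_limit_le (ltW C0) _ _ wv wv' wu wu') => //.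
  by move=> k; rewrite plancherelB.
- apply: (E2_limit_le _ _ _ wu wu' wv wv') => //; first by rewrite invr_ge0 ltW.
  by move=> k; rewrite plancherelB// muleA -EFinM mulVf ?mul1e// gt_eqF.
Qed.

Lemma E2B_eq0_ae f g : cmeas f -> cmeas g -> E2 leb (fun x => f x - g x) = 0%E ->
  \forall x \ae leb, f x = g x.
Proof. by move=> mf mg /(E2_eq0 (cmeasB mf mg)); apply: filterS => x /subr0_eq. Qed.

(** Makes statements up to null sets independent of the representatives that [fourier] and
    [inv_fourier] select. *)
Lemma fourier_graph_uniq u v u' v' : fourier_graph u v -> fourier_graph u' v' ->
  (\forall x \ae leb, u x = u' x) <-> (\forall x \ae leb, v x = v' x).
Proof.
move=> G G'; have [H1 H2] := fourier_graph_le G G'.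
have [/L2_meas mu /L2_meas mv _] := G; have [/L2_meas mu' /L2_meas mv' _] := G'.
split=> E; apply: E2B_eq0_ae => //; apply/le_anti; rewrite E2_ge0 andbT.
- by move: H1; rewrite (E2_eq0_ae E)// mule0.
- by move: H2; rewrite (E2_eq0_ae E)// mule0.
Qed.

Lemma L2_approx f (e : R) : L2 f -> 0 < e -> exists2 g, L12 g & (E2 leb (fun x => g x - f x)%R < e%:E)%E.
Proof.
move=> /L2P[mf f2] e0.
(* Truncation in height and in space at once: on [A k], [normc (f x)] is at most
   [k.+1%:R ^+ 2 * gaussn 1 x], which is integrable and square integrable. *)
pose A k := [set x : V | normc (f x) <= k.+1%:R] `&` [set x : V | k.+1%:R^-1 <= gaussn 1 x].
have mA k : measurable (A k).
  apply: measurableI.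
  - have := measurable_normc mf measurableT (measurable_itv `]-oo, k.+1%:R]); rewrite setTI.
    by congr measurable; apply/seteqP; split => x /=; rewrite in_itv.
  - have := @measurable_gaussn R n 1 measurableT _ (measurable_itv `[k.+1%:R^-1, +oo[); rewrite setTI.
    by congr measurable; apply/seteqP; split => x /=; rewrite in_itv/= andbT.
pose g k x := (\1_(A k) x : R)%:C * f x.
have mg k : cmeas (g k) := cmeas_indicM (mA k) mf.
have gE1 k x : A k x -> g k x = f x.
  have i1 : A k x -> \1_(A k) x = 1 :> R by move=> Ax; rewrite indicE mem_set.
  by move=> /i1 E; apply: eq_ReIm; rewrite /g E ?ReZ ?ImZ ?mul1r ?mul0r.
have gE0 k x : ~ A k x -> g k x = 0.
  have i1 : ~ A k x -> \1_(A k) x = 0 :> R by move=> Ax; rewrite indicE memNset.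
  by move=> /i1 E; apply: eq_ReIm; rewrite /g E ?ReZ ?ImZ ?mul1r ?mul0r.
have ng k x : normc (g k x) = \1_(A k) x * normc (f x) by rewrite /g normcM normc_indic.
have Lg k : L12 (g k).
  apply: (L12_le (mg k) (L12Z (k.+1%:R ^+ 2 : R)%:C (L12_gaussn 0 ltr01))) => x.
  rewrite ng normcM !normc_real !ger0_norm ?gaussn_ge0 ?exprn_ge0// subr0 indicE.
  case: (boolP (x \in A k)) => [/set_mem[/= fx gx]|_]; last by rewrite mul0r mulr_ge0 ?gaussn_ge0// exprn_ge0.
  rewrite mul1r (le_trans fx)// expr2 -mulrA ler_peMr//.
  by rewrite mulrC -ler_pdivrMr// mul1r.
have cg : E2 leb (fun x => g k x - f x) @[k --> \oo] --> 0%E.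
  apply: (@E2_cvg_dominated _ _ _ leb g f (fun x => normc (f x)) mg mf).
  - exact: (integrable_normc2 mf f2).
  - apply: aeW => x; apply: cvg_near_cst.
    exists (maxn (Num.bound (normc (f x))) (Num.bound (gaussn 1 x)^-1)) => // k /=.
    rewrite geq_max => /andP[k1 k2].
    rewrite gE1 ?subrr ?normc0//; split => /=.
      rewrite ltW// (lt_le_trans (archi_boundP (normc_ge0 _)))// ler_nat.
      exact: leqW.
    rewrite -[leRHS]invrK lef_pV2 ?posrE ?invr_gt0 ?gaussn_gt0//.
    by rewrite ltW// (lt_le_trans (archi_boundP _)) ?invr_ge0 ?gaussn_ge0// ler_nat leqW.
  - apply: aeW => x k; have [Ax|Ax] := pselect (A k x).
      by rewrite gE1// subrr normc0 normc_ge0.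
    by rewrite gE0// sub0r normcN.
move/(cvge0P (fun k => E2_ge0 _ _)) : cg => /(_ e e0)[N _ /(_ N (leqnn N))/= HN].
by exists (g N).
Qed.

(** Extension by continuity, in the generality needed for [FT (-1)] and for [iFT]: the former makes
    the graph total, the latter makes it onto. *)
Lemma L2_extension (A : (V -> R[i]) -> (V -> R[i])) (c : R) f : 0 < c ->
  (forall g, L12 g -> cmeas (A g)) ->
  (forall g h, L12 g -> L12 h -> (E2 leb (fun x => A g x - A h x)%R <= c%:E * E2 leb (fun x => g x - h x)%R)%E) ->
  (forall g, L12 g -> E2 leb (A g) < +oo)%E ->
  L2 f -> exists g_ : nat -> V -> R[i], exists u, [/\ forall k, L12 (g_ k), L2 u,
    E2 leb (fun x => g_ k x - f x) @[k --> \oo] --> 0%E & E2 leb (fun x => A (g_ k) x - u x) @[k --> \oo] --> 0%E].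
Proof.
move=> c0 mA HA A2 Lf; have mf := L2_meas Lf.
(* The increments of [g] are at most [4 * d k] in [E2], and [d k] is so small that those of
   [A (g k)] satisfy the hypothesis of [L2_complete]. *)
pose d k : R := (4 * (1 + c))^-1 * ((4 ^+ k)^-1 * (2 ^+ k.+1)^-1).
have c10 : 0 < 4 * (1 + c) by rewrite mulr_gt0// addr_gt0.
have d0 k : 0 < d k by rewrite !mulr_gt0// invr_gt0// exprn_gt0.
have /choice[g Hg] : forall k, exists g, L12 g /\ (E2 leb (fun x => g x - f x)%R < (d k)%:E)%E.
  by move=> k; have [g Lg Hg] := L2_approx Lf (d0 k); exists g.
have Lg k : L12 (g k) by have [] := Hg k.
have dS k : d k.+1 <= d k.
  have -> : d k.+1 = d k / 8.
    by rewrite /d !exprS; field; rewrite !expf_neq0// gt_eqF// addr_gt0.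
  by have := d0 k; lra.
have fast k : (E2 leb (fun x => A (g k.+1) x - A (g k) x)%R <= ((4 ^+ k)^-1 * (2 ^+ k.+1)^-1)%:E)%E.
  apply: (le_trans (HA _ _ (Lg k.+1) (Lg k))).
  apply: (@le_trans _ _ (c%:E * (4 * d k)%:E)%E).
    rewrite lee_wpmul2l ?lee_fin ?(ltW c0)//.
    apply: (le_trans (E2_dist leb (L12_meas (Lg k.+1)) mf (L12_meas (Lg k)))).
    rewrite (E2BC leb f); have [_ h1] := Hg k.+1; have [_ h2] := Hg k.
    have -> : (4 * d k)%:E = (2%:E * (d k)%:E + 2%:E * (d k)%:E)%E.
      by rewrite -!EFinM -EFinD; congr (_%:E); ring.
    apply: leeD; rewrite lee_wpmul2l//; last exact: ltW.
    by apply: (le_trans (ltW h1)); rewrite lee_fin.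
  rewrite -EFinM lee_fin /d.
  have : 0 <= (4 ^+ k)^-1 * (2 ^+ k.+1)^-1 :> R by rewrite mulr_ge0// invr_ge0 exprn_ge0.
  move: ((4 ^+ k)^-1 * (2 ^+ k.+1)^-1) => q q0; rewrite !mulrA ler_piMl// ler_pdivrMr// mul1r.
  by lra.
have [u mu cu] := L2_complete (fun k => mA _ (Lg k)) fast.
exists g, u; split => //.
- apply/L2P; split => //.
  move/(cvge0P (fun k => E2_ge0 _ _)) : cu => /(_ 1 ltr01)[N _ /(_ N (leqnn N))/= HN].
  have -> : u = fun x => A (g N) x - (A (g N) x - u x) by apply/funext => x; ring.
  apply: (le_lt_trans (E2B leb (mA _ (Lg N)) (cmeasB (mA _ (Lg N)) mu))).
  rewrite lte_add_pinfty// lte_mul_pinfty//; first exact: A2.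
  exact: (lt_trans HN (ltry _)).
- apply: (le_cvge0 (v := fun k => (1 * (2 ^+ k)^-1)%:E) (fun k => E2_ge0 _ _)) => [k|]; last first.
    by apply: cvg_EFin; [exact: nearW|exact: cvg_expV2].
  have [_ /ltW/le_trans] := Hg k; apply; rewrite lee_fin /d.
  have h4 : (4 ^+ k)^-1 <= 1 :> R by rewrite invf_le1 ?exprn_gt0// exprn_ege1// ler1n.
  have h40 : 0 <= (4 ^+ k)^-1 :> R by rewrite invr_ge0 exprn_ge0.
  have hc : (4 * (1 + c))^-1 <= 1 by rewrite invf_le1//; lra.
  have hc0 : 0 <= (4 * (1 + c))^-1 by rewrite invr_ge0 ltW.
  rewrite ler_pM// ?mulr_ge0 ?invr_ge0 ?exprn_ge0 ?(ltW c10)//.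
  rewrite exprS invfM -[leRHS]mul1r mulrA ler_pM ?mulr_ge0 ?invr_ge0 ?exprn_ge0//.
  by rewrite mulr_ile1// ?invr_ge0// invf_le1// ler1n.
Qed.

Lemma fourier_graph_total u : L2 u -> exists v, fourier_graph u v.
Proof.
move=> Lu; have s1 := sqrN1 R.
have H2 g : L12 g -> (E2 leb (FT (-1) g) < +oo)%E by move=> Lg; have /L2P[] := L2_FT s1 Lg.
have [g [v [Lg Lv cg cv]]] := L2_extension pi2n_gt0 (fun g Lg => FT_meas (-1) Lg)
  (fun g h Lg Lh => E2_FTB_le s1 Lg Lh) H2 Lu.
exists v; apply: (fourier_approx_graph Lu Lv).
apply: (fourier_approx_closed _ _ (L2_meas Lu) (L2_meas Lv) _ cg cv) => k.
- exact: (L12_meas (Lg k)).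
- exact: (FT_meas _ (Lg k)).
- exact: fourier_approx_FT.
Qed.

Lemma E2_iFTB_le g h : L12 g -> L12 h ->
  (E2 leb (fun x => iFT g x - iFT h x)%R <= C^-1%:E * E2 leb (fun x => g x - h x)%R)%E.
Proof.
move=> Lg Lh; have C0 := pi2n_gt0.
have -> : (fun x => iFT g x - iFT h x) = fun x => (C^-1)%:C * (FT 1 g x - FT 1 h x).
  by apply/funext => x; rewrite /iFT mulrBr.
rewrite (E2Z leb _ (cmeasB (FT_meas 1 Lg) (FT_meas 1 Lh))) normc_real ger0_norm ?invr_ge0 ?(ltW C0)//.
apply: (@le_trans _ _ ((C^-1 ^+ 2)%:E * (C%:E * E2 leb (fun x => g x - h x)%R))%E).
  by rewrite lee_wpmul2l ?lee_fin ?sqr_ge0//; apply: E2_FTB_le => //; rewrite expr1n.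
by rewrite muleA -EFinM expr2 -mulrA mulVf ?mulr1// gt_eqF.
Qed.

Lemma fourier_graph_onto v : L2 v -> exists u, fourier_graph u v.
Proof.
move=> Lv; have C0 : 0 < C^-1 by rewrite invr_gt0 pi2n_gt0.
have H2 g : L12 g -> (E2 leb (iFT g) < +oo)%E by move=> Lg; have /L2P[] := L2_iFT Lg.
have [g [u [Lg Lu cg cu]]] := L2_extension C0 (fun g Lg => iFT_meas Lg) E2_iFTB_le H2 Lv.
exists u; apply: (fourier_approx_graph Lu Lv).
apply: (fourier_approx_closed _ _ (L2_meas Lu) (L2_meas Lv) _ cu cg) => k.
- exact: (iFT_meas (Lg k)).
- exact: (L12_meas (Lg k)).
- exact: fourier_approx_iFT.
Qed.

Lemma fourierP u : L2 u -> fourier_graph u (fourier u).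
Proof. by move=> /fourier_graph_total[v Gv]; exact: (@xgetPex _ 0 [set v | fourier_graph u v]) (ex_intro _ v Gv). Qed.

Lemma inv_fourierP v : L2 v -> fourier_graph (inv_fourier v) v.
Proof. by move=> /fourier_graph_onto[u Gu]; exact: (@xgetPex _ 0 [set u | fourier_graph u v]) (ex_intro _ u Gu). Qed.

Lemma fourier_graph_approx u v : fourier_graph u v -> fourier_approx u v.
Proof.
move=> G; have [w [Lw wu wv]] := fourier_graph_seq G; have [/L2_meas mu /L2_meas mv _] := G.
apply: (fourier_approx_closed _ _ mu mv _ wu wv) => k.
- exact: (L12_meas (Lw k)).
- exact: (FT_meas _ (Lw k)).
- exact: (fourier_approx_FT (Lw k)).
Qed.

Lemma L2DZ c f g : L2 f -> L2 g -> L2 (fun x => f x + c * g x).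
Proof.
move=> /L2P[mf f2] /L2P[mg g2]; have mcg : cmeas (fun x => c * g x) by apply: cmeasM mg; exact: cmeas_cst.
apply/L2P; split; first exact: cmeasD.
apply: (le_lt_trans (E2D leb mf mcg)); rewrite (E2Z leb c mg).
by rewrite lte_add_pinfty// !lte_mul_pinfty ?lee_fin ?sqr_ge0 ?mule_ge0 ?E2_ge0 ?lee_fin ?sqr_ge0.
Qed.

Lemma fourier_graphDZ c u v u' v' : fourier_graph u v -> fourier_graph u' v' ->
  fourier_graph (fun x => u x + c * u' x) (fun x => v x + c * v' x).
Proof.
move=> G G'; have [Lu Lv _] := G; have [Lu' Lv' _] := G'.
apply: fourier_approx_graph; [exact: L2DZ|exact: L2DZ|].
by apply: fourier_approxDZ; try exact: L2_meas; exact: fourier_graph_approx.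
Qed.

End plancherel.

(** * Multipliers and Wiener-Hopf operators *)

Lemma le_E2_ae (R : realType) d (T : measurableType d) (m : {measure set T -> \bar R}) (f g : T -> R[i]) :
  cmeas f -> cmeas g -> (\forall x \ae m, normc (f x) <= normc (g x)) -> (E2 m f <= E2 m g)%E.
Proof.
move=> mf mg fg; apply: ae_ge0_le_integral => //.
- by move=> x _; rewrite lee_fin sqr_ge0.
- exact: (measurable_normc2 mf).
- by move=> x _; rewrite lee_fin sqr_ge0.
- exact: (measurable_normc2 mg).
by apply: filterS fg => x fgx _; rewrite lee_fin lerXn2r ?nnegrE ?normc_ge0.
Qed.

Section multiplier.
Variables (R : realType) (n : nat).
Local Notation V := (Rn R n).
Local Notation leb := (@leb R n).
Implicit Types a u v f g : V -> R[i].
Hypothesis leb_gt0 : (0 < leb setT)%E.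

Lemma Linf_norm_le a (k : R) : (\forall x \ae leb, normc (a x) <= k) -> (Linf_norm a <= k%:E)%E.
Proof.
(* For the exponent [+oo], the norm is the essential supremum on a space of positive measure, and 0
   otherwise. *)
move=> ak; rewrite /Linf_norm unlock leb_gt0; apply/ess_supP; apply: filterS ak => x.
by rewrite /= ger0_norm ?normc_ge0// lee_fin.
Qed.

Lemma Linf_norm_ae a : Linf a -> exists2 M : R, 0 <= M & \forall x \ae leb, normc (a x) <= M.
Proof.
move=> [_ aoo]; exists `|fine (Linf_norm a)|; first by [].
have : \forall x \ae leb, ((normc (a x))%:E <= Linf_norm a)%E.
  have := ess_sup_ge leb (abse \o absC a); rewrite /Linf_norm unlock leb_gt0.
  by apply: filterS => x /=; rewrite ger0_norm ?normc_ge0.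
apply: filterS => x H; apply: le_trans (ler_norm _); rewrite -lee_fin fineK//.
rewrite ge0_fin_numE//; apply: le_trans H; rewrite lee_fin; exact: normc_ge0.
Qed.

Lemma L2_mul a f : Linf a -> L2 f -> L2 (fun x => a x * f x).
Proof.
move=> La /L2P[mf f2]; have [M M0 aM] := Linf_norm_ae La; have [ma _] := La.
have ma' : cmeas a := ma.
have mMf : cmeas (fun x => M%:C * f x) by apply: cmeasM mf; exact: cmeas_cst.
apply/L2P; split; first exact: cmeasM.
apply: (@le_lt_trans _ _ (E2 leb (fun x => M%:C * f x))).
  apply: (le_E2_ae (cmeasM ma' mf) mMf); apply: filterS aM => x ax.
  by rewrite !normcM normc_real ger0_norm// ler_wpM2r ?normc_ge0.
by rewrite (E2Z leb _ mf) lte_mul_pinfty ?lee_fin ?sqr_ge0.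
Qed.

Variable a : V -> R[i].
Hypothesis La : Linf a.

Lemma multiplier_graph u : L2 u -> fourier_graph (fourier_multiplier a u) (fun x => a x * fourier u x).
Proof. by move=> Lu; have [_ Lf _] := fourierP Lu; exact: (inv_fourierP (L2_mul La Lf)). Qed.

Lemma L2_multiplier u : L2 u -> L2 (fourier_multiplier a u).
Proof. by move=> /multiplier_graph[]. Qed.

Lemma multiplierDZ c u v : L2 u -> L2 v -> \forall x \ae leb,
  fourier_multiplier a (fun x => u x + c * v x) x = fourier_multiplier a u x + c * fourier_multiplier a v x.
Proof.
move=> Lu Lv; have G := multiplier_graph (L2DZ c Lu Lv).
have G' := fourier_graphDZ c (multiplier_graph Lu) (multiplier_graph Lv).
apply/(fourier_graph_uniq G G').
have := (fourier_graph_uniq (fourierP (L2DZ c Lu Lv)) (fourier_graphDZ c (fourierP Lu) (fourierP Lv))).1 _.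
move=> /(_ (aeW _ (fun=> erefl))); apply: filterS => x ->; ring.
Qed.

(** Where [(a - c) * g] is integrable, the multiplier minus [c] is an absolutely convergent
    integral: this is what allows pointwise bounds in place of norm bounds. *)
Lemma multiplier_iFT c g : L12 g -> L12 (fun x => (a x - c) * g x) ->
  \forall x \ae leb, fourier_multiplier a (iFT g) x - c * iFT g x = iFT (fun y => (a y - c) * g y) x.
Proof.
move=> Lg Lag; have Gg := fourier_graph_iFT Lg.
have G := fourier_graphDZ (- c) (multiplier_graph (L2_iFT Lg)) Gg.
have H := (fourier_graph_uniq G (fourier_graph_iFT Lag)).2.
have E := (fourier_graph_uniq (fourierP (L2_iFT Lg)) Gg).1 (aeW _ (fun=> erefl)).
have {}E : \forall x \ae leb, a x * fourier (iFT g) x + - c * g x = (a x - c) * g x.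
  by apply: filterS E => x ->; rewrite mulrBl mulNr.
by apply: filterS (H E) => x <-; rewrite mulNr.
Qed.

End multiplier.

Lemma lee_div_mul (R : realType) (x y s : \bar R) : (0 < y)%E -> y \is a fin_num ->
  (x / y <= s)%E = (x <= s * y)%E.
Proof.
case: y => // r; rewrite lte_fin => r0 _; rewrite inver gt_eqF//.
by rewrite lee_pdivrMr.
Qed.

Section normX.
Variables (R : realType) (n : nat).
Local Notation V := (Rn R n).
Local Notation leb := (@leb R n).
Variables (rho : (V -> \bar R) -> \bar R).
Hypothesis hrho : banach_function_norm rho.
Implicit Types f g : V -> R[i].

Lemma Mplus_absC f : cmeas f -> Mplus (absC f).
Proof.
move=> mf; split; first by apply/measurable_EFinP; exact: measurable_normc.
by move=> x; rewrite lee_fin normc_ge0.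
Qed.

Lemma normX_ge0 f : cmeas f -> (0 <= normX rho f)%E.
Proof. by move=> mf; apply: (bfn_ge0 hrho); exact: Mplus_absC. Qed.

Lemma normX_le f g : cmeas f -> cmeas g -> (\forall x \ae leb, normc (f x) <= normc (g x)) ->
  (normX rho f <= normX rho g)%E.
Proof.
move=> mf mg fg; apply: (bfn_le hrho); [exact: Mplus_absC|exact: Mplus_absC|].
by apply: filterS fg => x; rewrite lee_fin.
Qed.

Lemma normX_ae f g : cmeas f -> cmeas g -> (\forall x \ae leb, f x = g x) ->
  normX rho f = normX rho g.
Proof. by move=> mf mg fg; apply/le_anti/andP; split; apply: normX_le => //; apply: filterS fg => x ->. Qed.

Lemma normXD f g : cmeas f -> cmeas g ->
  (normX rho (fun x => f x + g x)%R <= normX rho f + normX rho g)%E.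
Proof.
move=> mf mg; have Mf := Mplus_absC mf; have Mg := Mplus_absC mg.
apply: le_trans (bfn_triangle hrho Mf Mg); apply: (bfn_le hrho).
- split; first by apply: emeasurable_funD; [case: Mf|case: Mg].
  by move=> x; rewrite adde_ge0//; [case: Mf|case: Mg].
- by apply: Mplus_absC; exact: cmeasD.
- by apply: aeW => x; have := ler_normcD (f x) 0 (- g x); rewrite /absC -EFinD lee_fin opprK subr0 add0r.
Qed.

Lemma normXZ c f : cmeas f -> normX rho (fun x => c * f x) = ((normc c)%:E * normX rho f)%E.
Proof.
move=> mf; rewrite -(bfn_scale hrho (normc_ge0 c) (Mplus_absC mf)).
by congr rho; apply/funext => x; rewrite /absC normcM EFinM.
Qed.

Lemma normX_eq0 f : cmeas f -> normX rho f = 0%E <-> ae_zero f.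
Proof.
move=> mf; rewrite (bfn_eq0 hrho (Mplus_absC mf)).
split; apply: filterS => x; rewrite /absC; first by move=> [/eq0_normc].
by move=> ->; rewrite normc0.
Qed.

Variable a : V -> R[i].
Hypothesis ha : multiplier rho a.
Hypothesis leb_gt0 : (0 < leb setT)%E.

Lemma multiplier_bound : exists2 M : R, 0 <= M & forall u, L2 u -> Xspace rho u ->
  (normX rho (fourier_multiplier a u) <= M%:E * normX rho u)%E.
Proof.
have [La] := ha; set s := ereal_sup _ => soo.
exists `|fine s|; first by [].
move=> u Lu Xu; have [mu uoo] := Xu; have mu' : cmeas u := mu.
have mT : cmeas (fourier_multiplier a u) := L2_meas (L2_multiplier leb_gt0 La Lu).
(* The supremum leaves out the functions that vanish almost everywhere. Such a [u] equals [u + u]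
   almost everywhere, so that its image equals its own double and vanishes too. *)
have [u0|nu0] := pselect (ae_zero u).
  have L0 : L2 (fun _ : V => 0 : R[i]).
    apply/L2P; split; first exact: cmeas_cst.
    by rewrite /E2; under eq_integral do rewrite normc0 expr0n; rewrite integral0.
  have : ae_zero (fourier_multiplier a u).
    have := multiplierDZ leb_gt0 La 1 Lu Lu.
    have GE := (fourier_graph_uniq (multiplier_graph leb_gt0 La (L2DZ 1 Lu Lu)) (multiplier_graph leb_gt0 La Lu)).2.
    have FE := (fourier_graph_uniq (fourierP (L2DZ 1 Lu Lu)) (fourierP Lu)).1.
    have {}FE : \forall x \ae leb, a x * fourier (fun x => u x + 1 * u x) x = a x * fourier u x.
      have : \forall x \ae leb, u x + 1 * u x = u x by apply: filterS u0 => x ->; rewrite mulr0 addr0.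
      by move=> /FE; apply: filterS => x ->.
    apply: filterS2 (GE FE) => x -> /eqP.
    by rewrite mul1r -[X in X == _]addr0 (inj_eq (addrI _)) eq_sym => /eqP.
  by move=> /(normX_eq0 mT) ->; rewrite mule_ge0// normX_ge0.
have ngt0 : (0 < normX rho u)%E.
  by rewrite lt0e normX_ge0// andbT; apply/eqP => /(normX_eq0 mu').
have ufin : normX rho u \is a fin_num by rewrite ge0_fin_numE// ltW.
have : (normX rho (fourier_multiplier a u) / normX rho u <= s)%E.
  by apply: ereal_sup_ubound; exists u.
have r0 : (0 <= normX rho (fourier_multiplier a u) / normX rho u)%E.
  by rewrite mule_ge0 ?normX_ge0// inve_ge0 ltW.
move=> /[dup] /(le_trans r0) s0; rewrite lee_div_mul//.
move=> /le_trans; apply; rewrite lee_wpmul2r ?(ltW ngt0)//.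
by rewrite -[leLHS]fineK ?ge0_fin_numE// lee_fin ler_norm.
Qed.

End normX.

(** * Wiener-Hopf operators *)

Section wiener_hopf.
Variables (R : realType) (n : nat).
Local Notation V := (Rn R n).
Local Notation leb := (@leb R n).
Variables (rho : (V -> \bar R) -> \bar R).
Hypothesis hrho : banach_function_norm rho.
Variable Omega : set V.
Hypothesis mOmega : measurable Omega.
Variable a : V -> R[i].
Hypothesis ha : multiplier rho a.
Hypothesis leb_gt0 : (0 < leb setT)%E.
Implicit Types (f g : Omega -> R[i]) (u v : V -> R[i]).

Local Notation rr := (@r_Omega R n Omega).

Lemma e_r_Omega u x : e_Omega (rr u) x = (\1_Omega x : R)%:C * u x.
Proof.
rewrite /e_Omega /r_Omega -[LHS]/(('valL_0 \o sigL Omega) u x) sigLK /restrict/= /patch indicE.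
by case: ifP => _; apply: eq_ReIm; rewrite ?ReZ ?ImZ ?mul1r ?mul0r.
Qed.

Lemma e_OmegaB f g x : e_Omega (f - g) x = e_Omega f x - e_Omega g x.
Proof. by rewrite /e_Omega /valL_ /=; case: (_ x) => [y|]/=; rewrite ?subr0. Qed.

Lemma normc_e_r u x : normc (e_Omega (rr u) x) <= normc (u x).
Proof. by rewrite e_r_Omega normcM normc_indic ler_piMl ?normc_ge0// indicE; case: (_ \in _). Qed.

Lemma cmeas_e_r u : cmeas u -> cmeas (e_Omega (rr u)).
Proof.
move=> mu; rewrite (_ : e_Omega _ = fun x => (\1_Omega x : R)%:C * u x); first exact: cmeas_indicM.
by apply/funext => x; exact: e_r_Omega.
Qed.

Local Notation A0 := (@wiener_hopf0 R n Omega a).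
Local Notation NX := (@normXO R n rho Omega).
Local Notation T := (fourier_multiplier a).

Lemma wiener_hopfE f x : e_Omega (A0 f) x = (\1_Omega x : R)%:C * T (e_Omega f) x.
Proof. exact: e_r_Omega. Qed.

Lemma wiener_hopf_meas f : L2XO rho f -> cmeas (e_Omega (A0 f)).
Proof.
move=> [Lf _]; apply: cmeas_e_r; have [La _] := ha.
exact: (L2_meas (L2_multiplier leb_gt0 La Lf)).
Qed.

Lemma normXO_wiener_hopf_le M : (forall u, L2 u -> Xspace rho u -> (normX rho (T u) <= M%:E * normX rho u)%E) ->
  forall f, L2XO rho f -> (normXO rho (A0 f) <= M%:E * normXO rho f)%E.
Proof.
move=> HM f Lf; have [L2f [mf Xf]] := Lf; have [La _] := ha.
have mT := L2_meas (L2_multiplier leb_gt0 La L2f).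
apply: le_trans (HM _ L2f (conj mf Xf)).
apply: (normX_le hrho (wiener_hopf_meas Lf) mT).
by apply: aeW => x; exact: normc_e_r.
Qed.

Lemma L2XOB f g : L2XO rho f -> L2XO rho g -> L2XO rho (f - g).
Proof.
move=> [L2f [mf Xf]] [L2g [mg Xg]].
have E : e_Omega (f - g) = fun x => e_Omega f x + (-1) * e_Omega g x.
  by apply/funext => x; rewrite e_OmegaB mulN1r.
have mf' : cmeas (e_Omega f) := mf; have mg' : cmeas (e_Omega g) := mg.
split; first by rewrite E; exact: L2DZ.
have mN : cmeas (fun x => (-1) * e_Omega g x) by apply: cmeasM mg'; exact: cmeas_cst.
split; first by rewrite E; exact: (cmeasD mf' mN).
rewrite E; apply: (le_lt_trans (normXD hrho mf' mN)).
by rewrite (normXZ hrho _ mg') normcN normc1 mul1e lte_add_pinfty.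
Qed.

Lemma wiener_hopfB f g : L2XO rho f -> L2XO rho g -> normXO rho (A0 f - A0 g) = normXO rho (A0 (f - g)).
Proof.
move=> Lf Lg; have Lfg := L2XOB Lf Lg; have [L2f _] := Lf; have [L2g _] := Lg; have [La _] := ha.
apply: (normX_ae hrho).
- rewrite (_ : e_Omega _ = fun x => e_Omega (A0 f) x - e_Omega (A0 g) x); last by apply/funext => x; rewrite e_OmegaB.
  by apply: cmeasB; exact: wiener_hopf_meas.
- exact: wiener_hopf_meas.
have := multiplierDZ leb_gt0 La (-1) L2f L2g; apply: filterS => x.
have -> : (fun x => e_Omega f x + -1 * e_Omega g x) = e_Omega (f - g).
  by apply/funext => y; rewrite e_OmegaB mulN1r.
move=> H; apply: (etrans (e_OmegaB _ _ x)); apply: (etrans _ (esym (wiener_hopfE (f - g) x))); rewrite H.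
apply: (etrans (congr2 (fun p q => p - q) (wiener_hopfE f x) (wiener_hopfE g x))).
by rewrite mulN1r mulrBr.
Qed.

Lemma normXO_triangle f g : cmeas (e_Omega f) -> cmeas (e_Omega g) ->
  (normXO rho f <= normXO rho g + normXO rho (g - f)%R)%E.
Proof.
move=> mf mg.
have E : e_Omega (g - f) = fun x => e_Omega g x - e_Omega f x by apply/funext => x; rewrite e_OmegaB.
have mB : cmeas (e_Omega (g - f)) by rewrite E; exact: cmeasB.
have mN : cmeas (fun x => (-1) * e_Omega (g - f) x) by apply: cmeasM mB; exact: cmeas_cst.
have := normXD hrho mg mN; rewrite (normXZ hrho _ mB) normcN normc1 mul1e.
by rewrite (_ : (fun x => _) = e_Omega f)//; apply/funext => x; rewrite e_OmegaB; ring.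
Qed.

Lemma normXOC f g : normXO rho (f - g) = normXO rho (g - f).
Proof.
have E1 : e_Omega (f - g) = fun x => e_Omega f x - e_Omega g x by apply/funext => x; exact: e_OmegaB.
have E2 : e_Omega (g - f) = fun x => e_Omega g x - e_Omega f x by apply/funext => x; exact: e_OmegaB.
rewrite /normXO E1 E2 /normX; congr rho; apply/funext => x.
by rewrite /absC -normcN opprB.
Qed.

Lemma normXO0 : normXO rho (0 : Omega -> R[i]) = 0%E.
Proof.
have E : e_Omega (0 : Omega -> R[i]) = fun=> 0.
  by apply/funext => x; rewrite -(subrr 0) e_OmegaB subrr.
rewrite /normXO; apply/(normX_eq0 hrho); first by rewrite E; exact: cmeas_cst.
by rewrite E; exact: aeW.
Qed.

Lemma normXO_ge0 f : cmeas (e_Omega f) -> (0 <= normXO rho f)%E.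
Proof. exact: normX_ge0. Qed.

(* The values of [wiener_hopf0] depend on the representatives selected by
   [inv_fourier], those of [wiener_hopf] on the limit selected by [xget]; only
   the norms are compared. *)
Lemma wiener_hopf_ge f : L2XO rho f -> (normXO rho (A0 f) <= normXO rho (@wiener_hopf R n rho Omega a f))%E.
Proof.
move=> Lf; have [M M0 HM] := multiplier_bound hrho ha leb_gt0.
have {}HM := normXO_wiener_hopf_le HM.
have [_ [_ Xf]] := Lf; have mA := wiener_hopf_meas Lf.
pose G := [set g | XO rho g /\ ext_graph NX NX (@L2XO R n rho Omega) A0 f g].
(* [A0 f] is a limit along a constant sequence, so that [xget] selects an element of [G] and not its
   default value. *)
have GA : G (A0 f).
  split.
    split; first exact: mA.
    by apply: (le_lt_trans (HM _ Lf)); rewrite lte_mul_pinfty// normXO_ge0//; case: Lf => _ [].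
  exists (fun=> f); split; first by [].
  - by under eq_fun do rewrite subrr normXO0; exact: cvg_cst.
  - by under eq_fun do rewrite subrr normXO0; exact: cvg_cst.
have [[mg Xg] [w [Lw wf wg]]] : G (@wiener_hopf R n rho Omega a f).
  by apply: xgetPex; exists (A0 f).
set g := @wiener_hopf R n rho Omega a f in mg Xg wg *.
have mg' : cmeas (e_Omega g) := mg.
have mAw k := wiener_hopf_meas (Lw k).
have meB (p q : Omega -> R[i]) : cmeas (e_Omega p) -> cmeas (e_Omega q) -> cmeas (e_Omega (p - q)).
  move=> mp mq; rewrite (_ : e_Omega _ = fun x => e_Omega p x - e_Omega q x); first exact: cmeasB.
  by apply/funext => x; rewrite e_OmegaB.
have key k : (normXO rho (A0 f) <= normXO rho g + (normXO rho (A0 (w k) - g)%R + M%:E * normXO rho (w k - f)%R))%E.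
  have h1 := normXO_triangle mA (mAw k).
  have h2 := normXO_triangle (mAw k) mg'.
  have h3 := HM _ (L2XOB (Lw k) Lf).
  rewrite (wiener_hopfB (Lw k) Lf) in h1.
  have h4 : normXO rho (g - A0 (w k)) = normXO rho (A0 (w k) - g).
    exact: normXOC.
  rewrite h4 in h2.
  apply: (le_trans h1); rewrite addeA; exact: leeD.
have t0 : (normXO rho (A0 (w k) - g)%R + M%:E * normXO rho (w k - f)%R)%E @[k --> \oo] --> 0%E.
  by apply: cvge0D => //; exact: cvge0Z.
have tge0 k : (0 <= normXO rho (A0 (w k) - g)%R + M%:E * normXO rho (w k - f)%R)%E.
  have m1 := meB (A0 (w k)) g (mAw k) mg'; have [_ [m2 _]] := L2XOB (Lw k) Lf.
  apply: adde_ge0; first exact: (normXO_ge0 m1).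
  by apply: mule_ge0 => //; exact: (normXO_ge0 m2).
apply/lee_addgt0Pr => e e0.
have [N _ /(_ N (leqnn N))/= tN] := (cvge0P tge0).1 t0 e e0.
by apply: (le_trans (key N)); rewrite leeD2l// ltW.
Qed.

Lemma opnorm_wiener_hopf_ge f : L2XO rho f -> ~ ae_zero (e_Omega f) ->
  (normXO rho (A0 f) <= opnorm rho (@wiener_hopf R n rho Omega a) * normXO rho f)%E.
Proof.
move=> Lf nf; have [_ [mf Xf]] := Lf; have mf' : cmeas (e_Omega f) := mf.
have f0 : (0 < normXO rho f)%E.
  by rewrite lt0e normXO_ge0// andbT; apply/eqP => /(normX_eq0 hrho mf').
apply: (le_trans (wiener_hopf_ge Lf)); rewrite -lee_div_mul//; last by rewrite ge0_fin_numE// ltW.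
apply: ereal_sup_ubound; exists f => //; split => //; split; first by [].
exists (fun=> f); split; first by [].
by under eq_fun do rewrite subrr normXO0; exact: cvg_cst.
Qed.

End wiener_hopf.

(** * Wave packets *)

Section enorm.
Variables (R : realType) (n : nat).
Local Notation V := (Rn R n).
Implicit Types (x y : V) (c : R).

Lemma enorm_eq0 x : enorm x = 0 -> x = 0.
Proof.
move=> x0; apply/rowP => i; rewrite !mxE; apply/eqP; rewrite -normr_le0 -x0.
exact: normr_coord_le.
Qed.

Lemma enorm0 : enorm (0 : V) = 0.
Proof. by rewrite /enorm dotp0l sqrtr0. Qed.

Lemma enormZ c x : enorm (c *: x) = `|c| * enorm x.
Proof. by rewrite /enorm dotpZl dotpZr mulrA -expr2 sqrtrM ?sqr_ge0// sqrtr_sqr. Qed.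

Lemma enormN x : enorm (- x) = enorm x.
Proof. by rewrite -scaleN1r enormZ normrN1 mul1r. Qed.

Lemma ler_enormD x y : enorm (x + y) <= enorm x + enorm y.
Proof.
have [x0|x0] := eqVneq (enorm x) 0; first by rewrite (enorm_eq0 x0) add0r enorm0 add0r.
have [y0|y0] := eqVneq (enorm y) 0; first by rewrite (enorm_eq0 y0) addr0 enorm0 addr0.
have xp : 0 < enorm x by rewrite lt_neqAle eq_sym x0 enorm_ge0.
have yp : 0 < enorm y by rewrite lt_neqAle eq_sym y0 enorm_ge0.
rewrite -(@ler_pXn2r _ 2)// ?nnegrE ?enorm_ge0 ?addr_ge0 ?enorm_ge0//.
rewrite enorm_sqr sqrrD !enorm_sqr dotpDl !dotpDr (dotpC y x).
suff : dotp x y <= enorm x * enorm y by rewrite mulr2n; lra.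
(* The Cauchy-Schwarz inequality comes from expanding this square. *)
have := dotp_ge0 (enorm y *: x - enorm x *: y).
rewrite dotpDl !dotpDr !(dotpNl, dotpNr) !(dotpZl, dotpZr) (dotpC y x) -!enorm_sqr.
move: (enorm x) (enorm y) (dotp x y) xp yp => p q d xp yp H.
have pq : 0 < p * q by rewrite mulr_gt0.
rewrite -(ler_pM2l pq); nra.
Qed.

Lemma ler_enorm_dist x y : enorm x <= enorm y + enorm (x - y).
Proof. by rewrite -{1}(subrK y x) addrC ler_enormD. Qed.

End enorm.

Section eball.
Variables (R : realType) (n : nat).
Local Notation V := (Rn R n).
Local Notation leb := (@leb R n).
Implicit Types (x y : V) (r : R).

Lemma L12_eball y r : L12 (fun x : V => (\1_(eball y r) x : R)%:C).
Proof.
have mB := borel_measurable (measurable_eball y r).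
apply: (L12_le _ (L12Z (expR (r ^+ 2))%:C (L12_gaussn y ltr01))).
  by apply: cmeas_real; exact: measurable_indic.
move=> x; rewrite normc_indic normcM !normc_real (ger0_norm (expR_ge0 _)) (ger0_norm (gaussn_ge0 _ _)).
have H0 : 0 <= expR (r ^+ 2) * gaussn 1 (x - y) := mulr_ge0 (expR_ge0 _) (gaussn_ge0 _ _).
rewrite indicE; case: (boolP (x \in _)) => [/set_mem|_]; last exact: H0.
rewrite /eball/= /gaussn -expRD => xr; rewrite -[leLHS]expR0 ler_expR mulN1r subr_ge0 -enorm_sqr.
have r0 := ltW (le_lt_trans (enorm_ge0 (x - y)) xr).
by rewrite lerXn2r ?nnegrE ?enorm_ge0// ltW.
Qed.

(** If the ball were null, so would be its dilates by [k.+1], which cover the space. *)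
Lemma leb_eball_gt0 r : (0 < leb setT)%E -> 0 < r -> (0 < leb (eball (0%R : V) r))%E.
Proof.
move=> leb0 r0; have mB s := borel_measurable (measurable_eball (0 : V) s).
rewrite lt0e measure_ge0 andbT; apply/eqP => Br0.
have Bk k : leb (eball (0 : V) (k.+1%:R * r)) = 0%E.
  have c0 : 0 < k.+1%:R^-1 :> R by rewrite invr_gt0.
  have mf : measurable_fun setT (fun x : borelRn R n => ((\1_(eball (0 : V) r) x : R)%:E)).
    by apply/measurable_EFinP; apply: measurable_indic; exact: measurable_eball.
  have f0 (x : borelRn R n) : (0 <= (\1_(eball (0%R : V) r) x : R)%:E)%E by rewrite lee_fin.
  have h1 : (\int[leb]_x (\1_(eball (0%R : V) r) x : R)%:E = 0)%E.
    by rewrite (integral_indic leb measurableT (mB r)) setIT.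
  have h2 := ge0_integral_affine 0 c0 mf f0.
  have -> : leb (eball (0%R : V) (k.+1%:R * r)) = (\int[leb]_x (\1_(eball (0%R : V) (k.+1%:R * r)) x : R)%:E)%E.
    by rewrite (integral_indic leb measurableT (mB _)) setIT.
  transitivity ((k.+1%:R^-1^-1 ^+ n)%:E * (\int[leb]_x (\1_(eball (0%R : V) r) x : R)%:E))%E; last by rewrite h1 mule0.
  rewrite -h2; apply: eq_integral => x _; congr (_%:E).
  rewrite !indicE; congr (_%:R); congr nat_of_bool; apply/idP/idP => /set_mem H; apply/mem_set; move: H;
    by rewrite /eball/= addr0 !subr0 enormZ ger0_norm ?invr_ge0// ltr_pdivrMl.
have : leb.-negligible (\bigcup_k (eball (0 : V) (k.+1%:R * r))).
  by apply: negligible_bigcup => k; exists (eball (0 : V) (k.+1%:R * r)); split; [exact: mB|exact: Bk|].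
have -> : \bigcup_k (eball (0 : V) (k.+1%:R * r)) = setT.
  apply/seteqP; split => // x _; exists (Num.bound (enorm x / r)) => //=.
  rewrite /eball/= subr0 -ltr_pdivrMr// (lt_le_trans (archi_boundP _)) ?divr_ge0 ?enorm_ge0 ?ltW//.
  by rewrite ltr_nat.
by move=> /(negligibleP leb measurableT) H; move: leb0; rewrite H ltxx.
Qed.

End eball.

(** * Bump functions *)

Section bump.
Variables (R : realType) (n : nat).
Local Notation V := (Rn R n).
Local Notation leb := (@leb R n).

(** The transform is a Borel function even though [f] is only Lebesgue measurable; this is needed
    for its composition with affine maps in [wave_packet]. *)
Lemma borel_FT s (f : V -> R[i]) : cintegrable leb f -> cmeas (FT s f : borelRn R n -> R[i]).
Proof.
move=> If; pose ph (z : borelRn R n * V) := s * dotp (z.1 : V) z.2.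
have mph : measurable_fun setT ph.
  apply: measurable_funMl; apply: (measurable_dotp (f := fun p : borelRn R n * V => p.1) (g := fun p : borelRn R n * V => p.2)).
  - exact: measurable_fst.
  - exact: (measurableT_comp (@measurable_toB R n) measurable_snd).
have Ig : (borel_lebesgue R n).-integrable setT (EFin \o (gaussn 1 : borelRn R n -> R)).
  apply/(ge0_integrableP (borel_lebesgue R n) (borel_gaussn 1)); first by move=> x; exact: gaussn_ge0.
  by rewrite integral_gaussn// ltry.
apply: (cmeas_cint_expi mph If Ig (borel_gaussn (-1))).
by move=> x; rewrite gaussnM addNr /gaussn oppr0 mul0r expR0.
Qed.

Lemma FT_shift s (f : borelRn R n -> R[i]) (x xi : V) : cmeas f -> cintegrable leb (f : V -> R[i]) ->
  FT s (fun t : V => f (t - x)) xi = expi (s * dotp xi x) * FT s f xi.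
Proof.
move=> mf If; pose F (y : borelRn R n) := f y * expi (s * dotp xi (y : V)) * expi (s * dotp xi x).
have me : cmeas (fun y : borelRn R n => expi (s * dotp xi (y : V))).
  apply: cmeas_expi; apply: measurable_funMl.
  exact: (measurable_dotp (measurable_cst (xi : borelRn R n)) (@measurable_id _ _ setT)).
have mF : cmeas F by apply: cmeasM; [exact: cmeasM|exact: cmeas_cst].
have I1 := cintegrable_FT s xi If.
have FE : (F : V -> R[i]) = fun y => expi (s * dotp xi x) * (f y * expi (s * dotp xi y)).
  by apply/funext => y; rewrite /F mulrC.
have IF : cintegrable leb (F : V -> R[i]) by rewrite FE; exact: cintegrableZ.
rewrite /FT -(cintZ _ I1) -FE -(Rintegral_shift_cint x mF IF); apply: eq_cint => t.
rewrite /F -mulrA -expiD; congr (_ * expi _); rewrite !dotpE; ring.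
Qed.

(** The product is also square integrable, because the first factor is bounded by [N1 z]. *)
Lemma L12_FTM (z w : V -> R[i]) : L12 z -> L12 w -> L12 (fun x => FT (-1) z x * FT 1 w x).
Proof.
move=> Lz Lw; have [Iz _] := Lz; have [Iw _] := Lw.
have /L2P[mz z2] := L2_FT (sqrN1 R) Lz; have /L2P[mw w2] := L2_FT (expr1n R 2) Lw.
split; first exact: (normcM_lty mz mw z2 w2).
have mN : cmeas (fun x => (N1 z)%:C * FT 1 w x) by apply: cmeasM mw; exact: cmeas_cst.
apply: (@le_lt_trans _ _ (E2 leb (fun x => (N1 z)%:C * FT 1 w x))).
  apply: (le_E2 leb (cmeasM mz mw) mN) => x.
  rewrite !normcM normc_real (ger0_norm (N1_ge0 z)) ler_wpM2r ?normc_ge0//.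
  exact: normc_FT.
by rewrite (E2Z leb _ mw) lte_mul_pinfty ?lee_fin ?sqr_ge0.
Qed.

(** The convolution theorem as an instance of [parseval]. Transforming [w] with the opposite sign
    yields [w (t - x)] in place of [w (x - t)]. *)
Lemma iFT_FTM (z : V -> R[i]) (w : borelRn R n -> R[i]) (x : V) : L12 z -> cmeas w -> L12 (w : V -> R[i]) ->
  L12 (fun t : V => w (t - x)) ->
  iFT (fun xi => FT (-1) z xi * FT 1 (w : V -> R[i]) xi) x = cint leb (fun t => z t * w (t - x)).
Proof.
move=> Lz mw Lw Lwx; rewrite (parseval Lz Lwx) /iFT.
have [IM _] := L12_FTM Lz Lw; have [Iw _] := Lw.
rewrite /FT -(cintZ _ (cintegrable_FT 1 x IM)); apply: eq_cint => xi.
by rewrite -/(FT (-1) z xi) -/(FT 1 _ xi) -/(FT 1 _ xi) (FT_shift 1 x xi mw Iw) dotpC; ring.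
Qed.

(* [g] is integrable as a product of two functions of L^2, and by [parseval]
   [iFT g x] is the quotient [|B(0, del) & B(x, 1 + del)| / |B(0, del)|]. *)
Lemma bump_function (del : R) : (0 < leb setT)%E -> 0 < del -> exists g : borelRn R n -> R[i],
  [/\ cmeas g, L12 (g : V -> R[i]), forall x, enorm x < 1 -> iFT (g : V -> R[i]) x = 1,
      forall x, 1 + 2 * del <= enorm x -> iFT (g : V -> R[i]) x = 0 &
      forall x, normc (iFT (g : V -> R[i]) x) <= 1].
Proof.
move=> leb0 d0; pose B := eball (0 : V) del.
have mB : measurable B := borel_measurable (measurable_eball (0 : V) del).
pose z x : R[i] := (\1_B x : R)%:C; have Lz : L12 z := L12_eball 0 del.
(* The radius [1 + del] is such that the translate of this ball to [x] contains [B] when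
   [enorm x < 1] and misses it when [1 + 2 * del <= enorm x]. *)
pose w (x : borelRn R n) : R[i] := (\1_(eball (0 : V) (1 + del)) x : R)%:C.
have Lw : L12 (w : V -> R[i]) := L12_eball 0 (1 + del).
have mw : cmeas w by apply: cmeas_real; apply: measurable_indic; exact: measurable_eball.
have wE (x t : V) : w (t - x) = (\1_(eball x (1 + del)) t : R)%:C.
  rewrite /w !indicE; congr ((nat_of_bool _)%:R%:C).
  by apply/idP/idP => /set_mem H; apply/mem_set; move: H; rewrite /eball/= subr0.
have Lwx x : L12 (fun t : V => w (t - x)).
  by under eq_fun do rewrite wE; exact: L12_eball.
have Boo : (leb B < +oo)%E := L12_indic_lty mB Lz.
have Bfin : leb B \is a fin_num by rewrite ge0_fin_numE.
pose b := fine (leb B).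
have b0 : 0 < b by rewrite fine_gt0// Boo leb_eball_gt0.
have LM : L12 (fun xi => FT (-1) z xi * FT 1 (w : V -> R[i]) xi) := L12_FTM Lz Lw.
exists (fun xi => (b^-1)%:C * (FT (-1) z xi * FT 1 (w : V -> R[i]) xi)).
have [Iz _] := Lz; have [Iw _] := Lw; have [IM _] := LM.
have mE x : measurable (B `&` eball x (1 + del)).
  by apply: measurableI => //; exact: borel_measurable (measurable_eball x _).
have phiE x : iFT (fun xi : V => (b^-1)%:C * (FT (-1) z xi * FT 1 (w : V -> R[i]) xi)) x =
    (b^-1 * fine (leb (B `&` eball x (1 + del))))%:C.
  rewrite /iFT (FTZ _ _ _ IM) mulrCA -/(iFT _ x) (iFT_FTM Lz mw Lw (Lwx x)) realCM; congr (_ * _).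
  transitivity (cint leb (fun t => (\1_(B `&` eball x (1 + del)) t : R)%:C)).
    by apply: eq_cint => t; rewrite wE /z -realCM indicI.
  rewrite cint_real /Rintegral (integral_indic leb measurableT (mE x)) setIT.
  by [].
split.
- apply: cmeasM; first exact: cmeas_cst.
  by apply: cmeasM; exact: borel_FT.
- exact: L12Z.
- move=> x x1; rewrite phiE (_ : B `&` _ = B) ?mulVf ?gt_eqF//.
  apply/setIidPl => t; rewrite /B /eball/= subr0 => td.
  by apply: (le_lt_trans (ler_enormD _ _)); rewrite enormN addrC ltrD.
- move=> x x1; rewrite phiE (_ : B `&` _ = set0) ?measure0 ?mulr0//.
  apply/seteqP; split => // t [/=]; rewrite /B /eball/= subr0 => td.
  rewrite ltNge => /negP; apply.
  have := ler_enorm_dist x t; rewrite -[enorm (x - t)]enormN opprB.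
  by move: td x1; lra.
- move=> x; have E0 : 0 <= b^-1 * fine (leb (B `&` eball x (1 + del))).
    by rewrite mulr_ge0 ?fine_ge0// invr_ge0 ltW.
  rewrite phiE normc_real (ger0_norm E0).
  rewrite ler_pdivrMl// mulr1 /b fine_le//; last by apply: le_measure; rewrite ?inE//; exact: subIsetl.
  rewrite ge0_fin_numE//; apply: le_lt_trans Boo.
  by apply: le_measure; rewrite ?inE//; exact: subIsetl.
Qed.

End bump.

Section affine.
Variables (R : realType) (n : nat).
Local Notation V := (Rn R n).
Local Notation B := (borelRn R n).
Local Notation leb := (@leb R n).

Lemma measurable_affine (c : R) (b : V) : measurable_fun setT (fun x : B => (c *: (x : V) + b : B)).
Proof. exact: (measurable_funZD c (@measurable_id _ B setT) (measurable_cst (b : B))). Qed.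

Lemma cmeas_affine (c : R) (b : V) (f : B -> R[i]) : cmeas f -> cmeas (fun x : B => f (c *: (x : V) + b)).
Proof. exact: (cmeas_comp (measurable_affine c b)). Qed.

Lemma cintegrable_affine (c : R) (b : V) (f : B -> R[i]) : 0 < c -> cmeas f -> cintegrable leb (f : V -> R[i]) ->
  cintegrable leb (fun x : V => f (c *: x + b)).
Proof.
move=> c0 mf If; have mfa : cmeas (fun x : V => f (c *: x + b)).
  by have [m1 m2] := cmeas_affine c b mf; split; exact: borel_measurable_fun.
apply/(cintegrableP leb mfa).
have mn : measurable_fun setT (fun x : B => (normc (f x))%:E) by apply/measurable_EFinP; exact: measurable_normc.
rewrite (ge0_integral_affine b c0 mn); last by move=> x; rewrite lee_fin normc_ge0.
rewrite lte_mul_pinfty ?lee_fin ?exprn_ge0 ?invr_ge0 ?(ltW c0)//.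
by move/(cintegrableP leb (cintegrable_meas If)) : If.
Qed.

Lemma E2_affine (c : R) (b : V) (f : B -> R[i]) : 0 < c -> cmeas f ->
  E2 leb (fun x : V => f (c *: x + b)) = ((c^-1 ^+ n)%:E * E2 leb (f : V -> R[i]))%E.
Proof.
move=> c0 mf; apply: (ge0_integral_affine b c0 (measurable_normc2 mf)).
by move=> x; rewrite lee_fin sqr_ge0.
Qed.

Lemma L12_affine (c : R) (b : V) (f : B -> R[i]) : 0 < c -> cmeas f -> L12 (f : V -> R[i]) ->
  L12 (fun x : V => f (c *: x + b)).
Proof.
move=> c0 mf [If f2]; split; first exact: cintegrable_affine.
by rewrite E2_affine// lte_mul_pinfty// lee_fin exprn_ge0// invr_ge0 ltW.
Qed.

Lemma cint_affine (c : R) (b : V) (f : B -> R[i]) : 0 < c -> cmeas f -> cintegrable leb (f : V -> R[i]) ->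
  cint leb (fun x : V => f (c *: x + b)) = (c^-1 ^+ n)%:C * cint leb (f : V -> R[i]).
Proof.
move=> c0 [f1 f2] [I1 I2]; apply: eq_ReIm; rewrite ?ReZ ?ImZ/=.
- exact: (Rintegral_affine b c0 f1 I1).
- exact: (Rintegral_affine b c0 f2 I2).
Qed.

Variables (g : B -> R[i]) (r : R) (xi0 y : V).
Hypotheses (mg : cmeas g) (Lg : L12 (g : V -> R[i])) (r0 : 0 < r).

(** The packet on the Fourier side: [g] is concentrated around [xi0] at the scale [r^-1], the factor
    [r ^+ n] preserves its L^1 norm, and the centre [y] enters through a phase only. *)
Definition wave_packet (xi : B) : R[i] :=
  (r ^+ n)%:C * (g (r *: (xi : V) + (- (r *: xi0))) * expi (- dotp ((xi : V) - xi0) y)).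

Let borel_expi_dotp (x : V) (c : R) : cmeas (fun xi : B => expi (c * dotp (xi : V) x)).
Proof.
apply: cmeas_expi; apply: measurable_funMl.
exact: (measurable_dotp (@measurable_id _ B setT) (measurable_cst (x : B))).
Qed.

Lemma borel_wave_packet : cmeas wave_packet.
Proof.
apply: cmeasM; first exact: cmeas_cst.
apply: cmeasM; first exact: cmeas_affine.
have -> : (fun xi : B => expi (- dotp ((xi : V) - xi0) y)) = fun xi : B => expi (dotp xi0 y) * expi (-1 * dotp (xi : V) y).
  by apply/funext => xi; rewrite -expiD; congr expi; rewrite !dotpE; ring.
by apply: cmeasM; [exact: cmeas_cst|exact: borel_expi_dotp].
Qed.

Lemma normc_wave_packet (xi : V) : normc (wave_packet xi) = r ^+ n * normc (g (r *: xi + (- (r *: xi0)))).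
Proof. by rewrite /wave_packet !normcM normc_expi mulr1 normc_real ger0_norm// exprn_ge0// ltW. Qed.

Lemma L12_wave_packet : L12 (wave_packet : V -> R[i]).
Proof.
have Lga := L12Z (r ^+ n)%:C (L12_affine (- (r *: xi0)) r0 mg Lg).
apply: (L12_le _ Lga); first by have [m1 m2] := borel_wave_packet; split; exact: borel_measurable_fun.
by move=> xi; rewrite normc_wave_packet normcM normc_real ger0_norm ?lexx// exprn_ge0// ltW.
Qed.

Let rn1 : r^-1 ^+ n * r ^+ n = 1.
Proof. by rewrite -exprMn mulVf ?expr1n// gt_eqF. Qed.

Let unscale (xi : V) : r^-1 *: (r *: xi + (- (r *: xi0))) + xi0 = xi.
Proof. by rewrite -scalerBr scalerA mulVf ?gt_eqF// scale1r subrK. Qed.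

Lemma iFT_wave_packet (x : V) :
  iFT (wave_packet : V -> R[i]) x = expi (dotp xi0 x) * iFT (g : V -> R[i]) (r^-1 *: (x - y)).
Proof.
have [Ig _] := Lg.
pose H (eta : B) := (r ^+ n)%:C * expi (dotp xi0 x) * (g eta * expi (1 * dotp (r^-1 *: (x - y)) (eta : V))).
have mH : cmeas H.
  apply: cmeasM; first exact: cmeas_cst.
  by apply: cmeasM => //; under eq_fun do rewrite dotpC; exact: borel_expi_dotp.
have Ie := cintegrable_FT 1 (r^-1 *: (x - y)) Ig.
have IH : cintegrable leb (H : V -> R[i]) by exact: cintegrableZ.
rewrite /iFT.
have -> : FT 1 (wave_packet : V -> R[i]) x = cint leb (fun xi : V => H (r *: xi + (- (r *: xi0)))).
  apply: eq_cint => xi; rewrite /wave_packet /H -!mulrA; congr (_ * _).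
  rewrite [RHS]mulrCA; congr (_ * _); rewrite -!expiD; congr expi.
  rewrite -{1 2}(unscale xi); move: (r *: xi + _) => eta.
  by rewrite !dotpE ?(dotpC eta) ?(dotpC xi0 x) (dotpC y eta) ?(dotpC xi0 y); ring.
rewrite (cint_affine _ r0 mH IH) /H (cintZ _ Ie) -/(FT 1 _ _) !mulrA; congr (_ * _).
by rewrite -[X in X * expi _]mulrA -realCM rn1 mulr1 mulrC.
Qed.

Lemma integral_wave_packet (h : B -> R) : measurable_fun setT h -> (forall x, 0 <= h x) ->
  (\int[leb]_xi (h xi * normc (wave_packet xi))%:E =
   \int[leb]_eta (h (r^-1 *: (eta : V) + xi0) * normc (g eta))%:E)%E.
Proof.
move=> mh h0.
pose F (eta : B) : \bar R := (r ^+ n * (h (r^-1 *: (eta : V) + xi0) * normc (g eta)))%:E.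
have mP : measurable_fun setT (fun eta : B => h (r^-1 *: (eta : V) + xi0) * normc (g eta)).
  by apply: measurable_funM; [exact: (measurableT_comp mh (measurable_affine _ _))|exact: measurable_normc].
have mF : measurable_fun setT F by apply/measurable_EFinP; exact: measurable_funMl.
have F0 eta : (0 <= F eta)%E by rewrite lee_fin !mulr_ge0 ?normc_ge0// exprn_ge0// ltW.
transitivity (\int[leb]_xi F (r *: (xi : V) + (- (r *: xi0)))%R)%E.
  apply: eq_integral => xi _; rewrite /F unscale normc_wave_packet; congr (_%:E); ring.
rewrite (ge0_integral_affine _ r0 mF F0) -ge0_integralZlT.
- apply: eq_integral => xi _; rewrite /F -EFinM; congr (_%:E).
  apply: (etrans (mulrA _ _ _)); apply: (etrans (congr1 (fun z => z * _) rn1)); exact: mul1r.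
- exact: (borel_measurable_fun mF).
- exact: F0.
- by rewrite lee_fin exprn_ge0// invr_ge0 ltW.
Qed.

End affine.

(** * Translations of a level set and averaging over frequencies *)

Section translation.
Variables (R : realType) (n : nat).
Local Notation V := (Rn R n).
Local Notation B := (borelRn R n).
Local Notation leb := (@leb R n).
Local Notation C := ((2 * pi) ^+ n : R).
Variable K : set B.
Hypotheses (mK : measurable K) (Koo : (leb (K : set V) < +oo)%E).

Let k (x : B) : R[i] := (\1_K x : R)%:C.

Let mk : cmeas k.
Proof. by apply: cmeas_real; exact: measurable_indic. Qed.

Let Lk : L12 (k : V -> R[i]).
Proof. exact: (L12_indic (borel_measurable mK) Koo). Qed.

Let Lkx (x : V) : L12 (fun t : V => k (t - x)).
Proof. by have := L12_affine (- x) ltr01 mk Lk; under eq_fun do rewrite scale1r. Qed.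

(* Plancherel's theorem turns the translations into multiplications by
   characters. *)
Lemma translation_cvg (x : V) (t_ : nat -> R) : t_ j @[j --> \oo] --> (0 : R) ->
  E2 leb (fun xi : V => k (xi - t_ j *: x) - k xi) @[j --> \oo] --> 0%E.
Proof.
move=> t0; have C0 := pi2n_gt0 R n.
pose F := FT (-1) (k : V -> R[i]); have [Ik _] := Lk.
have /L2P[mF F2] := L2_FT (sqrN1 R) Lk.
pose f j (xi : V) := expi (- t_ j * dotp xi x) * F xi.
have mf j : cmeas (f j).
  apply: cmeasM mF; apply: cmeas_expi; apply: measurable_funMl.
  exact: (measurable_dotp (@measurable_toB R n) (measurable_cst (x : B))).
have EF j : E2 leb (fun xi : V => k (xi - t_ j *: x) - k xi) = (C^-1%:E * E2 leb (fun xi => f j xi - F xi)%R)%E.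
  have -> : (fun xi => f j xi - F xi)%R = fun xi => FT (-1) (fun t : V => k (t - t_ j *: x)) xi - F xi.
    by apply/funext => xi; rewrite /f (FT_shift _ _ _ mk Ik) dotpZr mulrA mulN1r.
  rewrite (plancherelB (Lkx _) Lk) muleA -EFinM mulVf ?mul1e// gt_eqF//; exact: C0.
under eq_fun do rewrite EF; apply: cvge0Z.
have i4 : leb.-integrable setT (fun xi => ((2 * normc (F xi)) ^+ 2)%:E).
  have := integrableZl measurableT 4 (integrable_normc2 mF F2).
  congr (leb.-integrable _ _); apply/funext => xi; rewrite -EFinM; congr (_%:E).
  by rewrite exprMn; congr (_ * _); rewrite expr2; ring.
have nf j xi : normc (f j xi - F xi) = normc (expi (- t_ j * dotp xi x) - 1) * normc (F xi).
  by rewrite -normcM mulrBl mul1r.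
apply: (E2_cvg_dominated mf mF i4).
- apply: aeW => xi.
  have -> : (fun j => normc (f j xi - F xi)) = fun j => normc (expi (- t_ j * dotp xi x) - 1) * normc (F xi).
    by apply/funext => j; exact: nf.
  rewrite -[X in _ --> X](mul0r (normc (F xi))); apply: cvgM; last exact: cvg_cst.
  have ca : - t_ j * dotp xi x @[j --> \oo] --> (0 : R).
    by rewrite -[X in _ --> X](mul0r (dotp xi x)) -[X in X * _]oppr0; apply: cvgM; [exact: cvgN|exact: cvg_cst].
  apply: (@squeeze_cvgr _ _ _ _ (cst 0) (fun j => `|cos (- t_ j * dotp xi x) - 1| + `|sin (- t_ j * dotp xi x)|)).
  + apply: nearW => j; apply/andP; split; first exact: normc_ge0.
    have := normc_le_ReIm (expi (- t_ j * dotp xi x) - 1); congr (_ <= _ + `|_|).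
    by rewrite /= subr0.
  + exact: cvg_cst.
  + rewrite -[X in _ --> X](addr0 (0 : R)); apply: cvgD.
    * rewrite -[X in _ --> X](normr0 R); apply: cvg_norm; rewrite -[X in _ --> X](subrr (1 : R)).
      apply: cvgB; last exact: cvg_cst.
      by rewrite -[X in _ --> X](cos0 R); apply: (continuous_cvg _ (@continuous_cos R 0) ca).
    * rewrite -[X in _ --> X](normr0 R); apply: cvg_norm.
      by rewrite -[X in _ --> X](sin0 R); apply: (continuous_cvg _ (@continuous_sin R 0) ca).
- apply: aeW => xi j; rewrite nf ler_wpM2r ?normc_ge0//.
  have := ler_normcD (expi (- t_ j * dotp xi x)) 0 1.
  by rewrite subr0 sub0r normcN normc_expi normc1.
Qed.

End translation.

Section averaging.
Variables (R : realType) (n : nat).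
Local Notation V := (Rn R n).
Local Notation B := (borelRn R n).
Local Notation leb := (@leb R n).
Variables (K : set B) (g : B -> R[i]) (t_ : nat -> R).
Hypotheses (mK : measurable K) (K0 : (0 < leb (K : set V))%E) (Koo : (leb (K : set V) < +oo)%E).
Hypotheses (Ig : cintegrable leb (g : V -> R[i])) (t0 : t_ j @[j --> \oo] --> (0 : R)).

Let ind (x : B) : R := \1_K x.

Let mind : measurable_fun setT ind.
Proof. exact: measurable_indic. Qed.

(** Detects that the displacement [t_ j *: p.2] throws the point [p.1] of [K] out of [K]. *)
Let psi j (p : V * V) : R := ind p.1 * (1 - ind (t_ j *: p.2 + p.1)).

Let psi_ge0 j p : 0 <= psi j p.
Proof. by rewrite /psi /ind mulr_ge0// subr_ge0 indicE; case: (_ \in _). Qed.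

Let psi_le j p : psi j p <= ind p.1.
Proof. by rewrite /psi ler_piMr /ind// lerBlDr lerDl. Qed.

Let mpsi j : measurable_fun setT (psi j).
Proof.
have m1 := measurableT_comp (@measurable_toB R n) (@measurable_fst _ _ V V).
have m2 := measurableT_comp (@measurable_toB R n) (@measurable_snd _ _ V V).
apply: measurable_funM; first exact: (measurableT_comp mind m1).
apply: measurable_funB; first exact: measurable_cst.
exact: (measurableT_comp mind (measurable_funZD (t_ j) m2 m1)).
Qed.

Let M j (eta : V) : \bar R := (\int[leb]_xi (psi j (xi, eta))%:E)%E.

Let mM j : measurable_fun setT (M j).
Proof.
apply: (measurable_fun_fubini_tonelli_G (m1 := leb) (fun p => (psi j p)%:E)).
- by apply/measurable_EFinP; exact: mpsi.
- by move=> p; rewrite lee_fin psi_ge0.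
Qed.

Let mpsi1 j eta : measurable_fun setT (fun xi : V => psi j (xi, eta)).
Proof. exact: (measurableT_comp (mpsi j) (measurable_pair2 eta)). Qed.

Let M_ge0 j eta : (0 <= M j eta)%E.
Proof. by apply: integral_ge0 => xi _; rewrite lee_fin psi_ge0. Qed.

Let M_le j eta : (M j eta <= leb (K : set V))%E.
Proof.
have -> : leb (K : set V) = (\int[leb]_x (ind x)%:E)%E.
  by rewrite (integral_indic leb measurableT (borel_measurable mK)) setIT.
apply: ge0_le_integralT.
- by apply/measurable_EFinP; exact: mpsi1.
- by move=> xi; rewrite lee_fin psi_ge0.
- by apply/measurable_EFinP; exact: (borel_measurable_fun mind).
- by move=> xi; rewrite lee_fin psi_le.
Qed.

(** Indicators equal their squares, so that continuity of translations in L^2 controls the measure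
    of what leaves [K]. *)
Let M_cvg eta : M j eta @[j --> \oo] --> 0%E.
Proof.
apply: (le_cvge0 (fun j => M_ge0 j eta) _ (translation_cvg mK Koo (- eta) t0)) => j.
have mk : cmeas (fun x : B => (ind x)%:C) := cmeas_real mind.
apply: ge0_le_integralT.
- by apply/measurable_EFinP; exact: mpsi1.
- by move=> xi; rewrite lee_fin psi_ge0.
- apply: measurable_normc2; apply: cmeasB; last by have [m1 m2] := mk; split; exact: borel_measurable_fun.
  by have := cmeas_affine 1 (- (t_ j *: - eta)) mk => -[m1 m2]; under eq_fun do rewrite -[X in X - _]scale1r;
    split; exact: borel_measurable_fun.
- move=> xi; rewrite lee_fin normc_realB /psi/= scalerN opprK [xi + _]addrC /ind !indicE.
  by case: (xi \in K); case: (_ \in K); rewrite ?subrr ?mulr0 ?mul0r ?sqr_ge0// subr0 sub0r normrN normr1 expr1n mulr1.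
Qed.

Let J j := (\int[leb]_eta ((normc (g eta))%:E * M j eta))%E.

Let mgV : measurable_fun setT (fun eta : V => (normc (g eta))%:E).
Proof. by apply/measurable_EFinP; exact: (measurable_normc (cintegrable_meas Ig)). Qed.

Let J_cvg : J j @[j --> \oo] --> 0%E.
Proof.
have mJ j : measurable_fun setT (fun eta : V => ((normc (g eta))%:E * M j eta)%E) by exact: emeasurable_funM.
have Kfin : leb (K : set V) \is a fin_num by rewrite ge0_fin_numE.
have iK := integrableZr measurableT (fine (leb (K : set V))) (cintegrable_normc Ig).
have cF : \forall eta \ae leb, setT eta -> ((normc (g eta))%:E * M j eta)%E @[j --> \oo] --> cst 0%E eta.
  by apply: aeW => eta _; apply: cvge0Z; exact: M_cvg.
have dF : \forall eta \ae leb, forall j, setT eta ->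
    (`|(normc (g eta))%:E * M j eta| <= (normc (g eta))%:E * (fine (leb (K : set V)))%:E)%E.
  apply: aeW => eta j _; rewrite gee0_abs; last by rewrite mule_ge0// lee_fin normc_ge0.
  by rewrite lee_wpmul2l ?lee_fin ?normc_ge0// fineK.
have [_ _] := dominated_convergence measurableT mJ (measurable_cst _) cF iK dF.
by rewrite integral0.
Qed.

Let J_swap j : J j = (\int[leb]_xi \int[leb]_eta (psi j (xi, eta) * normc (g eta))%:E)%E.
Proof.
have mF : measurable_fun setT (fun p : V * V => (psi j p * normc (g p.2))%:E).
  apply/measurable_EFinP; apply: measurable_funM; first exact: mpsi.
  exact: (measurableT_comp (measurable_normc (cintegrable_meas Ig)) (@measurable_snd _ _ V V)).
have F0 (p : V * V) : (0 <= (psi j p * normc (g p.2))%:E)%E.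
  by rewrite lee_fin mulr_ge0 ?normc_ge0 ?psi_ge0.
have /= -> := fubini_tonelli (m1 := leb) (m2 := leb) _ mF F0.
apply: eq_integral => eta _; rewrite /M -ge0_integralZlT.
- by apply: eq_integral => xi _; rewrite -EFinM mulrC.
- by apply/measurable_EFinP; exact: mpsi1.
- by move=> xi; rewrite lee_fin psi_ge0.
- by rewrite lee_fin normc_ge0.
Qed.

(* By Tonelli's theorem and [translation_cvg], the mean over [xi0] in [K] of these
   integrals tends to 0. *)
Lemma averaging (e : R) : 0 < e -> exists j (xi0 : V), K xi0 /\
  (\int[leb]_eta ((1 - \1_K (t_ j *: eta + xi0)) * normc (g eta))%:E < e%:E)%E.
Proof.
move=> e0; have Kfin : leb (K : set V) \is a fin_num by rewrite ge0_fin_numE.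
have k0 : 0 < fine (leb (K : set V)) by rewrite fine_gt0// K0.
have J0 j : (0 <= J j)%E by apply: integral_ge0 => eta _; rewrite mule_ge0// lee_fin normc_ge0.
have [j _ /(_ j (leqnn j))/= Jj] := (cvge0P J0).1 J_cvg (e * fine (leb (K : set V))) (mulr_gt0 e0 k0).
exists j; apply: contrapT => H; move: Jj; rewrite ltNge => /negP; apply.
rewrite EFinM fineK// J_swap.
have -> : leb (K : set V) = (\int[leb]_x (ind x)%:E)%E.
  by rewrite (integral_indic leb measurableT (borel_measurable mK)) setIT.
have mV : measurable_fun setT (fun xi : V => (ind xi)%:E) by apply/measurable_EFinP; exact: (borel_measurable_fun mind).
have i0 (xi : V) : (0 <= (ind xi)%:E)%E by rewrite lee_fin.
rewrite -(ge0_integralZlT leb mV i0); last by rewrite lee_fin ltW.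
apply: ge0_le_integralT.
- exact: measurable_funeM.
- by move=> xi; rewrite mule_ge0// lee_fin ltW.
- apply: (measurable_fun_fubini_tonelli_F (m2 := leb) (fun p : V * V => (psi j p * normc (g p.2))%:E)).
  + apply/measurable_EFinP; apply: measurable_funM; first exact: mpsi.
    exact: (measurableT_comp (measurable_normc (cintegrable_meas Ig)) (@measurable_snd _ _ V V)).
  + by move=> p; rewrite lee_fin mulr_ge0 ?normc_ge0 ?psi_ge0.
- move=> xi; rewrite /ind /psi/= indicE; have [Kxi|nKxi] := pselect (K xi); last first.
    rewrite memNset// mule0; apply: integral_ge0 => eta _; rewrite lee_fin.
    by rewrite mulr_ge0 ?normc_ge0//; exact: (psi_ge0 j (xi, eta)).
  rewrite mem_set// mule1 leNgt; apply/negP => He; apply: H; exists xi; split; first exact: Kxi.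
  apply: le_lt_trans He; rewrite le_eqVlt; apply/orP; left; apply/eqP; apply: eq_integral => eta _.
  by rewrite /ind [\1_K xi]indicE mem_set// mul1r.
Qed.

End averaging.

Lemma ae_ge0_le_integralT d (T : measurableType d) (R : realType) (m : {measure set T -> \bar R})
    (f g : T -> \bar R) : measurable_fun setT f -> (forall x, 0 <= f x)%E ->
  measurable_fun setT g -> (forall x, 0 <= g x)%E -> (\forall x \ae m, (f x <= g x)%E) ->
  (\int[m]_x f x <= \int[m]_x g x)%E.
Proof. by move=> mf f0 mg g0 fg; apply: ae_ge0_le_integral => //; apply: filterS fg. Qed.

Section approximate_eigenfunction.
Variables (R : realType) (n : nat).
Local Notation V := (Rn R n).
Local Notation B := (borelRn R n).
Local Notation leb := (@leb R n).
Local Notation C := ((2 * pi) ^+ n : R).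
Hypothesis leb_gt0 : (0 < leb setT)%E.
Variable a : V -> R[i].
Hypothesis La : Linf a.
Variables (g : B -> R[i]) (mg : cmeas g) (Lg : L12 (g : V -> R[i])).

Lemma normc_iFT_le (h : V -> R[i]) (x : V) (b : R) : L12 h -> (\int[leb]_xi (normc (h xi))%:E <= b%:E)%E ->
  normc (iFT h x) <= C^-1 * b.
Proof.
move=> [Ih _] hb; have C0 := pi2n_gt0 R n.
rewrite /iFT normcM normc_real ger0_norm ?invr_ge0 ?(ltW C0)// ler_wpM2l ?invr_ge0 ?(ltW C0)//.
apply: (le_trans (normc_FT 1 x Ih)); rewrite -lee_fin /N1 /Rintegral fineK//.
exact: (integrable_fin_num measurableT (cintegrable_normc Ih)).
Qed.

Lemma iFT_packet_bump (r del : R) (xi0 y x : V) : 0 < r ->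
  (forall x, enorm x < 1 -> iFT (g : V -> R[i]) x = 1) ->
  (forall x, 1 + 2 * del <= enorm x -> iFT (g : V -> R[i]) x = 0) ->
  (forall x, normc (iFT (g : V -> R[i]) x) <= 1) ->
  let u := iFT (wave_packet g r xi0 y : V -> R[i]) in
  [/\ eball y r x -> normc (u x) = 1, ~ eball y ((1 + 2 * del) * r) x -> u x = 0 & normc (u x) <= 1].
Proof.
move=> r0 g1 g0 gle u; have uE : u x = expi (dotp xi0 x) * iFT (g : V -> R[i]) (r^-1 *: (x - y)).
  exact: iFT_wave_packet.
have nE : enorm (r^-1 *: (x - y)) = r^-1 * enorm (x - y).
  by rewrite enormZ ger0_norm// invr_ge0 ltW.
split; rewrite uE.
- by move=> xr; rewrite g1 ?mulr1 ?normc_expi// nE ltr_pdivrMl// mulr1.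
- by move=> /negP; rewrite -leNgt => xr; rewrite g0 ?mulr0// nE ler_pdivlMl// mulrC.
- by rewrite normcM normc_expi mul1r.
Qed.

Variables (K : set B) (c : R[i]) (eps : R) (r_ : nat -> R).
Hypotheses (mK : measurable K) (K0 : (0 < leb (K : set V))%E) (Koo : (leb (K : set V) < +oo)%E).
Hypotheses (eps0 : 0 <= eps) (Kac : \forall x \ae leb, K x -> normc (a x - c) <= eps).
Hypotheses (r0 : forall j, 0 < r_ j) (rcvg : (r_ j)^-1 @[j --> \oo] --> (0 : R)).

(** [averaging] is applied to the displacements [(r_ j)^-1 *: eta], the positions of the rescaled
    [g] relative to [xi0]. Since [y] changes the packet by a phase only, the same [j] and [xi0]
    serve for all centres. *)
Lemma multiplier_wave_packet (d : R) : 0 < d -> exists j (xi0 : V), forall y,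
  let u := iFT (wave_packet g (r_ j) xi0 y : V -> R[i]) in
  L2 u /\ \forall x \ae leb, normc (fourier_multiplier a u x - c * u x) <= C^-1 * (eps * N1 (g : V -> R[i]) + d).
Proof.
move=> d0; have [M0 M00 aM] := Linf_norm_ae leb_gt0 La.
have [Ig _] := Lg; have [ma _] := La; have ma' : cmeas a := ma.
pose M := M0 + normc c; have M_0 : 0 <= M by rewrite addr_ge0// normc_ge0.
have M10 : 0 < M + 1 by rewrite ltr_wpDl.
have [j [xi0 [Kxi0 Hxi]]] := averaging mK K0 Koo Ig rcvg (divr_gt0 d0 M10).
exists j, xi0 => y u; have Lwp := L12_wave_packet xi0 y mg Lg (r0 j).
set wp := wave_packet g (r_ j) xi0 y in u Lwp *.
have [Iwp wp2] := Lwp; have mwp : cmeas (wp : V -> R[i]) := L12_meas Lwp.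
have mac : cmeas (fun x => (a x - c) * wp x).
  by apply: cmeasM mwp; apply: cmeasB => //; exact: cmeas_cst.
(* A Borel majorant of [normc (a x - c)], to which the change of variables [integral_wave_packet]
   applies, whereas [a] is only Lebesgue measurable. *)
pose h (x : B) : R := eps + M * (1 - \1_K x).
have h0 (x : B) : 0 <= h x.
  by rewrite addr_ge0// mulr_ge0// subr_ge0 indicE; case: (_ \in _).
have mh : measurable_fun setT h.
  apply: measurable_funD; first exact: measurable_cst.
  apply: measurable_funMl; apply: measurable_funB; first exact: measurable_cst.
  exact: measurable_indic.
have ach : \forall x \ae leb, normc (a x - c) <= h x.
  apply: filterS2 aM Kac => x ax Kx; rewrite /h indicE; have [xK|xK] := pselect (K x).
    by rewrite mem_set// subrr mulr0 addr0 Kx.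
  rewrite memNset// subr0 mulr1 (@le_trans _ _ M) ?lerDr//.
  have := ler_normcD (a x) 0 c; rewrite subr0 sub0r normcN => /le_trans; apply.
  by rewrite lerD2r.
have key : (\int[leb]_x (normc ((a x - c) * wp x))%:E <= (eps * N1 (g : V -> R[i]) + d)%:E)%E.
  apply: (@le_trans _ _ (\int[leb]_x (h x * normc (wp x))%:E)%E).
    apply: ae_ge0_le_integralT.
    - by apply/measurable_EFinP; exact: (measurable_normc mac).
    - by move=> x; rewrite lee_fin normc_ge0.
    - by apply/measurable_EFinP; exact: (measurable_funM (borel_measurable_fun mh) (measurable_normc mwp)).
    - by move=> x; rewrite lee_fin mulr_ge0 ?normc_ge0.
    by apply: filterS ach => x ax; rewrite lee_fin normcM ler_wpM2r ?normc_ge0.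
  rewrite (integral_wave_packet xi0 y mg (r0 j) mh h0).
  have mn : measurable_fun setT (fun x : V => normc (g x)) := measurable_normc (cintegrable_meas Ig).
  pose q (eta : V) : R := (1 - \1_K ((r_ j)^-1 *: eta + xi0)) * normc (g eta).
  have q0 eta : 0 <= q eta.
    by rewrite mulr_ge0 ?normc_ge0// subr_ge0 indicE; case: (_ \in _).
  have mq : measurable_fun setT q.
    have m1 : measurable_fun setT (fun eta : V => 1 - \1_K ((r_ j)^-1 *: eta + xi0) : R).
      have mK1 : measurable_fun setT (\1_K : B -> R) by exact: measurable_indic.
      have mi := borel_measurable_fun (measurableT_comp mK1 (measurable_affine (r_ j)^-1 xi0)).
      exact: (measurable_funB (measurable_cst (1 : R)) mi).
    exact: (measurable_funM m1 mn).
  have mnE : measurable_fun setT (fun x : V => (normc (g x))%:E) by apply/measurable_EFinP; exact: mn.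
  have mqE : measurable_fun setT (fun x : V => (q x)%:E) by apply/measurable_EFinP; exact: mq.
  have n0 (x : V) : (0 <= (normc (g x))%:E)%E by rewrite lee_fin normc_ge0.
  have q0' (x : V) : (0 <= (q x)%:E)%E by rewrite lee_fin.
  have -> : (\int[leb]_eta (h ((r_ j)^-1 *: eta + xi0)%R * normc (g eta))%:E =
     eps%:E * \int[leb]_eta (normc (g eta))%:E + M%:E * \int[leb]_eta (q eta)%:E)%E.
    rewrite -(ge0_integralZlT leb mnE n0); last by rewrite lee_fin.
    rewrite -(ge0_integralZlT leb mqE q0'); last by rewrite lee_fin.
    rewrite -(ge0_integralDT leb (measurable_funeM eps%:E mnE) _ (measurable_funeM M%:E mqE) _); last 2 first.
    - by move=> x; rewrite mule_ge0.
    - by move=> x; rewrite mule_ge0.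
    by apply: eq_integral => eta _; rewrite -!EFinM -EFinD; congr (_%:E); rewrite /h /q; ring.
  have -> : (eps * N1 (g : V -> R[i]) + d)%:E = (eps%:E * (N1 (g : V -> R[i]))%:E + d%:E)%E by rewrite -EFinM -EFinD.
  apply: leeD.
    rewrite /N1 /Rintegral fineK//.
    exact: (integrable_fin_num measurableT (cintegrable_normc Ig)).
  apply: (@le_trans _ _ (M%:E * (d / (M + 1))%:E)%E).
    by rewrite lee_wpmul2l// ltW.
  rewrite -EFinM lee_fin mulrA ler_pdivrMr// mulrC ler_wpM2l ?(ltW d0)//.
  by rewrite lerDl.
have Lac : L12 (fun x => (a x - c) * wp x).
  split; first by apply/(cintegrableP leb mac); exact: (le_lt_trans key (ltry _)).
  have /L2P[_] := L2DZ (- c) (L2_mul leb_gt0 La (L12_L2 Lwp)) (L12_L2 Lwp).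
  by congr (E2 _ _ < _)%E; apply/funext => x; rewrite mulrBl mulNr.
split; first exact: L2_iFT.
apply: filterS (multiplier_iFT leb_gt0 La Lwp Lac) => x ->.
exact: (normc_iFT_le x Lac key).
Qed.

End approximate_eigenfunction.

(** * Level sets and doubling *)

Section level_sets.

Lemma measure_gt0_bigcup d (T : measurableType d) (R : realType) (m : {measure set T -> \bar R})
    (E : set T) (F : nat -> set T) : measurable E -> (forall k, measurable (F k)) ->
  E `<=` \bigcup_k F k -> (0 < m E)%E -> exists k, (0 < m (E `&` F k))%E.
Proof.
move=> mE mF EF E0; apply: contrapT => H.
have H0 k : m (E `&` F k) = 0%E.
  apply/eqP/negPn/negP => n0; apply: H; exists k.
  by rewrite lt0e n0 measure_ge0.
have : m.-negligible E.
  apply: (@negligibleS _ _ _ _ (\bigcup_k (E `&` F k))); first by move=> x Ex; have [k _ Fkx] := EF x Ex; exists k.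
  by apply: negligible_bigcup => k; exists (E `&` F k); split => //; exact: measurableI.
by move=> /(negligibleP m mE) E0'; move: E0; rewrite E0' ltxx.
Qed.

(** Countably many strips of width [e] cover the values of [f], so one of them is hit with positive
    measure; bounding [f] below by [- k] first lets the natural numbers index the strips. *)
Lemma oscillation_le d (T : measurableType d) (R : realType) (m : {measure set T -> \bar R})
    (E : set T) (f : T -> R) (e : R) : measurable E -> measurable_fun setT f -> 0 < e -> (0 < m E)%E ->
  exists E', [/\ measurable E', E' `<=` E, (0 < m E')%E & forall x y, E' x -> E' y -> `|f x - f y| <= e].
Proof.
move=> mE mf e0 E0.
have mitv (i : interval R) : measurable (f @^-1` [set` i]).
  by rewrite -[X in measurable X]setTI; apply: mf.
have [|k k0] := measure_gt0_bigcup (F := fun k => f @^-1` `]- k%:R, +oo[) mE (fun k => mitv _) _ E0.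
  move=> x _; exists (Num.bound `|f x|) => //=; rewrite in_itv/= andbT ltrNl.
  by apply: (le_lt_trans (ler_norm _)); rewrite normrN; exact: archi_boundP.
have mEk : measurable (E `&` f @^-1` `]- k%:R, +oo[) by apply: measurableI.
have [|j j0] := measure_gt0_bigcup (F := fun j => f @^-1` `[j%:R * e - k%:R, j.+1%:R * e - k%:R]) mEk (fun k => mitv _) _ k0.
  move=> x [_ /=]; rewrite in_itv/= andbT => fx.
  have q0 : 0 <= (f x + k%:R) / e by rewrite divr_ge0 ?(ltW e0)//; lra.
  exists (Num.truncn ((f x + k%:R) / e)) => //=; rewrite in_itv/=.
  have /andP[h1 h2] := truncn_itv q0.
  by rewrite lerBlDr lerBrDr -ler_pdivlMr// h1/= -ler_pdivrMr// ltW.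
exists (E `&` f @^-1` `]- k%:R, +oo[ `&` f @^-1` `[j%:R * e - k%:R, j.+1%:R * e - k%:R]); split.
- by apply: measurableI.
- by move=> x [[]].
- exact: j0.
- move=> x y [_ /=] + [_ /=]; rewrite !in_itv/= => /andP[? ?] /andP[? ?].
  have jS : j.+1%:R * e = j%:R * e + e by rewrite -natr1 mulrDl mul1r.
  by rewrite ler_norml; lra.
Qed.

Variables (R : realType) (n : nat).
Local Notation V := (Rn R n).
Local Notation B := (borelRn R n).
Local Notation leb := (@leb R n).

(** [c] is a value of [a] at a point where its modulus exceeds [lam], which gives the strict bound
    on [normc c]; passing to a Borel hull costs a null set, hence the estimate almost everywhere. *)
Lemma level_set (a : V -> R[i]) (lam eps : R) : (0 < leb setT)%E -> measurable_cplx a -> 0 < eps ->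
  (lam%:E < Linf_norm a)%E -> exists (c : R[i]) (K : set B),
  [/\ measurable K, (0 < leb (K : set V))%E, (leb (K : set V) < +oo)%E, lam < normc c &
      \forall x \ae leb, K x -> normc (a x - c) <= eps].
Proof.
move=> leb_gt0 ma eps0 lamL; have ma' : cmeas a := ma; have [mr mi] := ma.
pose S0 := [set x | lam < normc (a x)].
have mS0 : measurable S0.
  have := measurable_normc ma' measurableT (measurable_itv `]lam, +oo[); rewrite setTI.
  by congr measurable; apply/seteqP; split => x /=; rewrite in_itv/= andbT.
have S0_gt0 : (0 < leb S0)%E.
  rewrite lt0e measure_ge0 andbT; apply/eqP => S00; move: lamL; rewrite ltNge => /negP; apply.
  apply: (Linf_norm_le leb_gt0); exists S0; split => // x /= /negP; rewrite -ltNge.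
  by [].
have [|k k0] := measure_gt0_bigcup (F := fun k => eball (0 : V) k%:R) mS0
    (fun k => borel_measurable (measurable_eball (0 : V) _)) _ S0_gt0.
  move=> x _; exists (Num.bound (enorm x)) => //; rewrite /eball/= subr0.
  exact: archi_boundP (enorm_ge0 x).
have mB := borel_measurable (measurable_eball (0 : V) k%:R).
have mS1 : measurable (S0 `&` eball (0 : V) k%:R) by apply: measurableI.
have e20 : 0 < eps / 2 by rewrite divr_gt0.
have [E1 [mE1 E1S E10 E1r]] := oscillation_le mS1 mr e20 k0.
have [E2 [mE2 E2S E20 E2i]] := oscillation_le mE1 mi e20 E10.
have E2oo : (leb E2 < +oo)%E.
  apply: (@le_lt_trans _ _ (leb (eball (0%R : V) k%:R))); last exact: (L12_indic_lty mB (L12_eball _ _)).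
  apply: le_measure; rewrite ?inE//; apply: (subset_trans E2S); apply: (subset_trans E1S).
  exact: subIsetr.
have [x0 E2x0] : exists x, E2 x.
  by apply: contrapT => H; move: E20; rewrite (_ : E2 = set0) ?measure0 ?ltxx//;
    apply/seteqP; split => // x E2x; apply: H; exists x.
have [K [mK E2K KE2]] := leb_borel_hull mE2 E2oo.
have mK' : measurable (K : set V) := borel_measurable mK.
have mD : measurable (K `\` E2 : set V) by exact: measurableD.
exists (a x0), K; split => //.
- by apply: (lt_le_trans E20); apply: le_measure; rewrite ?inE.
- have -> : (K : set V) = E2 `|` (K `\` E2) by rewrite setDUK.
  apply: (@le_lt_trans _ _ (leb E2 + leb (K `\` E2 : set V))%E); last by rewrite KE2 adde0.
  exact: measureU2.
- by have [] := E1S _ (E2S _ E2x0).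
- exists (K `\` E2); split => // x /= H; apply: contrapT => nKE; apply: H => Kx.
  have E2x : E2 x by apply: contrapT => nE; exact: nKE.
  apply: (le_trans (normc_le_ReIm _)); have h1 := E1r _ _ (E2S _ E2x) (E2S _ E2x0); have h2 := E2i _ _ E2x E2x0.
  have -> : complex.Re (a x - a x0) = complex.Re (a x) - complex.Re (a x0) by case: (a x) (a x0) => ? ? [].
  have -> : complex.Im (a x - a x0) = complex.Im (a x) - complex.Im (a x0) by case: (a x) (a x0) => ? ? [].
  by lra.
Qed.

End level_sets.

Lemma lte_div_mul (R : realType) (x y s : \bar R) : (0 < y)%E -> y \is a fin_num ->
  (x / y < s)%E = (x < s * y)%E.
Proof.
case: y => // r; rewrite lte_fin => r0 _; rewrite inver gt_eqF//.
by rewrite lte_pdivrMr.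
Qed.

(** * Concentric balls whose indicators have a ratio of norms close to 1 *)

Section doubling.
Variables (R : realType) (n : nat).
Local Notation V := (Rn R n).
Local Notation leb := (@leb R n).
Variables (rho : (V -> \bar R) -> \bar R).
Hypothesis hrho : banach_function_norm rho.
Variable Omega : set V.
Hypothesis leb_gt0 : (0 < leb setT)%E.
Local Notation p y r := (normXO rho (@chi R n Omega (eball y r))).

Lemma bounded_eball (y : V) r : bounded_set (eball y r).
Proof.
exists (enorm y + r); split; first exact: num_real.
move=> M rM x /= xr; apply: (@le_trans _ _ (enorm x)).
  have [->|x0] := eqVneq x 0; first by rewrite normr0 enorm_ge0.
  have [|i E] := @mx_norm_neq0 _ _ _ (x : 'rV[R]_n).
    by apply: contra x0 => /eqP/mx_norm_eq0 ->.
  by rewrite -[leLHS]/(mx_norm (x : 'rV[R]_n)) E (ord1 i.1); exact: normr_coord_le.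
by apply: (le_trans (ler_enorm_dist x y)); rewrite (le_trans _ (ltW rM))// lerD2l ltW.
Qed.

Lemma e_chi (E : set V) x : E `<=` Omega -> e_Omega (@chi R n Omega E) x = (\1_E x : R)%:C.
Proof.
move=> EO; rewrite /chi e_r_Omega !indicE; case: (boolP (x \in E)) => [/set_mem/EO/mem_set -> |_].
  by rewrite mulr1n mul1r.
by apply: eq_ReIm; rewrite ?ReZ ?ImZ/= mulr0.
Qed.

Lemma cmeas_indic (E : set V) : measurable E -> cmeas (fun x => (\1_E x : R)%:C).
Proof. by move=> mE; apply: cmeas_real; exact: measurable_indic. Qed.

Lemma normXO_chi (E : set V) : E `<=` Omega ->
  normXO rho (@chi R n Omega E) = normX rho (fun x => (\1_E x : R)%:C).
Proof. by move=> EO; rewrite /normXO; congr normX; apply/funext => x; exact: e_chi. Qed.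

Lemma normX_eball_fin (y : V) r : (normX rho (fun x => (\1_(eball y r) x : R)%:C) < +oo)%E.
Proof.
have := bfn_indic hrho (borel_measurable (measurable_eball y r)) (@bounded_eball y r).
by congr (rho _ < _)%E; apply/funext => x; rewrite /absC normc_indic.
Qed.

Lemma leb_eball_gt0c (y : V) r : 0 < r -> (0 < leb (eball y r))%E.
Proof.
move=> r0; have mB z := borel_measurable (measurable_eball (z : V) r).
suff -> : leb (eball y r) = leb (eball (0%R : V) r) by exact: leb_eball_gt0.
have iE z : leb (eball z r) = (\int[leb]_x (\1_(eball z r) x : R)%:E)%E.
  by rewrite (integral_indic leb measurableT (mB z)) setIT.
have mf : measurable_fun setT (fun x : borelRn R n => (\1_(eball (0 : V) r) x : R)%:E).
  by apply/measurable_EFinP; apply: measurable_indic; exact: measurable_eball.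
have f0 (x : borelRn R n) : (0 <= (\1_(eball (0%R : V) r) x : R)%:E)%E by rewrite lee_fin.
rewrite !iE -(ge0_integral_shift y mf f0); apply: eq_integral => x _; congr (_%:E).
rewrite !indicE; congr ((nat_of_bool _)%:R).
by apply/idP/idP => /set_mem H; apply/mem_set; move: H; rewrite /eball/= subr0.
Qed.

Lemma normX_eball_gt0 (y : V) r : 0 < r -> (0 < normX rho (fun x => (\1_(eball y r) x : R)%:C))%E.
Proof.
move=> r0; have mE := borel_measurable (measurable_eball y r).
rewrite lt0e (normX_ge0 hrho (cmeas_indic mE)) andbT.
apply/eqP => /(normX_eq0 hrho (cmeas_indic mE)) [N [mN N0 H]].
have := leb_eball_gt0c y r0; rewrite ltNge => /negP; apply; rewrite -N0.
apply: le_measure; rewrite ?inE// => x xr; apply: H => /=; rewrite indicE mem_set// => /(congr1 (@complex.Re R))/= /eqP.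
by rewrite oner_eq0.
Qed.

(* If the ratio exceeded [D] for all the radii [sig ^+ j * r], [j <= N], where
   [sig ^+ N.+1 = tau], then the ratio for [tau] would exceed [D ^+ N.+1]. *)
Lemma doubling_ball (D : R) : weak_doubling rho Omega -> 1 < D -> exists2 sig : R, 1 < sig &
  forall r0 : R, exists r y, [/\ r0 < r, eball y (sig * r) `<=` Omega &
    (normX rho (fun x => (\1_(eball y (sig * r)) x : R)%:C) <=
     D%:E * normX rho (fun x => (\1_(eball y r) x : R)%:C))%E].
Proof.
move=> [tau tau1 dtau] D1; set q := fun y r => normX rho (fun x : V => (\1_(eball y r) x : R)%:C).
have [M [M1 HM]] : exists M : R, 1 <= M /\ (doubling_const rho Omega tau < M%:E)%E.
  move: dtau; case: (doubling_const rho Omega tau) => [v _|//|_].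
  - exists (Num.max 1 (v + 1)); split; first by rewrite le_max lexx.
    by rewrite lte_fin lt_max ltrDl ltr01 orbT.
  - by exists 1; split; [exact: lexx|exact: ltNyr].
have D0 : 0 < D - 1 by rewrite subr_gt0.
(* By Bernoulli's inequality, [D ^+ N.+1] is then at least [M], a bound that exceeds the doubling
   constant. *)
pose N := Num.bound (M / (D - 1)).
have DN : M <= D ^+ N.+1.
  have := bernoulli_add N.+1 (ltW D0); rewrite subrKC; apply: le_trans.
  have : M / (D - 1) < N%:R by rewrite archi_boundP// divr_ge0 ?(ltW D0)// (le_trans ler01).
  by rewrite ltr_pdivrMr// -natr1 mulrDl mul1r; lra.
pose sig := expR (ln tau / N.+1%:R).
have tau0 : 0 < tau by exact: lt_trans ltr01 tau1.
have sigN : sig ^+ N.+1 = tau.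
  by rewrite /sig -expRM_natl mulrC divfK// lnK.
have sig1 : 1 < sig by rewrite expR_gt1 divr_gt0// ln_gt0.
exists sig; first exact: sig1.
(* The lower limit is tested on this neighbourhood of infinity: it contains a radius at which the
   infimum over the centres is less than [M]. An empty set of centres would give [+oo], so that a
   centre exists. *)
move=> r0; pose A := [set r : R | Num.max r0 0 < r].
have nA : pinfty_nbhs R A by exists (Num.max r0 0); split; [exact: num_real|].
move: HM; rewrite /doubling_const /limf_einf /limf_esup lteNl => HM.
have {}HM := lt_le_trans HM (ereal_inf_lbound (ex_intro2 _ _ A nA erefl)).
have [_ [r Ar <-]] := ereal_sup_gt HM.
rewrite /= => H0.
have {H0} : (- M%:E < - ereal_inf [set p y (tau * r) / p y r | y in [set y | eball y (tau * r) `<=` Omega]])%E := H0.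
rewrite lteN2 => /ereal_inf_lt[_ [y /= yO <-]].
move: Ar; rewrite /A/= gt_max => /andP[rr0 rp].
have ball_le s t : s <= t -> eball y s `<=` eball y t by move=> st x /= xs; exact: (lt_le_trans xs st).
have sig0 : 0 < sig by exact: lt_trans sig1.
have yrO : eball y r `<=` Omega.
  by apply: subset_trans yO; apply: ball_le; rewrite ler_peMl ?ltW.
rewrite (normXO_chi yO) (normXO_chi yrO) -/(q _ _) -/(q _ _) => Hq.
pose s j : R := sig ^+ j * r.
have qgt0 z t : 0 < t -> (0 < q z t)%E by exact: normX_eball_gt0.
have qltoo z t : (q z t < +oo)%E by exact: normX_eball_fin.
have [j [jN Hj]] : exists j, (j <= N)%N /\ (q y (s j.+1) <= D%:E * q y (s j))%E.
  apply: contrapT => H.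
  have step j : (j <= N.+1)%N -> ((D ^+ j)%:E * q y r <= q y (s j))%E.
    elim: j => [_|j IH jN]; first by rewrite /s !expr0 mul1e mul1r.
    have Hj : (D%:E * q y (s j) < q y (s j.+1))%E.
      by rewrite ltNge; apply/negP => Hle; apply: H; exists j.
    apply: le_trans (ltW Hj); rewrite exprS EFinM -muleA lee_wpmul2l//.
      by rewrite lee_fin; lra.
    by apply: IH; rewrite ltnW.
  have := step N.+1 (leqnn _); rewrite /s sigN leNgt => /negP; apply.
  apply: (@lt_le_trans _ _ (M%:E * q y r)%E); last by rewrite lee_wpmul2r ?lee_fin ?(ltW (qgt0 _ _ rp)).
  by rewrite -lte_div_mul ?qgt0// ge0_fin_numE ?qltoo// ltW ?qgt0.
exists (sig ^+ j * r), y; rewrite mulrA -exprS; split; last exact: Hj.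
- by apply: (lt_le_trans rr0); rewrite ler_peMl ?(ltW rp)// exprn_ege1// ltW.
- apply: subset_trans yO; apply: ball_le; rewrite ler_wpM2r ?(ltW rp)// -sigN.
  by rewrite ler_weXn2l// ltW.
Qed.

End doubling.

Theorem theorem1p2 (R : realType) (n : nat) (hn : (0 < n)%N)
  (rho : (Rn R n -> \bar R) -> \bar R) (hrho : banach_function_norm rho)
  (Omega : set (Rn R n)) (mOmega : measurable Omega)
  (hOmega : leb Omega = +oo%E) (hdoubling : weak_doubling rho Omega)
  (a : Rn R n -> complex R) (ha : multiplier rho a) :
  (Linf_norm a <= opnorm rho (@wiener_hopf R n rho Omega a))%E.
Proof.
have leb_gt0 : (0 < @leb R n setT)%E.
  have : (@leb R n Omega <= @leb R n setT)%E by apply: le_measure; rewrite ?inE.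
  by rewrite hOmega; apply: lt_le_trans; exact: ltry.
have [La _] := ha; have [ma Loo] := La.
have C0 := pi2n_gt0 R n; set C := (2 * pi) ^+ n in C0.
pose p y r := normX rho (fun x : Rn R n => (\1_(eball y r) x : R)%:C).
have pgt0 y r : 0 < r -> (0 < p y r)%E by exact: (normX_eball_gt0 hrho leb_gt0).
have pfin y r : 0 < r -> p y r \is a fin_num.
  by move=> r0; rewrite ge0_fin_numE ?(normX_eball_fin hrho)// ltW// pgt0.
have mBall y r := borel_measurable (measurable_eball (y : Rn R n) r).
set N := opnorm rho _.
(* Any [u] that vanishes outside a ball of [Omega] and has modulus 1 on a smaller one tests the
   operator norm. This is used for the wave packet, and with [k = 0] for an indicator in [N0]. *)
have test u y r s (k : R) : L2 u -> 0 < r -> 0 <= k -> r <= s -> eball y s `<=` Omega ->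
    (forall x, ~ eball y s x -> u x = 0) -> (forall x, normc (u x) <= 1) ->
    (forall x, eball y r x -> normc (u x) = 1) ->
    (\forall x \ae leb, eball y r x -> k <= normc (fourier_multiplier a u x)) ->
    (k%:E * p y r <= N * normXO rho (@r_Omega R n Omega u))%E /\
    (0 < normXO rho (@r_Omega R n Omega u) <= p y s)%E.
  move=> Lu r0 k0 rs sO u0 u1 ur Tu; have mu : cmeas u := L2_meas Lu.
  have rO : eball y r `<=` Omega by move=> x /= xr; apply: sO; exact: (lt_le_trans xr rs).
  have eE : e_Omega (@r_Omega R n Omega u) = u.
    apply/funext => x; rewrite e_r_Omega indicE; have [Ox|nO] := pselect (Omega x).
      by rewrite mem_set// mulr1n mul1r.
    by rewrite memNset// u0; [rewrite mulr0|move=> /sO].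
  have nu : normXO rho (@r_Omega R n Omega u) = normX rho u by rewrite /normXO eE.
  have mi t := cmeas_indic (mBall y t).
  have nus : (normX rho u <= p y s)%E.
    apply: (normX_le hrho mu (mi s)); apply: aeW => x; rewrite normc_indic indicE.
    have [xs|xs] := pselect (eball y s x); first by rewrite mem_set.
    by rewrite memNset// u0// normc0.
  have nur : (p y r <= normX rho u)%E.
    apply: (normX_le hrho (mi r) mu); apply: aeW => x; rewrite normc_indic indicE.
    have [xr|xr] := pselect (eball y r x); first by rewrite mem_set// ur.
    by rewrite memNset// normc_ge0.
  have s0 : 0 < s by exact: lt_le_trans r0 rs.
  have Xu : Xspace rho u.
    split; first exact: mu.
    by apply: (le_lt_trans nus); rewrite -ge0_fin_numE ?pfin// ltW// pgt0.
  have Lf : L2XO rho (@r_Omega R n Omega u) by split; rewrite ?/XO /= eE.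
  have nz : ~ ae_zero (e_Omega (@r_Omega R n Omega u)).
    rewrite eE => /(normX_eq0 hrho mu) u00; have := lt_le_trans (pgt0 y r r0) nur.
    by rewrite u00 ltxx.
  have := opnorm_wiener_hopf_ge hrho mOmega ha leb_gt0 Lf nz.
  rewrite nu => H; split; last by rewrite nus andbT; exact: lt_le_trans (pgt0 y r r0) nur.
  apply: le_trans H.
  have mA := wiener_hopf_meas mOmega ha leb_gt0 Lf.
  rewrite -[k](ger0_norm k0) -normc_real -(normXZ hrho _ (mi r)).
  apply: (normX_le hrho _ mA); first by apply: cmeasM (mi r); exact: cmeas_cst.
  apply: filterS Tu => x Tux; rewrite normcM normc_real normc_indic (ger0_norm k0) wiener_hopfE eE.
  rewrite normcM normc_indic !indicE; have [xr|xr] := pselect (eball y r x).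
    by rewrite (mem_set xr) (mem_set (rO _ xr)) mulr1 mul1r; exact: Tux.
  by rewrite (memNset xr) mulr0 mulr_ge0 ?normc_ge0.
(* An extended supremum over no functions would be [-oo]; the indicator of a ball in [Omega]
   excludes this. *)
have N0 : (0 <= N)%E.
  have D2 : 1 < 2 :> R by rewrite ltr1n.
  have [sig sig1 /(_ 0)[r [y [r0 yO _]]]] := doubling_ball hrho leb_gt0 hdoubling D2.
  have rO : eball y r `<=` Omega.
    by apply: subset_trans yO => x /= xr; apply: (lt_le_trans xr); rewrite ler_peMl// ltW.
  have Lb : L2 (fun x : Rn R n => (\1_(eball y r) x : R)%:C) := L12_L2 (L12_eball y r).
  have [||||H1 /andP[H2 _]] := test _ y r r 0 Lb r0 (lexx 0) (lexx r) rO.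
  - by move=> x xr; rewrite indicE memNset.
  - by move=> x; rewrite normc_indic indicE; case: (_ \in _).
  - by move=> x xr; rewrite normc_indic indicE mem_set.
  - by apply: aeW => x _; exact: normc_ge0.
  move: H1; rewrite mul0e; move: H2; set z := normXO _ _ => z0.
  by rewrite pmule_lge0.
rewrite leNgt; apply/negP => NL.
have Nfin : N \is a fin_num by rewrite ge0_fin_numE//; exact: lt_trans NL Loo.
have L0 : (0 <= Linf_norm a)%E by exact: le_trans N0 (ltW NL).
have Lfin : Linf_norm a \is a fin_num by rewrite ge0_fin_numE.
pose b := fine N; pose L := fine (Linf_norm a).
have bE : N = b%:E by rewrite fineK.
have LE : Linf_norm a = L%:E by rewrite fineK.
have bL : b < L by rewrite -lte_fin -bE -LE.
have b0 : 0 <= b by rewrite -lee_fin -bE.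
(* The gap is spent as follows: [gap / 4] on the distance of [normc c] to [L], [gap / 4] on the
   error of the packet, and the remaining half on [b * D] exceeding [b]. *)
pose gap := L - b; have gap0 : 0 < gap by rewrite subr_gt0.
(* [D] keeps [b * D] below [b + gap / 2]; the [+ 1] covers [b = 0]. *)
pose D := 1 + gap / (4 * (b + 1)).
have b10 : 0 < 4 * (b + 1) by rewrite mulr_gt0// ltr_wpDl.
have D1 : 1 < D by rewrite ltrDl divr_gt0.
have [sig sig1 dbl] := doubling_ball hrho leb_gt0 hdoubling D1.
have del0 : 0 < (sig - 1) / 2 by rewrite divr_gt0// subr_gt0.
have [g [mg Lg g1 g0 gle]] := bump_function leb_gt0 del0.
have sigE : 1 + 2 * ((sig - 1) / 2) = sig by field.
have n0 : 0 <= N1 (g : Rn R n -> R[i]) := N1_ge0 _.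
set ng := N1 _ in n0.
(* [eps * ng] and [d] are each at most half of [gap / 4 * C]; the factor [C] compensates the
   constant of [iFT]. *)
pose eps := gap / 4 * C / (2 * (ng + 1)).
have ng10 : 0 < 2 * (ng + 1) by rewrite mulr_gt0// ltr_wpDl.
have eps0 : 0 < eps by rewrite divr_gt0// mulr_gt0// divr_gt0.
pose d := gap / 4 * C / 2; have d0 : 0 < d by rewrite divr_gt0// mulr_gt0// divr_gt0.
have small : C^-1 * (eps * ng + d) <= gap / 4.
  rewrite ler_pdivrMl// /d /eps.
  have q0 : 0 < gap / 4 * C by rewrite mulr_gt0// divr_gt0.
  rewrite [C * _]mulrC; move: (gap / 4 * C) q0 => q q0.
  have : ng * (q / (2 * (ng + 1))) <= q / 2 by rewrite mulrA ler_pdivrMr//; nra.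
  by rewrite mulrC; lra.
have lamL : ((L - gap / 4)%:E < Linf_norm a)%E.
  by rewrite LE lte_fin ltrBlDr ltrDl divr_gt0.
have [c [K [mK K0 Koo lamc Kac]]] := level_set leb_gt0 ma eps0 lamL.
(* The centres are left aside for now: they depend on the radius, and [j] is only determined by
   [multiplier_wave_packet]. *)
have /choice[r_ Hr] : forall k : nat, exists r, k.+1%:R < r /\ exists y, eball y (sig * r) `<=` Omega /\
    (p y (sig * r)%R <= D%:E * p y r)%E.
  by move=> k; have [r [y [h1 h2 h3]]] := dbl k.+1%:R; exists r; split => //; exists y.
have r0 j : 0 < r_ j by have [h _] := Hr j; exact: lt_trans h.
have rcvg : (r_ j)^-1 @[j --> \oo] --> (0 : R).
  apply: (@squeeze_cvgr _ _ _ _ (cst 0) (@harmonic R)); [|exact: cvg_cst|exact: cvg_harmonic].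
  apply: nearW => j /=; have [h _] := Hr j; rewrite invr_ge0 (ltW (r0 j))/= /harmonic.
  by rewrite lef_pV2 ?posrE// ltW.
have [j [xi0 Hj]] := multiplier_wave_packet leb_gt0 La mg Lg mK K0 Koo (ltW eps0) Kac r0 rcvg d0.
have [_ [y [yO yD]]] := Hr j; have [Lu Tu] := Hj y.
set u := iFT _ in Lu Tu.
have uP x : [/\ eball y (r_ j) x -> normc (u x) = 1, ~ eball y (sig * r_ j) x -> u x = 0 & normc (u x) <= 1].
  by have := iFT_packet_bump mg Lg xi0 y x (r0 j) g1 g0 gle; rewrite sigE.
(* On the inner ball, the image of [u] has modulus at least [normc c - gap / 4], which exceeds
   [k]. *)
pose k := L - gap / 2.
have kE : k = b + gap / 2 by rewrite /k /gap; field.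
have k0 : 0 <= k by rewrite kE addr_ge0// divr_ge0// ltW.
have [|||||H1 /andP[H2 H3]] := test u y (r_ j) (sig * r_ j) k Lu (r0 j) k0 _ yO.
- by rewrite ler_peMl// ltW.
- by move=> x; have [] := uP x.
- by move=> x; have [] := uP x.
- by move=> x; have [] := uP x.
- apply: filterS Tu => x Tux xr; have [/(_ xr) u1 _ _] := uP x.
  have := ler_normc_distD (c * u x) (fourier_multiplier a u x).
  rewrite normcM u1 mulr1 -[normc (_ - fourier_multiplier _ _ _)]normcN opprB => h.
  have := le_trans Tux small; rewrite /k; move: h lamc; lra.
(* After division by the norm [p y (r_ j)], which is positive and finite, this contradicts the
   choice of [D]. *)
have : (k%:E * p y (r_ j) <= (b * D)%:E * p y (r_ j))%E.
  apply: (le_trans H1); rewrite bE EFinM -muleA lee_wpmul2l ?lee_fin//.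
  exact: le_trans H3 yD.
rewrite lee_pmul2r ?pfin ?pgt0// lee_fin kE /D.
rewrite leNgt => /negP; apply.
rewrite mulrDr mulr1 ltrD2l mulrA ltr_pdivrMr//.
nra.
Qed.
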